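(* Let $w_0\in\mathbb R$. Assume $\mathscr S^{*}\neq\varnothing$, that $U$ satisfies the utility assumption, and that we are in the whole-line setting. If $U(+\infty):=\lim_{x\to+\infty}U(x)<+\infty$, then there exists $\hat\phi\in\mathscr L$ such that $$u(w_0)=\inf_{S\in\mathscr S}\mathbb E_{\mathbb P}\big[U(W_T^S(w_0,\hat\phi))\big]<+\infty.$$
   Context: Fix $d,T\in\mathbb N$ and a filtered probability space $(\Omega,\mathcal F,\mathbb F=(\mathcal F_t)_{t=0}^T,\mathbb P)$ whose $\sigma$-algebras all contain the $\mathbb P$-null sets; random variables equal a.s. are identified. For $\mathcal G\subseteq\mathcal F$, $L^0(\mathcal G;\mathbb R^n)$ is the space of $\mathcal G$-measurable $\mathbb R^n$-valued random variables with the topology of convergence in probability. Let $\mathscr S$ be a nonempty family of $\mathbb F$-adapted $\mathbb R^d$-valued processes $S=(S_t)_{t=0}^T$, and write $\Delta S_t=S_t-S_{t-1}$. Let $\mathscr L=\prod_{t=1}^T L^0(\mathcal F_{t-1};\mathbb R^d)$. For $w\in\mathbb R$, $\phi\in\mathscr L$, $S\in\mathscr S$, set $W_t^S(w,\phi)=w+\sum_{s=1}^t\langle\phi_s,\Delta S_s\rangle$. For $S\in\mathscr S$ and $t\ge1$, $D_t^S(\omega)$ is the smallest affine subspace of $\mathbb R^d$ containing the support of the regular conditional distribution of $\Delta S_t$ given $\mathcal F_{t-1}$ at $\omega$. NA($S$) means: for every $\phi\in\mathscr L$, $W_T^S(0,\phi)\ge0$ a.s. implies $W_T^S(0,\phi)=0$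 a.s. $\mathscr S^{*}$ denotes the set of $S^*\in\mathscr S$ such that NA($S^*$) holds and, for every $S\in\mathscr S$ and $t$, $D_t^S\subseteq D_t^{S^*}$ a.s. Utility assumption: $U:\mathbb R\to\mathbb R\cup\{-\infty\}$ is non-decreasing, concave and upper semicontinuous. Whole-line setting: $U(x)>-\infty$ for all $x\in\mathbb R$, and every $\phi\in\mathscr L$ is admissible (i.e. $\mathscr L(w_0,S)=\mathscr L$ for all $S$). Value $u(w_0)=\sup_{\varphi\in\mathscr L}\inf_{S\in\mathscr S}\mathbb E_{\mathbb P}[U(W_T^S(w_0,\varphi))]$, with the convention that the expectation of a random variable whose positive and negative parts both have infinite expectation is $-\infty$. *)

(* Defs.v *)
From HB Require Import structures.
From mathcomp Require Import all_boot all_order all_algebra.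
From mathcomp Require Import all_classical all_reals all_analysis measurable_realfun.

Set Implicit Arguments.
Unset Strict Implicit.
Unset Printing Implicit Defensive.

Import Order.TTheory GRing.Theory Num.Theory.
Import numFieldNormedType.Exports.

Local Open Scope classical_set_scope.
Local Open Scope ring_scope.

Section defs.
Context {R : realType} {dO : measure_display} {Omega : measurableType dO}.
Variable (P : probability Omega R).
Variable (d : nat).

(* R^d is represented by d.-tuple R, equipped with the product (= Borel)
   sigma-algebra generated by the coordinate projections. *)
Notation Rd := (d.-tuple R).

Definition sub_measurable (G : set (set Omega)) {dV} {V : measurableType dV}
  (f : Omega -> V) : Prop :=
  forall B : set V, measurable B -> G (f @^-1` B).

Definition filtration (F : nat -> set (set Omega)) (T : nat) : Prop :=
  [/\ (forall t, (t <= T)%N -> sigma_algebra setT (F t)),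
      (forall t, (t <= T)%N -> F t `<=` measurable),
      (forall s t, (s <= t)%N -> (t <= T)%N -> F s `<=` F t) &
      (forall t, (t <= T)%N -> forall A, measurable A -> P A = 0%E -> F t A)].

Definition process := nat -> Omega -> Rd.

Definition adapted (F : nat -> set (set Omega)) (T : nat) (S : process) :=
  forall t, (t <= T)%N -> sub_measurable (F t) (S t).

Definition strategies (F : nat -> set (set Omega)) (T : nat) : set process :=
  [set phi | forall t, (1 <= t <= T)%N -> sub_measurable (F t.-1) (phi t)].

Definition dotp (x y : Rd) : R := \sum_(i < d) tnth x i * tnth y i.

Definition tsub (x y : Rd) : Rd := [tuple tnth x i - tnth y i | i < d].

Definition DeltaS (S : process) (t : nat) : Omega -> Rd :=
  fun w => tsub (S t w) (S t.-1 w).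

Definition wealth (S : process) (w : R) (phi : process) (t : nat) : Omega -> R :=
  fun om => w + \sum_(1 <= s < t.+1) dotp (phi s om) (DeltaS S s om).

Definition NA (F : nat -> set (set Omega)) (T : nat) (S : process) : Prop :=
  forall phi, strategies F T phi ->
    {ae P, forall om, 0 <= wealth S 0 phi T om} ->
    {ae P, forall om, wealth S 0 phi T om = 0}.

Definition rcd (G : set (set Omega)) (X : Omega -> Rd)
  (kappa : Omega -> probability Rd R) : Prop :=
  (forall B : set Rd, measurable B -> sub_measurable G (fun om => kappa om B : \bar R)) /\
  (forall B : set Rd, measurable B -> forall A, G A ->
     P (A `&` X @^-1` B) = (\int[P]_(om in A) kappa om B)%E).

Definition boxball (x : Rd) (e : R) : set Rd :=
  [set y | forall i : 'I_d, `|tnth y i - tnth x i| < e].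

Definition support (mu : set Rd -> \bar R) : set Rd :=
  [set x | forall e : R, 0 < e -> (0 < mu (boxball x e))%E].

Definition affine_comb (l : R) (x y : Rd) : Rd :=
  [tuple l * tnth x i + (1 - l) * tnth y i | i < d].

Definition affine_set (A : set Rd) : Prop :=
  forall x y, A x -> A y -> forall l : R, A (affine_comb l x y).

Definition affine_hull (A : set Rd) : set Rd :=
  [set x | forall B, affine_set B -> A `<=` B -> B x].

(* D_t^S(om) = affine hull of the support of the r.c.d. of Delta S_t
   given F_{t-1}, evaluated at om *)
Definition D_incl (F : nat -> set (set Omega)) (T : nat) (S S' : process) : Prop :=
  forall t, (1 <= t <= T)%N ->
  forall kappa kappa',
    rcd (F t.-1) (DeltaS S t) kappa -> rcd (F t.-1) (DeltaS S' t) kappa' ->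
    {ae P, forall om, affine_hull (support (kappa om)) `<=`
                      affine_hull (support (kappa' om))}.

Definition Sstar (F : nat -> set (set Omega)) (T : nat) (Sfam : set process) :
  set process :=
  [set S' | [/\ Sfam S', NA F T S' & forall S, Sfam S -> D_incl F T S S']].

(* expectation with the convention (+oo) - (+oo) = -oo *)
Definition Econv (X : Omega -> \bar R) : \bar R :=
  if ((\int[P]_om (X^\+ om))%E == +oo%E) && ((\int[P]_om (X^\- om))%E == +oo%E)
  then (-oo)%E
  else (\int[P]_om (X^\+ om) - \int[P]_om (X^\- om))%E.

Definition utility (U : R -> \bar R) : Prop :=
  [/\ (forall x, U x != +oo%E),
      (forall x y : R, x <= y -> (U x <= U y)%E),
      (forall (x y l : R), (0 <= l <= 1)%R ->
         (l%:E * U x + (1 - l)%R%:E * U y <= U (l * x + (1 - l) * y)%R)%E) &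
      (forall (x : R) (c : \bar R), (U x < c)%E -> \forall y \near x, (U y < c)%E)].

Definition robust_value (F : nat -> set (set Omega)) (T : nat)
  (Sfam : set process) (U : R -> \bar R) (phi : process) (w0 : R) : \bar R :=
  ereal_inf [set Econv (fun om => U (wealth S w0 phi T om)) | S in Sfam].

Definition value (F : nat -> set (set Omega)) (T : nat)
  (Sfam : set process) (U : R -> \bar R) (w0 : R) : \bar R :=
  ereal_sup [set robust_value F T Sfam U phi w0 | phi in strategies F T].

End defs.

(* Main.v *)
Require Import Defs.
From HB Require Import structures.
From mathcomp Require Import all_boot all_order all_algebra.
From mathcomp Require Import all_classical all_reals all_analysis measurable_realfun.
From mathcomp Require Import ring lra.

Set Implicit Arguments.
Unset Strict Implicit.
Unset Printing Implicit Defensive.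

Import Order.TTheory GRing.Theory Num.Theory.
Import numFieldNormedType.Exports.

Local Open Scope classical_set_scope.
Local Open Scope ring_scope.

(* The library's notation, with X read in ring_scope. *)
Local Notation "''E_' P [ X ]" := (expectation P X%R) : ereal_scope.

(* Write V = sup U - U >= 0, a convex nonincreasing loss, so that an optimal
   strategy minimises the supremum over S of the expected loss E[V(W_T^S)].

   If h_t is predictable and <h_t, Delta S*_t> = 0 almost surely, then the
   conditional support of Delta S*_t, hence its affine hull, lies in the
   orthogonal complement of h_t; by the inclusion of the affine hulls
   <h_t, Delta S_t> = 0 for every S.  Subtracting from a strategy its pointwise
   projection onto these null directions therefore leaves all wealths unchanged.

   For reduced strategies, the no-arbitrage condition for S* yields, one period at
   a time, a predictable weight alpha > 0 with
   alpha (w^- + |h|) <= E[gamma (w + <h, Delta S*>)^- | F_{t-1}] whenever w <= 0: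
   on each orthant the right-hand side is a conditional minimum over the unit
   simplex, which can only vanish along an arbitrage.  Since V dominates a multiple
   of x^- up to a constant (unless it is constant), iterating backward and then
   forward in time bounds near-optimal reduced strategies in L^1 of an equivalent
   measure.

   Finally, from a decreasing sequence of convex sets bounded in such an L^1 one
   can extract an almost surely convergent sequence, by nearly minimising
   E[exp(-.)] over positive and negative parts; Fatou's lemma for V shows that the
   limit of near-optimal reduced strategies is optimal. *)

(** * Expectations and almost sure convergence *)

Section ge0_expectation.
Context {R : realType} {dO : measure_display} {Omega : measurableType dO}.
Variable P : probability Omega R.
Implicit Types f g : Omega -> R.

Lemma eq_expectation f g : f =1 g -> ('E_P[f] = 'E_P[g])%E.
Proof. by move=> /funext ->. Qed.

Lemma ge0_expectation_le f g : measurable_fun setT f -> measurable_fun setT g ->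
  (forall x, 0 <= f x) -> (forall x, f x <= g x) -> ('E_P[f] <= 'E_P[g])%E.
Proof.
move=> mf mg f0 fg; apply: expectation_le => //; last exact: nearW.
by move=> x; apply: le_trans (fg x).
Qed.

Lemma ge0_ae_eq_expectation f g :
  measurable_fun setT f -> measurable_fun setT g ->
  (forall x, 0 <= f x) -> (forall x, 0 <= g x) ->
  {ae P, forall x, f x = g x} -> ('E_P[f] = 'E_P[g])%E.
Proof.
move=> mf mg f0 g0 fg; apply/eqP; rewrite eq_le.
by rewrite !expectation_le//; apply: filterS fg => x ->.
Qed.

Lemma ge0_expectationD f g : measurable_fun setT f -> measurable_fun setT g ->
  (forall x, 0 <= f x) -> (forall x, 0 <= g x) ->
  ('E_P[fun x => f x + g x] = 'E_P[f] + 'E_P[g])%E.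
Proof.
move=> /measurable_EFinP mf /measurable_EFinP mg f0 g0.
by rewrite unlock -ge0_integralD// => x _; rewrite lee_fin.
Qed.

Lemma ge0_expectationZl k f : 0 <= k -> measurable_fun setT f ->
  (forall x, 0 <= f x) -> ('E_P[fun x => k * f x] = k%:E * 'E_P[f])%E.
Proof.
move=> k0 /measurable_EFinP mf f0.
by rewrite unlock -ge0_integralZl_EFin// => x _; rewrite lee_fin.
Qed.

Lemma ge0_expectation_sum (I : Type) (s : seq I) (f : I -> Omega -> R) :
  (forall i, measurable_fun setT (f i)) -> (forall i x, 0 <= f i x) ->
  ('E_P[fun x => (\sum_(i <- s) f i x)%R] = \sum_(i <- s) 'E_P[f i])%E.
Proof.
move=> mf f0; rewrite unlock -ge0_integral_sum//.
- by apply: eq_integral => x _; rewrite sumEFin.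
- by move=> i; exact/measurable_EFinP.
- by move=> i x _; rewrite lee_fin.
Qed.

Lemma expectation_bounded_fin_num f K : measurable_fun setT f ->
  (forall x, 0 <= f x <= K) -> ('E_P[f])%E \is a fin_num.
Proof.
move=> mf fK; rewrite ge0_fin_numE; last first.
  by apply: expectation_ge0 => x; case/andP: (fK x).
apply: (@le_lt_trans _ _ ('E_P[cst K])%E); last by rewrite expectation_cst ltry.
by apply: ge0_expectation_le => // x; case/andP: (fK x).
Qed.

Lemma ae_nneseries_lty (f : nat -> Omega -> R) :
  (forall n, measurable_fun setT (f n)) -> (forall n x, 0 <= f n x) ->
  (\sum_(0 <= n <oo) 'E_P[f n] < +oo)%E ->
  {ae P, forall x, (\sum_(0 <= n <oo) (f n x)%:E < +oo)%E}.
Proof.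
move=> mf f0 fin.
have mEf n : measurable_fun setT (EFin \o f n) by exact/measurable_EFinP.
have sum_ge0 x : (0 <= \sum_(0 <= n <oo) (f n x)%:E)%E.
  by apply: nneseries_ge0 => n _ _; rewrite lee_fin.
have : P.-integrable setT (fun x => \sum_(0 <= n <oo) (f n x)%:E)%E.
  apply/integrableP; split.
    apply: (@ge0_emeasurable_sum _ _ _ _ (fun n x => (f n x)%:E) predT).
      by move=> n x _ _; rewrite lee_fin.
    by move=> n _; exact: mEf.
  under eq_integral => x _ do rewrite gee0_abs ?sum_ge0//.
  rewrite integral_nneseries//; last by move=> n x _; rewrite lee_fin.
  by move: fin; rewrite expectation.unlock.
move=> /(integrable_ae measurableT); apply: filterS => x /(_ Logic.I).
by rewrite ge0_fin_numE.
Qed.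

End ge0_expectation.

Section increments.
Context {R : realType}.

Lemma is_cvg_summable_increments (u : R^nat) :
  (\sum_(0 <= n <oo) `|u n.+1 - u n|%:E < +oo)%E -> cvgn u.
Proof.
move=> fin; have cvg_tele : cvgn (series (telescope u)).
  apply: normed_cvg; apply: nondecreasing_is_cvgn.
    apply/nondecreasing_seqP => n.
    by rewrite /normed_series_of /series/= big_nat_recr//= lerDl normr_ge0.
  exists (fine (\sum_(0 <= n <oo) `|u n.+1 - u n|%:E)) => _ [n _ <-].
  rewrite -lee_fin fineK; last first.
    by rewrite ge0_fin_numE// nneseries_ge0// => *; rewrite lee_fin.
  rewrite /normed_series_of /series /= -sumEFin.
  by apply: nneseries_lim_ge => k _ _; rewrite lee_fin.
rewrite (_ : u = fun n => u 0%N + series (telescope u) n); last first.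
  by apply/funext => n; exact: eq_sum_telescope.
by apply: is_cvgD => //; exact: is_cvg_cst.
Qed.

Lemma nneseries_geometric_half_lty (C : R) (a : (\bar R)^nat) :
  (forall n, (0 <= a n <= (C * 2^-1 ^+ n)%:E)%E) ->
  (\sum_(0 <= n <oo) a n < +oo)%E.
Proof.
move=> aC; have C0 : 0 <= C.
  have /andP[a0 /(le_trans a0)] := aC 0%N.
  by rewrite expr0 mulr1 lee_fin.
apply: (@le_lt_trans _ _ (C / (1 - 2^-1))%:E); last exact: ltry.
apply: lime_le.
  by apply: is_cvg_nneseries => n _ _; case/andP: (aC n).
apply: nearW => n.
apply: (@le_trans _ _ (\sum_(0 <= i < n) (C * 2^-1 ^+ i)%:E)%E).
  by apply: lee_sum => i _; case/andP: (aC i).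
rewrite sumEFin lee_fin.
by apply: (geometric_le_lim n C0); rewrite ?ger0_norm; lra.
Qed.

End increments.

Section ae_cvg.
Context {R : realType} {dO : measure_display} {Omega : measurableType dO}.
Variable P : probability Omega R.

Lemma ae_cvg_geometric_increments (u : nat -> Omega -> R) (C : R) :
  (forall n, measurable_fun setT (u n)) ->
  (forall n, ('E_P[fun x => `|u n.+1 x - u n x|] <= (C * 2^-1 ^+ n)%:E)%E) ->
  {ae P, forall x, cvgn (u^~ x)}.
Proof.
move=> mu uC; pose incr n x := `|u n.+1 x - u n x|.
have mincr n : measurable_fun setT (incr n).
  by apply: measurableT_comp => //; exact: measurable_funB.
have incr_ge0 n x : 0 <= incr n x by exact: normr_ge0.
have fin : (\sum_(0 <= n <oo) 'E_P[incr n] < +oo)%E.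
  apply: (@nneseries_geometric_half_lty _ C) => n.
  by apply/andP; split; [exact: expectation_ge0|exact: uC].
apply: filterS (ae_nneseries_lty mincr incr_ge0 fin) => x.
exact: is_cvg_summable_increments.
Qed.

Lemma ae_cvg_geometric_sqr_increments (u : nat -> Omega -> R) (C : R) :
  (forall n, measurable_fun setT (u n)) ->
  (forall n,
    ('E_P[fun x => (u n.+1 x - u n x) ^+ 2] <= (C * 4^-1 ^+ n)%:E)%E) ->
  {ae P, forall x, cvgn (u^~ x)}.
Proof.
move=> mu uC; apply: (@ae_cvg_geometric_increments _ (C + 1)) => // n.
have mincr : measurable_fun setT (fun x => u n.+1 x - u n x).
  exact: measurable_funB.
have msqr : measurable_fun setT (fun x => (u n.+1 x - u n x) ^+ 2).
  exact: measurable_funX.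
(* AM-GM: [|t| <= 2^n t^2 + 2^-n] *)
have norm_le (t : R) : `|t| <= 2 ^+ n * t ^+ 2 + 2^-1 ^+ n.
  rewrite -[t ^+ 2]real_normK ?num_real// exprVn.
  have : 0 <= (2 ^+ n)^-1 * (2 ^+ n * `|t| - 1) ^+ 2.
    by rewrite mulr_ge0 ?sqr_ge0// invr_ge0 ltW.
  have -> : (2 ^+ n)^-1 * (2 ^+ n * `|t| - 1) ^+ 2 =
      2 ^+ n * `|t| ^+ 2 + (2 ^+ n)^-1 - 2 * `|t|.
    by field; rewrite gt_eqF.
  by have := normr_ge0 t; lra.
apply: (@le_trans _ _
  ('E_P[fun x => 2 ^+ n * (u n.+1 x - u n x) ^+ 2 + 2^-1 ^+ n])%E).
  apply: ge0_expectation_le => //; first exact: measurableT_comp.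
  by apply: measurable_funD => //; exact: measurable_funM.
rewrite ge0_expectationD//; first last.
- by move=> x; rewrite mulr_ge0 ?sqr_ge0// ltW.
- exact: measurable_funM.
rewrite ge0_expectationZl//; last by move=> x; exact: sqr_ge0.
rewrite expectation_cst mulrDl mul1r EFinD leeD2r//.
apply: (@le_trans _ _ ((2 ^+ n)%:E * (C * 4^-1 ^+ n)%:E)%E).
  by rewrite lee_pmul2l// lte_fin.
rewrite -EFinM lee_fin mulrCA (_ : 4^-1 = 2^-1 * 2^-1); last by field.
by rewrite exprMn [2 ^+ n * _]mulrA -exprMn divff// expr1n mul1r.
Qed.

End ae_cvg.

Section near_minimizers.
Context {R : realType} {X : Type}.
Variables (mid : X -> X -> X) (D : nat -> set X) (f : X -> R) (m M : R).
Hypothesis D_nonincr : forall n, D n.+1 `<=` D n.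
Hypothesis D_neq0 : forall n, D n !=set0.
Hypothesis D_mid : forall n y z, D n y -> D n z -> D n (mid y z).
Hypothesis f_bounded : forall n y, D n y -> m <= f y <= M.

Let D_anti n k : (n <= k)%N -> D k `<=` D n.
Proof.
elim: k => [|k IH]; first by rewrite leqn0 => /eqP ->.
rewrite leq_eqVlt => /orP[/eqP -> //|]; rewrite ltnS => /IH.
exact: subset_trans.
Qed.

Let v n := inf (f @` D n).

Let has_inf_f n : has_inf (f @` D n).
Proof.
split; first by have [y Dy] := D_neq0 n; exists (f y), y.
by exists m => _ [y /f_bounded/andP[? _] <-].
Qed.

Let v_le n y : D n y -> v n <= f y.
Proof. by move=> Dy; apply: ge_inf; [case: (has_inf_f n)|exists y]. Qed.

Let v_homo n k : (n <= k)%N -> v n <= v k.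
Proof.
move=> nk; apply: lb_le_inf; first by case: (has_inf_f k).
by move=> _ [y /(D_anti nk) Dy <-]; exact: v_le.
Qed.

Let has_sup_v : has_sup (range v).
Proof.
split; first by exists (v 0%N), 0%N.
exists M => _ [n _ <-]; have [y Dy] := D_neq0 n.
by apply: (le_trans (v_le Dy)); case/andP: (f_bounded Dy).
Qed.

(* The infima over D n increase to a limit vs, hence a midpoint taken in D n
   cannot bring the value much below vs. *)
Lemma near_minimizers (e : nat -> R) :
  (forall n, 0 < e n) -> (forall n, e n.+1 <= e n) ->
  exists z, (forall n, D n (z n)) /\
    forall n, f (z n) + f (z n.+1) - 2 * f (mid (z n) (z n.+1)) <= 4 * e n.
Proof.
move=> e_gt0 e_nonincr; pose vs := sup (range v).
have v_le_sup n : v n <= vs by apply: ub_le_sup; [case: has_sup_v|exists n].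
have near_sup n : exists p : nat * X, [/\ (n <= p.1)%N, D p.1 p.2,
    f p.2 <= vs + e n & vs - e n <= v p.1].
  have [_ [k _ <-] vs_k] := sup_adherent (e_gt0 n) has_sup_v.
  have [_ [y Dy <-] fy] := inf_adherent (e_gt0 n) (has_inf_f (maxn k n)).
  exists (maxn k n, y); split => //=; first exact: leq_maxr.
    by apply: (le_trans (ltW fy)); rewrite lerD2r; exact: v_le_sup.
  by apply: (le_trans (ltW vs_k)); apply: v_homo; exact: leq_maxl.
have [p pP] := choice near_sup; exists (fun n => (p n).2); split => n.
  by have [np Dp _ _] := pP n; exact: D_anti np _ Dp.
have [_ D1 f1 v1] := pP n; have [_ D2 f2 v2] := pP n.+1.
pose N := minn (p n).1 (p n.+1).1.
have DN : D N (mid (p n).2 (p n.+1).2).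
  by apply: D_mid; [apply: D_anti D1; exact: geq_minl
                   |apply: D_anti D2; exact: geq_minr].
have vN : vs - e n <= v N.
  by rewrite /N /minn; case: ifP => // _; have := e_nonincr n; lra.
have := v_le DN; have := e_nonincr n; lra.
Qed.

End near_minimizers.

Section exponential_gap.
Context {R : realType} {dO : measure_display} {Omega : measurableType dO}.
Variable P : probability Omega R.
Variable J : finType.
Implicit Types y z : J -> Omega -> R.

Definition midpoint y z : J -> Omega -> R := fun j x => (y j x + z j x) / 2.

Definition expN_cost z := fine ('E_P[fun x => \sum_j expR (- z j x)])%E.

Definition ge0_measurable z :=
  forall j, measurable_fun setT (z j) /\ forall x, 0 <= z j x.

Let sum_expN_bounded z x : ge0_measurable z ->
  0 <= \sum_j expR (- z j x) <= #|J|%:R.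
Proof.
move=> mz; rewrite sumr_ge0/= => [|j _]; last exact: expR_ge0.
rewrite -[#|J|%:R](@sumr_const _ _ J 1); apply: ler_sum => j _.
by rewrite -expR0 ler_expR oppr_le0; case: (mz j).
Qed.

Lemma measurable_expN (z : Omega -> R) : measurable_fun setT z ->
  measurable_fun setT (fun x => expR (- z x)).
Proof. by move=> mz; do 2!apply: measurableT_comp => //. Qed.

Let measurable_sum_expN z : ge0_measurable z ->
  measurable_fun setT (fun x => \sum_j expR (- z j x)).
Proof.
by move=> mz; apply: measurable_sum => j; apply: measurable_expN; case: (mz j).
Qed.

Lemma expN_costE z : ge0_measurable z ->
  ('E_P[fun x => \sum_j expR (- z j x)] = (expN_cost z)%:E)%E.
Proof.
move=> mz; rewrite fineK//; apply: (@expectation_bounded_fin_num _ _ _ _ _ #|J|%:R).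
  exact: measurable_sum_expN.
by move=> x; exact: sum_expN_bounded.
Qed.

Lemma expN_cost_bounded z : ge0_measurable z -> 0 <= expN_cost z <= #|J|%:R.
Proof.
move=> mz; rewrite -!lee_fin -expN_costE// -(expectation_cst P #|J|%:R).
apply/andP; split.
  by apply: expectation_ge0 => x; case/andP: (sum_expN_bounded x mz).
apply: ge0_expectation_le => //; first exact: measurable_sum_expN.
  by move=> x; case/andP: (sum_expN_bounded x mz).
by move=> x; case/andP: (sum_expN_bounded x mz).
Qed.

(* (e^(-a/2) - e^(-b/2))^2 = e^(-a) + e^(-b) - 2 e^(-(a+b)/2) *)
Lemma expectation_sqr_expN_half y z :
  ge0_measurable y -> ge0_measurable z -> ge0_measurable (midpoint y z) ->
  ('E_P[fun x => \sum_j (expR (- (z j x / 2)) - expR (- (y j x / 2))) ^+ 2] =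
   (expN_cost y + expN_cost z - 2 * expN_cost (midpoint y z))%:E)%E.
Proof.
move=> my mz mm; set Q := ('E_P[_])%E.
have mQ : measurable_fun setT
    (fun x => \sum_j (expR (- (z j x / 2)) - expR (- (y j x / 2))) ^+ 2).
  apply: measurable_sum => j; apply: measurable_funX; apply: measurable_funB.
    by apply: measurable_expN; apply: measurable_funM => //; case: (mz j).
  by apply: measurable_expN; apply: measurable_funM => //; case: (my j).
have sum_ge0 w x : 0 <= \sum_(j : J) expR (- w j x) :> R.
  by apply: sumr_ge0 => j _; exact: expR_ge0.
have QD : (Q + (2 * expN_cost (midpoint y z))%:E =
    (expN_cost y)%:E + (expN_cost z)%:E)%E.
  rewrite EFinM -!expN_costE// -ge0_expectationZl//; last first.
    exact: measurable_sum_expN.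
  rewrite -!ge0_expectationD//; first last.
  - by move=> x; rewrite mulr_ge0.
  - by move=> x; apply: sumr_ge0 => j _; exact: sqr_ge0.
  - by apply: measurable_funM => //; exact: measurable_sum_expN.
  - exact: measurable_sum_expN.
  - exact: measurable_sum_expN.
  apply: eq_expectation => x; rewrite mulr_sumr -!big_split/=.
  apply: eq_bigr => j _; rewrite /midpoint.
  have expN_sqr a : expR (- a) = expR (- (a / 2)) ^+ 2 :> R.
    by rewrite -expRM_natl; congr expR; field.
  rewrite (expN_sqr (y j x)) (expN_sqr (z j x)).
  have -> : expR (- ((y j x + z j x) / 2)) =
      expR (- (y j x / 2)) * expR (- (z j x / 2)) :> R.
    by rewrite -expRD; congr expR; field.
  by ring.
move: QD; case: Q => // q; rewrite -!EFinD => -[qE].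
by congr (_%:E); lra.
Qed.

Lemma midpoint_convex_ae_cvg_expN (D : nat -> set (J -> Omega -> R)) :
  (forall n, D n.+1 `<=` D n) -> (forall n, D n !=set0) ->
  (forall n y z, D n y -> D n z -> D n (midpoint y z)) ->
  (forall n, D n `<=` ge0_measurable) ->
  exists z : nat -> J -> Omega -> R, (forall n, D n (z n)) /\
    {ae P, forall x, forall j, cvgn (fun n => expR (- (z n j x / 2)))}.
Proof.
move=> D_nonincr D_neq0 D_mid Dm.
have D_bounded n y : D n y -> 0 <= expN_cost y <= #|J|%:R.
  by move=> /Dm; exact: expN_cost_bounded.
have [||z [Dz gap]] := near_minimizers D_nonincr D_neq0 D_mid D_bounded
  (e := fun n => 4^-1 ^+ n).
- by move=> n; rewrite exprn_gt0.
- by move=> n; rewrite exprS ger_pMl ?exprn_gt0//; lra.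
exists z; split => //.
have mz n : ge0_measurable (z n) by exact: Dm (Dz n).
have mexp n j : measurable_fun setT (fun x => expR (- (z n j x / 2))).
  by apply: measurable_expN; apply: measurable_funM => //; case: (mz n j).
apply: filter_forall => j.
apply: (@ae_cvg_geometric_sqr_increments _ _ _ _ _ 4) => // n.
have mincr k : measurable_fun setT
    (fun x => (expR (- (z n.+1 k x / 2)) - expR (- (z n k x / 2))) ^+ 2).
  by apply: measurable_funX; exact: measurable_funB.
apply: (@le_trans _ _ ('E_P[fun x => \sum_k
    (expR (- (z n.+1 k x / 2)) - expR (- (z n k x / 2))) ^+ 2])%E); last first.
  rewrite expectation_sqr_expN_half ?lee_fin//; apply: Dm (D_mid n _ _ _ _) => //.
  exact: D_nonincr.
apply: ge0_expectation_le => //.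
- by apply: measurable_sum => k; exact: mincr.
- by move=> x; exact: sqr_ge0.
- move=> x; rewrite (bigD1 j)//= lerDl.
  by apply: sumr_ge0 => k _; exact: sqr_ge0.
Qed.

End exponential_gap.

Section fatou.
Context {R : realType} {dO : measure_display} {Omega : measurableType dO}.
Variable P : probability Omega R.

Lemma limn_einf_ge (u : (\bar R)^nat) c :
  (\forall n \near \oo, (c <= u n)%E) -> (c <= limn_einf u)%E.
Proof.
move=> [N _ cu]; rewrite limn_einf_lim; apply: lime_ge; first exact: is_cvg_einfs.
exists N => // n /= Nn; apply: le_ereal_inf_tmp => _ [k /= nk <-].
by apply: cu => /=; exact: leq_trans nk.
Qed.

Lemma limn_einf_le (u : (\bar R)^nat) (a : R) :
  (forall n, (u n <= (a + n.+1%:R^-1)%:E)%E) -> (limn_einf u <= a%:E)%E.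
Proof.
move=> ua; apply/lee_addgt0Pr => e e0; rewrite limn_einf_lim.
apply: lime_le; first exact: is_cvg_einfs.
have : \forall n \near \oo, n.+1%:R^-1 < e.
  exact: near_infty_natSinv_lt (PosNum e0).
apply: filterS => n ne; apply: (@le_trans _ _ (u n)).
  by apply: ereal_inf_lbound; exists n => /=.
by apply: (le_trans (ua n)); rewrite -EFinD lee_fin lerD2l ltW.
Qed.

Lemma measurable_fun_limn_einf (f : nat -> Omega -> \bar R) :
  (forall n, measurable_fun setT (f n)) ->
  measurable_fun setT (fun x => limn_einf (f^~ x)).
Proof.
move=> mf; rewrite (_ : (fun x => _) =
    (fun x => - limn_esup (fun n => - f n x))%E); last first.
  by apply/funext => x; rewrite -[LHS]oppeK -limn_esupN.
apply: measurableT_comp => //; apply: measurable_fun_limn_esup => n.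
exact: measurableT_comp.
Qed.

Lemma expectation_fatou (f : nat -> Omega -> R) (g : Omega -> R) (a : R) :
  (forall n, measurable_fun setT (f n)) -> (forall n x, 0 <= f n x) ->
  measurable_fun setT g -> (forall x, 0 <= g x) ->
  {ae P, forall x, forall c, c < g x -> \forall n \near \oo, c <= f n x} ->
  (forall n, ('E_P[f n] <= (a + n.+1%:R^-1)%:E)%E) -> ('E_P[g] <= a%:E)%E.
Proof.
move=> mf f0 mg g0 gf fa; rewrite expectation.unlock in fa *.
have mEf n : measurable_fun setT (EFin \o f n) by exact/measurable_EFinP.
have Ef0 n x : setT x -> (0 <= (f n x)%:E)%E by rewrite lee_fin.
apply: le_trans (limn_einf_le fa).
apply: le_trans (fatou P measurableT mEf Ef0).
apply: ae_ge0_le_integral => //.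
- by move=> x _; rewrite lee_fin.
- exact/measurable_EFinP.
- by move=> x _; apply: limn_einf_ge; apply: nearW => n; rewrite lee_fin.
- exact: measurable_fun_limn_einf.
apply: filterS gf => x gfx _; apply/lee_subgt0Pr => e e0.
rewrite -EFinB; apply: limn_einf_ge.
apply: filterS (gfx (g x - e) _) => [n|]; first by rewrite lee_fin.
by rewrite ltrBlDr ltrDl.
Qed.

Lemma expectation_fatou_cvg (f : nat -> Omega -> R) (g : Omega -> R) (a : R) :
  (forall n, measurable_fun setT (f n)) -> (forall n x, 0 <= f n x) ->
  measurable_fun setT g -> (forall x, 0 <= g x) ->
  {ae P, forall x, f n x @[n --> \oo] --> g x} ->
  (forall n, ('E_P[f n] <= (a + n.+1%:R^-1)%:E)%E) -> ('E_P[g] <= a%:E)%E.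
Proof.
move=> mf f0 mg g0 fg; apply: expectation_fatou => //.
by apply: filterS fg => x fgx c cg; apply: cvgr_ge fgx _ _.
Qed.

Lemma ae_limn_einf_lty (f : nat -> Omega -> R) (a : R) :
  (forall n, measurable_fun setT (f n)) -> (forall n x, 0 <= f n x) ->
  (forall n, ('E_P[f n] <= a%:E)%E) ->
  {ae P, forall x, (limn_einf (fun n => (f n x)%:E) < +oo)%E}.
Proof.
move=> mf f0 fa; rewrite expectation.unlock in fa.
have mEf n : measurable_fun setT (EFin \o f n) by exact/measurable_EFinP.
have Ef0 n x : setT x -> (0 <= (f n x)%:E)%E by rewrite lee_fin.
have liminf_ge0 x : (0 <= limn_einf (fun n => (f n x)%:E))%E.
  by apply: limn_einf_ge; apply: nearW => n; exact: Ef0.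
have : P.-integrable setT (fun x => limn_einf (fun n => (f n x)%:E)).
  apply/integrableP; split; first exact: measurable_fun_limn_einf.
  under eq_integral do rewrite gee0_abs//.
  apply: (le_lt_trans (fatou P measurableT mEf Ef0)).
  apply: (@le_lt_trans _ _ a%:E); last exact: ltry.
  apply: limn_einf_le => n; apply: (le_trans (fa n)).
  by rewrite lee_fin lerDl invr_ge0.
move=> /(integrable_ae measurableT); apply: filterS => x /(_ Logic.I).
by rewrite ge0_fin_numE.
Qed.

Lemma is_cvg_of_expN_half (z : R^nat) (c : R) : 0 < c ->
  (limn_einf (fun n => (c * z n)%:E) < +oo)%E ->
  cvgn (fun n => expR (- (z n / 2))) -> cvgn z.
Proof.
move=> c0 fin; set e := fun n => expR (- (z n / 2)) => cvg_e.
have zE : z = (fun n => - 2 * ln (e n)).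
  by apply/funext => n; rewrite expRK; field.
have [lim0|lim_gt0] : limn e = 0 \/ 0 < limn e.
  have : 0 <= limn e by apply: limr_ge => //; apply: nearW => n; exact: expR_ge0.
  by rewrite le_eqVlt => /orP[/eqP <-|]; [left|right].
- exfalso; move: fin; suff -> : limn_einf (fun n => (c * z n)%:E) = +oo%E by [].
  apply/eqyP => A A0; apply: limn_einf_ge.
  have : \forall n \near \oo, e n <= expR (- (A / c / 2)).
    have e0 : e n @[n --> \oo] --> 0 by rewrite -lim0.
    by apply: cvgr_le e0 _ _; exact: expR_gt0.
  apply: filterS => n; rewrite ler_expR lerN2 lee_fin => Az.
  by rewrite mulrC -ler_pdivrMr//; lra.
- rewrite zE; apply: is_cvgM; first exact: is_cvg_cst.
  apply/cvg_ex; exists (ln (limn e)).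
  by apply: continuous_cvg; [exact: continuous_ln|exact: cvg_e].
Qed.

(* If z_n tended to infinity on a non-negligible set, Fatou's lemma would make
   the expectations of g z_n unbounded. *)
Lemma ae_cvg_of_expN_half (z : nat -> Omega -> R) (g : Omega -> R) (a : R) :
  (forall n, measurable_fun setT (z n)) -> (forall n x, 0 <= z n x) ->
  measurable_fun setT g -> (forall x, 0 < g x) ->
  (forall n, ('E_P[fun x => g x * z n x] <= a%:E)%E) ->
  {ae P, forall x, cvgn (fun n => expR (- (z n x / 2)))} ->
  {ae P, forall x, cvgn (z^~ x)}.
Proof.
move=> mz z0 mg g0 za.
have mgz n : measurable_fun setT (fun x => g x * z n x) by exact: measurable_funM.
have gz0 n x : 0 <= g x * z n x by rewrite mulr_ge0// ltW.
apply: filterS2 (ae_limn_einf_lty mgz gz0 za) => x.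
exact: is_cvg_of_expN_half.
Qed.

End fatou.

Section midpoint_convex_ae_cvg.
Context {R : realType} {dO : measure_display} {Omega : measurableType dO}.
Variable P : probability Omega R.
Variable J : finType.
Variables (C : nat -> set (J -> Omega -> R)) (g : Omega -> R) (a : R).
Hypothesis C_nonincr : forall n, C n.+1 `<=` C n.
Hypothesis C_neq0 : forall n, C n !=set0.
Hypothesis C_mid : forall n y z, C n y -> C n z -> C n (midpoint y z).
Hypothesis mC : forall n y, C n y -> forall j, measurable_fun setT (y j).
Hypothesis mg : measurable_fun setT g.
Hypothesis g_gt0 : forall x, 0 < g x.
Hypothesis C_bounded : forall n y, C n y ->
  forall j, ('E_P[fun x => g x * `|y j x|] <= a%:E)%E.

Let difference (z : J * bool -> Omega -> R) : J -> Omega -> R :=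
  fun j x => z (j, true) x - z (j, false) x.

Let C_ge0 n : set (J * bool -> Omega -> R) := [set z | [/\ ge0_measurable z,
  forall k, ('E_P[fun x => (g x * z k x)%R] <= a%:E)%E & C n (difference z)]].

Let C_ge0_neq0 n : C_ge0 n !=set0.
Proof.
have [y Cy] := C_neq0 n; have my := mC Cy.
pose z (k : J * bool) : Omega -> R := if k.2 then (y k.1)^\+ else (y k.1)^\-.
have mz : ge0_measurable z.
  by move=> [j []]; split => [|x]; rewrite /z//=;
    [exact: measurable_funrpos|exact: measurable_funrneg].
have z_le k x : z k x <= `|y k.1 x|.
  case: k => j b; rewrite -[`|_|]/((Num.norm \o y j) x) -funrposDneg/=.
  by case: b; rewrite ?lerDl ?lerDr.
exists z; split => // [k|].
  apply: le_trans (C_bounded Cy k.1); apply: ge0_expectation_le => //.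
  - by apply: measurable_funM => //; case: (mz k).
  - by apply: measurable_funM => //; exact: measurableT_comp.
  - by move=> x; rewrite mulr_ge0//; [exact: ltW|case: (mz k)].
  - by move=> x; rewrite ler_pM2l.
rewrite (_ : difference z = y)//; apply/funext => j.
by rewrite -[RHS]funrposBneg; apply/funext.
Qed.

Let C_ge0_mid n y z : C_ge0 n y -> C_ge0 n z -> C_ge0 n (midpoint y z).
Proof.
move=> [my ya Cy] [mz za Cz]; split=> [k|k|].
- have [myk yk0] := my k; have [mzk zk0] := mz k; split.
    by apply: measurable_funM => //; exact: measurable_funD.
  by move=> x; rewrite /midpoint divr_ge0// addr_ge0.
- have [myk yk0] := my k; have [mzk zk0] := mz k.
  have mgM f : measurable_fun setT f -> measurable_fun setT (fun x => g x * f x).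
    exact: measurable_funM.
  have g_ge0 x : 0 <= g x by exact: ltW.
  rewrite (@eq_expectation _ _ _ _ _
    (fun x => 2^-1 * (g x * y k x + g x * z k x))); last first.
    by move=> x; rewrite /midpoint; field.
  rewrite ge0_expectationZl//; last 2 first.
  + by apply: measurable_funD; exact: mgM.
  + by move=> x; rewrite addr_ge0// mulr_ge0.
  rewrite ge0_expectationD//; [|exact: mgM|exact: mgM|..]; last 2 first.
  + by move=> x; rewrite mulr_ge0.
  + by move=> x; rewrite mulr_ge0.
  rewrite (_ : a = 2^-1 * (a + a)); last by field.
  by rewrite EFinM lee_pmul2l ?lte_fin ?invr_gt0// EFinD leeD.
- rewrite (_ : difference _ = midpoint (difference y) (difference z)).
    exact: C_mid.
  by apply/funext => j; apply/funext => x; rewrite /difference /midpoint; field.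
Qed.

Theorem midpoint_convex_ae_cvg : exists y : nat -> J -> Omega -> R,
  (forall n, C n (y n)) /\ {ae P, forall x, forall j, cvgn (fun n => y n j x)}.
Proof.
have [|n z []//|z [Cz cvg_exp]] :=
  midpoint_convex_ae_cvg_expN P _ C_ge0_neq0 C_ge0_mid.
  by move=> n z [mz za Cz]; split => //; exact: C_nonincr.
exists (fun n => difference (z n)); split; first by move=> n; case: (Cz n).
have cvg_z k : {ae P, forall x, cvgn (fun n => z n k x)}.
  apply: (@ae_cvg_of_expN_half _ _ _ P (fun n => z n k) g a) => //.
  - by move=> n; have [/(_ k)[]] := Cz n.
  - by move=> n; have [/(_ k)[]] := Cz n.
  - by move=> n; have [_ /(_ k)] := Cz n.
  - by apply: filterS cvg_exp => x; exact.
apply: filter_forall => j.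
by apply: filterS2 (cvg_z (j, true)) (cvg_z (j, false)) => x; exact: is_cvgB.
Qed.

End midpoint_convex_ae_cvg.

(** * Sub-sigma-algebras and conditional expectations *)

Definition sub_sigma_algebra {d} {T : measurableType d} (G : set (set T)) :=
  sigma_algebra setT G /\ G `<=` measurable.

Notation measurable_wrt G f := (measurable_fun [set: g_sigma_algebraType G] f).

Lemma measurable_inv (R : realType) : measurable_fun [set: R] (@GRing.inv R).
Proof.
rewrite -(setUv [set 0 : R]); apply/measurable_funU => //; first exact: measurableC.
split; first exact: measurable_fun_set1.
apply: open_continuous_measurable_fun; first by apply: closed_openC; exact: closed_eq.
by move=> x; rewrite inE => x0; apply: inv_continuous; exact/eqP.
Qed.

Section measurable_real_functions.
Context {d} {T : measurableType d} {R : realType}.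

Lemma measurable_funV (f : T -> R) : measurable_fun setT f ->
  measurable_fun setT (fun x => (f x)^-1).
Proof. by move=> mf; apply: measurableT_comp => //; exact: measurable_inv. Qed.

Lemma measurable_fun_lim (f : nat -> T -> R) :
  (forall n, measurable_fun setT (f n)) ->
  exists g : T -> R, measurable_fun setT g /\
    forall x, cvgn (f^~ x) -> f n x @[n --> \oo] --> g x.
Proof.
move=> mf; exists (fun x => fine (limn_esup (fun n => (f n x)%:E))); split.
  apply: measurableT_comp => //; apply: measurable_fun_limn_esup => n.
  exact/measurable_EFinP.
move=> x cvg_f; have Ecvg : (f n x)%:E @[n --> \oo] --> (limn (f^~ x))%:E.
  by apply: cvg_EFin; [exact: nearW|exact: cvg_f].
by rewrite (cvg_limn_einf_sup Ecvg).2.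
Qed.

Lemma measurable_ifE (A : set T) (f g : T -> R) : measurable A ->
  measurable_fun setT f -> measurable_fun setT g ->
  measurable_fun setT (fun x => if x \in A then f x else g x).
Proof.
move=> mA; apply: measurable_fun_ifT.
by apply: (measurable_fun_bool true); rewrite setTI preimage_mem_true.
Qed.

End measurable_real_functions.

Section measurable_wrt.
Context {d} {T : measurableType d}.
Variable G : set (set T).
Hypothesis sG : sub_sigma_algebra G.

Lemma measurable_wrt_set (A : set T) :
  measurable (A : set (g_sigma_algebraType G)) <-> G A.
Proof. by rewrite (measurable_g_measurableTypeE sG.1). Qed.

Lemma sub_measurableP {dV} {V : measurableType dV} (f : T -> V) :
  sub_measurable G f <-> measurable_wrt G f.
Proof.
split=> [mf _ B mB|mf B mB]; first by rewrite setTI; exact/measurable_wrt_set/mf.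
by apply/measurable_wrt_set; rewrite -[_ @^-1` _]setTI; exact: mf.
Qed.

Lemma measurable_wrtW {dV} {V : measurableType dV} (f : T -> V) :
  measurable_wrt G f -> measurable_fun [set: T] f.
Proof. by move=> mf _ B mB; apply: sG.2; apply/measurable_wrt_set; exact: mf. Qed.

Lemma measurable_wrt_id :
  measurable_fun [set: T] (id : T -> g_sigma_algebraType G).
Proof. by apply: measurable_wrtW; exact: measurable_id. Qed.

Lemma measurable_wrt_mono (H : set (set T)) {dV} {V : measurableType dV}
    (f : T -> V) : sub_sigma_algebra H -> G `<=` H ->
  measurable_wrt G f -> measurable_wrt H f.
Proof.
move=> sH GH /sub_measurableP mf.
rewrite -[measurable_wrt H f]/(measurable_fun _ _) => _ B mB; rewrite setTI.
by rewrite (measurable_g_measurableTypeE sH.1); exact/GH/mf.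
Qed.

Lemma measurable_wrt_ltr {R : realType} (f g : T -> R) : measurable_wrt G f ->
  measurable_wrt G g -> G [set x | f x < g x].
Proof.
move=> mf mg; have mfg : measurable_wrt G (fun x => f x < g x).
  exact: measurable_fun_ltr.
apply/measurable_wrt_set; rewrite -[[set _ | _]]setTI.
exact: (mfg measurableT [set true]).
Qed.

Lemma measurable_wrt_ler {R : realType} (f g : T -> R) : measurable_wrt G f ->
  measurable_wrt G g -> G [set x | f x <= g x].
Proof.
move=> mf mg; have mfg : measurable_wrt G (fun x => f x <= g x).
  exact: measurable_fun_ler.
apply/measurable_wrt_set; rewrite -[[set _ | _]]setTI.
exact: (mfg measurableT [set true]).
Qed.

End measurable_wrt.

Import HBNNSimple.

Section conditional_expectation.
Context {R : realType} {dO : measure_display} {Omega : measurableType dO}.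
Variable P : probability Omega R.
Variable G : set (set Omega).
Hypothesis sG : sub_sigma_algebra G.
Implicit Types f g e m : Omega -> R.

Let mG A : G A -> measurable A.
Proof. exact: sG.2. Qed.

Lemma ae_le_of_integral f g : measurable_wrt G f -> measurable_wrt G g ->
  P.-integrable setT (EFin \o f) -> P.-integrable setT (EFin \o g) ->
  (forall A, G A ->
    (\int[P]_(x in A) (f x)%:E <= \int[P]_(x in A) (g x)%:E)%E) ->
  {ae P, forall x, f x <= g x}.
Proof.
move=> mf mg intf intg fg; pose A := [set x | g x < f x].
have GA : G A by exact: measurable_wrt_ltr.
have intA h : P.-integrable setT (EFin \o h) -> P.-integrable A (EFin \o h).
  by apply: integrableS => //; exact: mG.
have mD : measurable_fun A (fun x => (f x - g x)%:E).
  apply/measurable_EFinP; apply: measurable_funTS.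
  by apply: (measurable_wrtW sG); exact: measurable_funB.
have : (\int[P]_(x in A) `|(f x - g x)%:E|)%E = 0%E.
  apply/eqP; rewrite eq_le integral_ge0// andbT.
  rewrite (eq_integral (fun x => (f x)%:E - (g x)%:E)%E); last first.
    by move=> x; rewrite inE => /ltW fgx; rewrite /= ger0_norm ?subr_ge0.
  rewrite integralB_EFin; [|exact: mG|exact: intA|exact: intA].
  rewrite leeBlDr ?add0e ?fg//.
  by apply: integrable_fin_num; [exact: mG|exact: intA].
move/(ae_eq_integral_abs P (mG GA) mD); apply: filterS => x fgx.
by rewrite leNgt; apply/negP => /[dup]/fgx []/eqP; rewrite subr_eq0 => /eqP ->;
  rewrite ltxx.
Qed.

Definition is_cond_exp f (e : Omega -> R) := measurable_wrt G e /\
  forall A, G A -> (\int[P]_(x in A) (e x)%:E = \int[P]_(x in A) (f x)%:E)%E.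

Lemma cond_exp_exists f : P.-integrable setT (EFin \o f) ->
  exists2 e : Omega -> R, is_cond_exp f e & P.-integrable setT (EFin \o e).
Proof.
move=> intf; have mid := measurable_wrt_id sG.
pose X : {mfun Omega >-> g_sigma_algebraType G} := mfun_Sub (mem_set mid).
pose PG := distribution P X.
pose nuP : {charge set Omega -> \bar R} := induced_charge intf.
have nuP_dom : nuP `<< P.
  apply/null_content_dominatesP => A mA PA0.
  apply: null_set_integral => //.
  by apply/measurable_funTS; exact: measurable_int intf.
pose nu : {charge set (g_sigma_algebraType G) -> \bar R} :=
  @measure_function_pushforward__canonical__charge_Charge _ _ _
    (g_sigma_algebraType G) X R nuP mid.
have nu_dom : nu `<< PG by exact: dominates_pushforward.
pose e := Radon_Nikodym nu PG.
have e_fin x : e x \is a fin_num by exact: Radon_Nikodym_fin_num.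
have inte : PG.-integrable setT e by exact: Radon_Nikodym_integrable.
have me : measurable_fun [set: g_sigma_algebraType G] e := measurable_int _ inte.
have intPe : P.-integrable setT (e \o X).
  have /integrableP[_ e_lty] := inte; apply/integrableP; split.
    exact: (measurable_wrtW sG me).
  by move: e_lty; rewrite ge0_integral_pushforward//; exact: measurableT_comp.
have fineE : EFin \o (fine \o e) = e \o X by apply/funext => x; exact: fineK.
exists (fine \o e); last by rewrite fineE.
split; first exact: measurableT_comp.
move=> A GA; have mA := (measurable_wrt_set sG A).2 GA.
transitivity (\int[P]_(x in A) (e \o X) x)%E.
  by apply: eq_integral => x _; rewrite -fineE.
transitivity (nu A); last by [].
rewrite (Radon_Nikodym_integral nu_dom mA) integral_pushforward//.
by apply: integrableS intPe => //; exact: mG.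
Qed.

Let bounded_integrable f a b : measurable_fun setT f ->
  (forall x, a <= f x <= b) -> P.-integrable setT (EFin \o f).
Proof.
move=> mf fab; apply: measurable_bounded_integrable => //.
  by rewrite -ge0_fin_numE// fin_num_measure.
exists (`|a| + `|b|); split; first exact: num_real.
move=> M abM x _ /=; have /andP[af fb] := fab x; apply: le_trans (ltW abM).
rewrite ler_norml; have := normr_ge0 a; have := normr_ge0 b.
by have := ler_norm b; have := ler_norm (- a); rewrite normrN; lra.
Qed.

Lemma bounded_cond_exp_exists f a b : measurable_fun setT f ->
  (forall x, a <= f x <= b) ->
  exists2 e : Omega -> R, is_cond_exp f e & forall x, a <= e x <= b.
Proof.
move=> mf fab; have intf := bounded_integrable mf fab.
have ab : a <= b by have /andP[] := fab point; exact: le_trans.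
have [e [me eE] inte] := cond_exp_exists intf.
have int_cst c : P.-integrable setT (EFin \o (cst c : Omega -> R)).
  by apply: (@bounded_integrable _ c c) => // x; rewrite lexx.
have integral_le A g h : G A -> P.-integrable setT (EFin \o g) ->
    P.-integrable setT (EFin \o h) -> (forall x, g x <= h x) ->
    (\int[P]_(x in A) (g x)%:E <= \int[P]_(x in A) (h x)%:E)%E.
  move=> GA intg inth gh; apply: le_integral; [exact: mG|..].
  - by apply: integrableS intg => //; exact: mG.
  - by apply: integrableS inth => //; exact: mG.
  - by move=> x _; rewrite lee_fin.
have ae_ge : {ae P, forall x, a <= e x}.
  apply: (ae_le_of_integral _ me (int_cst a) inte) => //.
  move=> A GA; rewrite eE//; apply: (integral_le _ (cst a) f) => // x.
  by case/andP: (fab x).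
have ae_le : {ae P, forall x, e x <= b}.
  apply: (ae_le_of_integral me _ inte (int_cst b)) => //.
  move=> A GA; rewrite eE//; apply: (integral_le _ f (cst b)) => // x.
  by case/andP: (fab x).
have mclamp : measurable_wrt G (fun x => Num.max a (Num.min (e x) b)).
  by apply: measurable_maxr => //; exact: measurable_minr.
exists (fun x => Num.max a (Num.min (e x) b)).
  split=> // A GA; rewrite -eE//; apply: ae_eq_integral; first exact: mG.
  - by apply/measurable_EFinP; apply: measurable_funTS; exact: (measurable_wrtW sG).
  - by apply/measurable_EFinP; apply: measurable_funTS; exact: (measurable_wrtW sG).
  - apply: filterS2 ae_ge ae_le => x aex exb _.
    by rewrite min_l// max_r.
by move=> x; rewrite le_max lexx/= ge_max ab ge_min lexx orbT.
Qed.

Let integral_nnsfunM (s : {nnsfun (g_sigma_algebraType G) >-> R}) f :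
  measurable_fun setT f -> (forall x, 0 <= f x) ->
  (\int[P]_x (s x * f x)%:E = \sum_(r \in range s)
    r%:E * \int[P]_(x in s @^-1` [set r]) (f x)%:E)%E.
Proof.
move=> mf f0; have mpre r : measurable (s @^-1` [set r] : set Omega).
  by apply: mG; apply/(measurable_wrt_set sG); exact: measurable_funPTI.
have term_ge0 r x :
    (0 <= (r * \1_(s @^-1` [set r]) x)%:E * (f x)%:E :> \bar R)%E.
  by rewrite mule_ge0 ?lee_fin// -lee_fin EFinM; exact: nnfun_muleindic_ge0.
transitivity (\int[P]_x \sum_(r \in range s)
    ((r * \1_(s @^-1` [set r]) x)%:E * (f x)%:E))%E.
  apply: eq_integral => x _; rewrite EFinM fimfunE -fsumEFin//.
  by rewrite ge0_mule_fsuml// => r; rewrite EFinM; exact: nnfun_muleindic_ge0.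
rewrite ge0_integral_fsum//; last first.
  move=> r; apply: emeasurable_funM; apply/measurable_EFinP => //.
  exact: measurable_funM.
apply: eq_fsbigr => r; rewrite inE => -[y _ <-].
under eq_integral do rewrite EFinM -muleA.
rewrite ge0_integralZl_EFin//.
- congr (_ * _)%E; rewrite [RHS]integral_mkcond; apply: eq_integral => x _.
  by rewrite epatch_indic muleC.
- by move=> x _; rewrite -EFinM lee_fin mulr_ge0// indicE.
- by apply: emeasurable_funM; exact/measurable_EFinP.
Qed.

Lemma le_expectation_weight f g (m : Omega -> R) :
  measurable_fun setT f -> (forall x, 0 <= f x) ->
  measurable_fun setT g -> (forall x, 0 <= g x) ->
  (forall A, G A ->
    (\int[P]_(x in A) (f x)%:E <= \int[P]_(x in A) (g x)%:E)%E) ->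
  measurable_wrt G m -> (forall x, 0 <= m x) ->
  ('E_P[fun x => m x * f x] <= 'E_P[fun x => m x * g x])%E.
Proof.
move=> mf f0 mg g0 fg mm m0.
have mmE : measurable_wrt G (EFin \o m) by exact/measurable_EFinP.
have m0E x : setT x -> (0 <= (EFin \o m) x)%E by rewrite lee_fin.
pose s := nnsfun_approx measurableT mmE.
have s_le n x : s n x <= m x.
  by rewrite -lee_fin /s nnsfun_approxE; exact: le_approx.
have s_cvg x : s n x @[n --> \oo] --> m x.
  under eq_fun do rewrite /s nnsfun_approxE.
  by apply: (cvg_approx m0E) => //; exact: ltry.
have ms n : measurable_fun [set: Omega] (s n).
  by apply: (measurable_wrtW sG); exact: measurable_funPT.
have mmW := measurable_wrtW sG mm.
have step n : ('E_P[fun x => s n x * f x] <= 'E_P[fun x => m x * g x])%E.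
  apply: (@le_trans _ _ ('E_P[fun x => s n x * g x])%E); last first.
    apply: ge0_expectation_le; [exact: measurable_funM|exact: measurable_funM|..].
      by move=> x; rewrite mulr_ge0.
    by move=> x; rewrite ler_wpM2r.
  rewrite !expectation.unlock !integral_nnsfunM//.
  apply: lee_fsum => // _ [x _ <-].
  apply: lee_wpmul2l; first by rewrite lee_fin.
  by apply: fg; apply/(measurable_wrt_set sG); exact: measurable_funPTI.
have [fin|] := boolP (('E_P[fun x => m x * g x])%E \is a fin_num); last first.
  rewrite ge0_fin_numE; last by apply: expectation_ge0 => x; exact: mulr_ge0.
  by rewrite ltey negbK => /eqP ->; exact: leey.
rewrite -(fineK fin).
apply: (expectation_fatou_cvg (f := fun n (x : Omega) => s n x * f x)).
- by move=> n; exact: measurable_funM.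
- by move=> n x; exact: mulr_ge0.
- exact: measurable_funM.
- by move=> x; exact: mulr_ge0.
- by apply: nearW => x; apply: cvgM; [exact: s_cvg|exact: cvg_cst].
- by move=> n; rewrite EFinD fineK// (le_trans (step n))// leeDl// lee_fin invr_ge0.
Qed.

End conditional_expectation.

(** * Measurable selections and projections *)

Section finite_sums.
Context {R : realType} {J : finType}.
Implicit Types c v w : J -> R.

Lemma cvg_fin_sum (u : nat -> J -> R) v : (forall j, u n j @[n --> \oo] --> v j) ->
  (\sum_j u n j) @[n --> \oo] --> \sum_j v j.
Proof. by move=> uv; apply: (@cvg_big _ _ +%R 0 predT add_continuous) => j _. Qed.

Lemma sum_mulr_mid c v w : \sum_j c j * ((v j + w j) / 2) =
  (\sum_j c j * v j + \sum_j c j * w j) / 2.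
Proof. by rewrite -big_split mulr_suml/=; apply: eq_bigr => j _; field. Qed.

Lemma sum_mull_mid c v w : \sum_j (v j + w j) / 2 * c j =
  (\sum_j v j * c j + \sum_j w j * c j) / 2.
Proof. by rewrite -big_split mulr_suml/=; apply: eq_bigr => j _; field. Qed.

Lemma homogeneous_fun0 (q : (J -> R) -> R) :
  (forall a v, 0 <= a -> q (fun j => a * v j) = a * q v) -> q (fun=> 0) = 0.
Proof.
move=> qZ; rewrite -[RHS](mul0r (q (fun=> 0))) -qZ//; congr (q _).
by apply/funext => j; rewrite mulr0.
Qed.

End finite_sums.

Section measurable_selections.
Context {R : realType} {dO : measure_display} {Omega : measurableType dO}.
Variable P : probability Omega R.
Variable G : set (set Omega).
Variable J : finType.

Definition convex_integrand (phi : Omega -> (J -> R) -> R) :=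
  [/\ forall y : J -> Omega -> R, (forall j, measurable_fun setT (y j)) ->
        measurable_fun setT (fun x => phi x (y^~ x)),
      forall x v, 0 <= phi x v,
      forall x v w, phi x (fun j => (v j + w j) / 2) <= (phi x v + phi x w) / 2 &
      forall x (v : nat -> J -> R) w, (forall j, v n j @[n --> \oo] --> w j) ->
        phi x (v n) @[n --> \oo] --> phi x w].

Definition selections (K : Omega -> set (J -> R)) : set (J -> Omega -> R) :=
  [set y | (forall j, measurable_wrt G (y j)) /\ {ae P, forall x, K x (y^~ x)}].

Hypothesis sG : sub_sigma_algebra G.
Variables (K : Omega -> set (J -> R)) (phi : Omega -> (J -> R) -> R) (c : R).
Hypothesis K_mid : forall x v w, K x v -> K x w -> K x (fun j => (v j + w j) / 2).
Hypothesis K_closed : forall x (v : nat -> J -> R) w, (forall n, K x (v n)) ->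
  (forall j, v n j @[n --> \oo] --> w j) -> K x w.
Hypothesis phi_integrand : convex_integrand phi.
Hypothesis phi_coercive : forall x v, K x v -> forall j, `|v j| <= c + phi x v.

Let cost (y : J -> Omega -> R) := ('E_P[fun x => phi x (y^~ x)])%E.

Let measurable_selection y : selections K y -> forall j, measurable_fun setT (y j).
Proof. by move=> [my _] j; exact: (measurable_wrtW sG). Qed.

Let phi_ge0 x v : 0 <= phi x v.
Proof. by case: phi_integrand. Qed.

Let measurable_phi y : selections K y ->
  measurable_fun setT (fun x => phi x (y^~ x)).
Proof. by case: phi_integrand => + _ _ _ /measurable_selection; apply. Qed.

Let selections_mid y z : selections K y -> selections K z ->
  selections K (midpoint y z).
Proof.
move=> [my Ky] [mz Kz]; split; last by apply: filterS2 Ky Kz => x; exact: K_mid.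
by move=> j; apply: measurable_funM => //; exact: measurable_funD.
Qed.

Let cost_mid y z (a : \bar R) : selections K y -> selections K z ->
  (cost y <= a)%E -> (cost z <= a)%E -> (cost (midpoint y z) <= a)%E.
Proof.
move=> sy sz ya za; have my := measurable_phi sy; have mz := measurable_phi sz.
apply: (@le_trans _ _
  ('E_P[fun x => 2^-1 * (phi x (y^~ x) + phi x (z^~ x))])%E).
  apply: ge0_expectation_le => //.
  - exact/measurable_phi/selections_mid.
  - by apply: measurable_funM => //; exact: measurable_funD.
  - by move=> x; rewrite mulrC; case: phi_integrand => _ _ + _; apply.
rewrite ge0_expectationZl//; last 2 first.
- exact: measurable_funD.
- by move=> x; rewrite addr_ge0.
rewrite ge0_expectationD// lee_pdivrMl// mule_natl mule2n.
exact: leeD.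
Qed.

Let cost_coercive y j : selections K y ->
  ('E_P[fun x => `|y j x|] <= `|c|%:E + cost y)%E.
Proof.
move=> sy; rewrite -(expectation_cst P `|c|) -ge0_expectationD//; last first.
  exact: measurable_phi.
apply: expectation_le => //.
- by apply: measurableT_comp => //; exact: measurable_selection.
- by apply: measurable_funD => //; exact: measurable_phi.
- by move=> x; rewrite addr_ge0.
apply: filterS sy.2 => x /phi_coercive /(_ j) /le_trans; apply.
by rewrite lerD2r ler_norm.
Qed.

Let cost_argmin : (exists2 y, selections K y & (cost y < +oo)%E) ->
  exists2 z, selections K z & forall y, selections K y -> (cost z <= cost y)%E.
Proof.
move=> [y0 sy0 y0_fin]; pose m := ereal_inf [set cost y | y in selections K].
have m_le y : selections K y -> (m <= cost y)%E.
  by move=> sy; apply: ereal_inf_lbound; exists y.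
have m_fin : m \is a fin_num.
  rewrite ge0_fin_numE; first exact: le_lt_trans (m_le _ sy0) y0_fin.
  by apply: le_ereal_inf_tmp => _ [y _ <-]; exact: expectation_ge0.
pose D n : set (J -> Omega -> R) :=
  [set y | selections K y /\ (cost y <= (fine m + n.+1%:R^-1)%:E)%E].
have [|||||||y [Dy cvg_y]] := @midpoint_convex_ae_cvg _ _ _ P J D (cst 1)
    (`|c| + (fine m + 1)).
- move=> n y [sy ym]; split => //; apply: (le_trans ym).
  by rewrite lee_fin lerD2l lef_pV2 ?posrE// ler_nat.
- move=> n; have e0 : 0 < n.+1%:R^-1 :> R by rewrite invr_gt0.
  have [_ [y sy <-] ym] := lb_ereal_inf_adherent e0 m_fin.
  by exists y; split => //; rewrite EFinD fineK// ltW.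
- move=> n y z [sy ym] [sz zm]; split; first exact: selections_mid.
  exact: cost_mid.
- by move=> n y [sy _]; exact: measurable_selection.
- by [].
- by move=> x; exact: ltr01.
- move=> n y [sy ym] j; rewrite (@eq_expectation _ _ _ _ _ (fun x => `|y j x|)).
    apply: (le_trans (cost_coercive j sy)); rewrite EFinD leeD2l//.
    by apply: (le_trans ym); rewrite lee_fin lerD2l invf_le1// ler1n.
  by move=> x; rewrite mul1r.
have sy n : selections K (y n) by case: (Dy n).
have /choice[z z_lim] j := measurable_fun_lim (fun n => (sy n).1 j).
have cvg_z : {ae P, forall x, forall j, y n j x @[n --> \oo] --> z j x}.
  by apply: filterS cvg_y => x cx j; exact: (z_lim j).2.
have sz : selections K z.
  split; first by move=> j; exact: (z_lim j).1.
  apply: filterS2 cvg_z (ae_foralln (fun n => (sy n).2)) => x cx Kx.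
  by apply: K_closed cx => n; exact: Kx.
exists z => // w sw; apply: le_trans (m_le _ sw); rewrite -(fineK m_fin).
apply: (expectation_fatou_cvg (f := fun n x => phi x ((y n)^~ x))) => //.
- by move=> n; exact: measurable_phi.
- exact: measurable_phi.
- by apply: filterS cvg_z => x; case: phi_integrand => _ _ _; exact.
- by move=> n; case: (Dy n).
Qed.

Let selections_paste (A : set Omega) y z : G A ->
  selections K y -> selections K z ->
  selections K (fun j x => if x \in A then y j x else z j x).
Proof.
move=> GA [my Ky] [mz Kz]; split=> [j|].
  by apply: measurable_ifE => //; exact/(measurable_wrt_set sG).
by apply: filterS2 Ky Kz => x Kyx Kzx; case: (x \in A).
Qed.

Let ge0_expectation_split (A : set Omega) (h : Omega -> R) : G A ->
  measurable_fun setT h -> (forall x, 0 <= h x) ->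
  ('E_P[h] = \int[P]_(x in A) (h x)%:E + \int[P]_(x in ~` A) (h x)%:E)%E.
Proof.
move=> /sG.2 mA mh h0; rewrite unlock -(setUv A) ge0_integral_setU//.
- exact: measurableC.
- by rewrite setUv; exact/measurable_EFinP.
- by move=> x _; rewrite lee_fin.
- by rewrite disj_set2E setICr.
Qed.

(* A minimiser is optimal on every event of G: otherwise pasting a better
   selection on that event would decrease the cost. *)
Lemma selection_argmin : (exists2 y, selections K y & (cost y < +oo)%E) ->
  exists2 z, selections K z & forall y A, selections K y -> G A ->
    (\int[P]_(x in A) (phi x (z^~ x))%:E <= \int[P]_(x in A) (phi x (y^~ x))%:E)%E.
Proof.
move=> [y0 sy0 y0_fin].
have [|z sz z_min] := cost_argmin; first by exists y0.
exists z => // y A sy GA; have mz := measurable_phi sz; have mA := sG.2 _ GA.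
have offA_fin : (\int[P]_(x in ~` A) (phi x (z^~ x))%:E)%E \is a fin_num.
  rewrite ge0_fin_numE; last by apply: integral_ge0 => x _; rewrite lee_fin.
  apply: le_lt_trans (le_lt_trans (z_min _ sy0) y0_fin).
  rewrite /cost (ge0_expectation_split GA)// leeDr//.
  by apply: integral_ge0 => x _; rewrite lee_fin.
rewrite -(leeD2rE _ _ offA_fin) -ge0_expectation_split//.
pose w j x := if x \in A then y j x else z j x.
have sw : selections K w by exact: selections_paste.
apply: le_trans (z_min _ sw) _; rewrite /cost (ge0_expectation_split GA)//; last first.
  exact: measurable_phi.
rewrite le_eqVlt; apply/orP; left; apply/eqP.
congr (_ + _)%E; apply: eq_integral => x; rewrite inE => xA; congr (phi x _)%:E.
  by apply/funext => j; rewrite /w mem_set.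
by apply/funext => j; rewrite /w memNset.
Qed.

End measurable_selections.

Section sqr_distance.
Context {R : realType} {I : finType}.
Implicit Types u v z : I -> R.

Lemma sum_sqr_eq0 z : \sum_i z i ^+ 2 = 0 -> forall i, z i = 0.
Proof.
move=> /eqP; rewrite psumr_eq0 => [/allP z0 i|i _]; last exact: sqr_ge0.
by have := z0 i (mem_index_enum i); rewrite sqrf_eq0 => /eqP.
Qed.

(* When z = 0 both sides reduce to the norm of u, since x / 0 = 0. *)
Lemma sum_sqr_subr_proj u z :
  let g := \sum_i u i * z i in let n := \sum_i z i ^+ 2 in
  \sum_i (u i - g / n * z i) ^+ 2 = \sum_i u i ^+ 2 - g ^+ 2 / n.
Proof.
move=> g n; have [n0|n0] := eqVneq n 0.
  rewrite n0 invr0 !mulr0 subr0; apply: eq_bigr => i _.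
  by rewrite mul0r subr0.
transitivity (\sum_i u i ^+ 2 - 2 * (g / n) * g + (g / n) ^+ 2 * n); last by field.
rewrite {3}/g {4}/n !mulr_sumr -sumrB -big_split/=.
by apply: eq_bigr => i _; ring.
Qed.

Lemma sum_sqr_subr_proj_ge u z :
  let g := \sum_i u i * z i in let n := \sum_i z i ^+ 2 in
  \sum_i u i ^+ 2 <= \sum_i (u i - g / n * z i) ^+ 2 -> g = 0.
Proof.
move=> g n; rewrite sum_sqr_subr_proj -/g -/n => le_proj.
have n_ge0 : 0 <= n by apply: sumr_ge0 => i _; exact: sqr_ge0.
have : g ^+ 2 / n = 0.
  by apply/eqP; rewrite eq_le divr_ge0 ?sqr_ge0// andbT; lra.
move/eqP; rewrite mulf_eq0 sqrf_eq0 invr_eq0 => /orP[/eqP//|/eqP /sum_sqr_eq0 z0].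
by apply: big1 => i _; rewrite z0 mulr0.
Qed.

Lemma norm_coord_le_sqr_dist u v i : `|v i| <= `|u i| + 1 + \sum_k (u k - v k) ^+ 2.
Proof.
rewrite (bigD1 i)//=.
have : 0 <= \sum_(k | k != i) (u k - v k) ^+ 2.
  by apply: sumr_ge0 => k _; exact: sqr_ge0.
have : `|v i| <= `|u i| + `|u i - v i|.
  by rewrite -[X in `|X| <= _](subKr (u i)) (le_trans (ler_normB _ _)).
rewrite -[(u i - v i) ^+ 2]real_normK ?num_real//.
by move: `|u i - v i| => t; have := sqr_ge0 (t - 1); rewrite !expr2; nra.
Qed.

End sqr_distance.

Section null_projection.
Context {R : realType} {dO : measure_display} {Omega : measurableType dO}.
Variable P : probability Omega R.
Variable G : set (set Omega).
Variables (I : finType) (X : I -> Omega -> R).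

Definition null_strategy : set (I -> Omega -> R) :=
  selections P G (fun x => [set v | \sum_i v i * X i x = 0]).

Definition is_null_projection (p : I -> I -> Omega -> R) :=
  [/\ forall k i, measurable_wrt G (p k i),
      forall h : I -> Omega -> R, (forall i, measurable_wrt G (h i)) ->
        null_strategy (fun k x => \sum_i p k i x * h i x) &
      forall z, null_strategy z ->
        {ae P, forall x, forall k, z k x = \sum_i p k i x * z i x}].

Hypothesis sG : sub_sigma_algebra G.

Lemma null_strategyB h k (s : Omega -> R) :
  null_strategy h -> null_strategy k -> measurable_wrt G s ->
  null_strategy (fun i x => h i x - s x * k i x).
Proof.
move=> [mh h0] [mk k0] ms; split.
  by move=> i; apply: measurable_funB => //; exact: measurable_funM.
apply: filterS2 h0 k0 => x /= hx kx.
transitivity (\sum_i h i x * X i x - s x * \sum_i k i x * X i x).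
  by rewrite mulr_sumr -sumrB; apply: eq_bigr => i _; ring.
by rewrite hx kx mulr0 subr0.
Qed.

Lemma null_strategy0 : null_strategy (fun _ _ => 0).
Proof. by split=> //; apply: nearW => x; apply: big1 => i _; rewrite mul0r. Qed.

Let sqr_dist_integrand (u : I -> R) :
  convex_integrand (fun (_ : Omega) v => \sum_i (u i - v i) ^+ 2).
Proof.
split=> [y my|_ v|_ v w|_ v w vw].
- apply: measurable_sum => i; apply: measurable_funX.
  exact: measurable_funB.
- by apply: sumr_ge0 => i _; exact: sqr_ge0.
- rewrite -big_split mulr_suml/=; apply: ler_sum => i _.
  by have := sqr_ge0 (v i - w i); rewrite !expr2; nra.
- apply: cvg_fin_sum => i.
  rewrite expr2; under eq_fun do rewrite expr2.
  by apply: cvgM; apply: cvgB => //; exact: cvg_cst.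
Qed.

Let null_strategy_argmin (u : I -> R) : exists2 p, null_strategy p &
  forall y A, null_strategy y -> G A ->
    (\int[P]_(x in A) (\sum_i (u i - p i x) ^+ 2)%:E <=
     \int[P]_(x in A) (\sum_i (u i - y i x) ^+ 2)%:E)%E.
Proof.
apply: (selection_argmin sG (phi := fun _ v => \sum_i (u i - v i) ^+ 2)
  (c := \sum_i `|u i| + 1)).
- by move=> x v w /= vX wX; rewrite sum_mull_mid vX wX addr0 mul0r.
- move=> x v w vX vw /=.
  have cvg_sum : (\sum_i v n i * X i x) @[n --> \oo] --> \sum_i w i * X i x.
    by apply: cvg_fin_sum => i; apply: cvgM => //; exact: cvg_cst.
  by rewrite -(cvg_lim _ cvg_sum)//; under eq_fun do rewrite vX; exact: lim_cst.
- exact: sqr_dist_integrand.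
- move=> x v _ j; apply: (le_trans (norm_coord_le_sqr_dist u v j)).
  rewrite !lerD2r (bigD1 j)//= lerDl.
  by apply: sumr_ge0 => i _; exact: normr_ge0.
- exists (fun _ _ => 0); first exact: null_strategy0.
  by rewrite expectation_cst ltry.
Qed.

Let measurable_sqr_dist (u : I -> R) (r : I -> Omega -> R) :
  (forall i, measurable_wrt G (r i)) ->
  measurable_wrt G (fun x => \sum_i (u i - r i x) ^+ 2).
Proof.
move=> mr; apply: measurable_sum => i; apply: measurable_funX.
exact: measurable_funB.
Qed.

Let integrable_sqr_dist (u : I -> R) (r : I -> Omega -> R) :
  (forall i, measurable_wrt G (r i)) ->
  ('E_P[fun x => \sum_i (u i - r i x) ^+ 2] < +oo)%E ->
  P.-integrable setT (EFin \o fun x => \sum_i (u i - r i x) ^+ 2).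
Proof.
move=> mr r_fin; apply/integrableP; split.
  by apply/measurable_EFinP; exact: (measurable_wrtW sG (measurable_sqr_dist u mr)).
under eq_integral => x _.
  rewrite /= ger0_norm; last by apply: sumr_ge0 => i _; exact: sqr_ge0.
  over.
by rewrite expectation.unlock in r_fin.
Qed.

(* The variation p + s z along a null strategy z is admissible for every
   G-measurable s, in particular for the pointwise optimal one. *)
Lemma null_strategy_projection (u : I -> R) : exists2 p, null_strategy p &
  forall z, null_strategy z -> {ae P, forall x, \sum_i (u i - p i x) * z i x = 0}.
Proof.
have [p np p_min] := null_strategy_argmin u; exists p => // z nz.
pose g x := \sum_i (u i - p i x) * z i x; pose n x := \sum_i z i x ^+ 2.
pose q i x := p i x - (- (g x / n x)) * z i x.
pose sqr_p x := \sum_i (u i - p i x) ^+ 2.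
pose sqr_q x := \sum_i (u i - q i x) ^+ 2.
have [mp _] := np; have [mz _] := nz.
have nq : null_strategy q.
  apply: null_strategyB => //; apply: measurable_funN; apply: measurable_funM.
    apply: measurable_sum => i; apply: measurable_funM => //.
    exact: measurable_funB.
  by apply: measurable_funV; apply: measurable_sum => i; exact: measurable_funX.
have [mq _] := nq.
have sqr_qE x : sqr_q x = \sum_i ((u i - p i x) - g x / n x * z i x) ^+ 2.
  by apply: eq_bigr => i _; rewrite /q; congr (_ ^+ 2); ring.
have GT : G setT by apply/(measurable_wrt_set sG); exact: measurableT.
have p_fin : ('E_P[sqr_p] < +oo)%E.
  apply: (@le_lt_trans _ _ ('E_P[fun=> \sum_i (u i - 0) ^+ 2])%E).
    by rewrite expectation.unlock; exact: p_min null_strategy0 GT.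
  by rewrite expectation_cst ltry.
have q_fin : ('E_P[sqr_q] < +oo)%E.
  apply: le_lt_trans p_fin; apply: ge0_expectation_le.
  - exact: (measurable_wrtW sG (measurable_sqr_dist u mq)).
  - exact: (measurable_wrtW sG (measurable_sqr_dist u mp)).
  - by move=> x; apply: sumr_ge0 => i _; exact: sqr_ge0.
  - move=> x; rewrite sqr_qE sum_sqr_subr_proj gerBl divr_ge0 ?sqr_ge0//.
    by apply: sumr_ge0 => i _; exact: sqr_ge0.
have : {ae P, forall x, sqr_p x <= sqr_q x}.
  apply: (ae_le_of_integral sG (measurable_sqr_dist u mp)
    (measurable_sqr_dist u mq)) => [||A]; [exact: integrable_sqr_dist..|].
  exact: p_min.
by apply: filterS => x; rewrite sqr_qE; exact: sum_sqr_subr_proj_ge.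
Qed.

Theorem null_projection_exists : exists p, is_null_projection p.
Proof.
have /choice[p pP] (k : I) : exists p, null_strategy p /\
    forall z, null_strategy z -> {ae P, forall x, z k x = \sum_i p i x * z i x}.
  have [p np p_orth] := null_strategy_projection (fun i => (i == k)%:R).
  exists p; split => // z /p_orth; apply: filterS => x orth.
  apply/eqP; rewrite -subr_eq0; apply/eqP; rewrite -[RHS]orth.
  under [RHS]eq_bigr do rewrite mulrBl.
  rewrite sumrB; congr (_ - _).
  rewrite (bigD1 k)//= eqxx mul1r big1 ?addr0// => i /negPf ->.
  by rewrite mul0r.
have np k := (pP k).1.
have p_sym : {ae P, forall x, forall k j, p k j x = p j k x}.
  apply: filter_forall => k; apply: filter_forall => j.
  apply: filterS2 ((pP k).2 _ (np j)) ((pP j).2 _ (np k)) => x -> ->.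
  by apply: eq_bigr => i _; rewrite mulrC.
exists p; split.
- by move=> k i; exact: (np k).1.
- move=> h mh; split.
    move=> k; apply: measurable_sum => i; apply: measurable_funM => //.
    exact: (np k).1.
  have p_null : {ae P, forall x, forall k, \sum_i p k i x * X i x = 0}.
    by apply: filter_forall => k; exact: (np k).2.
  apply: filterS2 p_sym p_null => x sym_x nx /=.
  transitivity (\sum_i h i x * \sum_k p i k x * X k x).
    under eq_bigr do rewrite mulr_suml.
    rewrite exchange_big/=; apply: eq_bigr => i _; rewrite mulr_sumr.
    by apply: eq_bigr => k _; rewrite (sym_x k i); ring.
  by apply: big1 => i _; rewrite nx mulr0.
- by move=> z nz; apply: filter_forall => k; exact: (pP k).2.
Qed.

End null_projection.

(** * One-period estimates *)

Section neg_part.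
Context {R : realType}.
Implicit Types r s : R.

Definition neg_part r : R := Num.max (- r) 0.

Lemma neg_part_ge0 r : 0 <= neg_part r.
Proof. by rewrite le_max lexx orbT. Qed.

Lemma neg_part_le0 r : r <= 0 -> neg_part r = - r.
Proof. by move=> r0; rewrite /neg_part max_l// oppr_ge0. Qed.

Lemma neg_part_id0 r : 0 <= r -> neg_part r = 0.
Proof. by move=> r0; rewrite /neg_part max_r// oppr_le0. Qed.

Lemma neg_part_eq0 r : neg_part r = 0 -> 0 <= r.
Proof. by move=> r0; rewrite -oppr_le0 -[X in _ <= X]r0 le_max lexx. Qed.

Lemma le_neg_part r s : r <= s -> neg_part s <= neg_part r.
Proof. by move=> rs; rewrite ge_max !le_max lerN2 rs lexx orbT. Qed.

Lemma pos_partB_neg_part r : Num.max r 0 - neg_part r = r.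
Proof.
by have [r0|r0] := leP 0 r; [rewrite neg_part_id0// subr0|
  rewrite neg_part_le0 ?opprK ?add0r// ltW].
Qed.

Lemma neg_partM r s : 0 <= r -> neg_part (r * s) = r * neg_part s.
Proof. by move=> r0; rewrite /neg_part maxr_pMr// mulr0 mulrN. Qed.

Lemma neg_part_mid r s : neg_part ((r + s) / 2) <= (neg_part r + neg_part s) / 2.
Proof.
have := neg_part_ge0 r; have := neg_part_ge0 s; rewrite ge_max.
have : - r <= neg_part r by rewrite le_max lexx.
have : - s <= neg_part s by rewrite le_max lexx.
by move=> *; apply/andP; split; lra.
Qed.

Lemma neg_partB r s : 0 <= s -> neg_part (r - s) <= neg_part r + s.
Proof.
move=> s0; rewrite ge_max; have := neg_part_ge0 r.
have : - r <= neg_part r by rewrite le_max lexx.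
by move=> *; apply/andP; split; lra.
Qed.

Lemma neg_part_le_norm r : neg_part r <= `|r|.
Proof. by rewrite ge_max normr_ge0 -normrN ler_norm. Qed.

Lemma cvg_neg_part (u : nat -> R) l :
  u n @[n --> \oo] --> l -> neg_part (u n) @[n --> \oo] --> neg_part l.
Proof.
move=> ul; have cont_neg_part : {for l, continuous neg_part}.
  apply: (@continuous_max _ _ -%R (cst 0)); first exact: opp_continuous.
  exact: cst_continuous.
exact: (continuous_cvg _ cont_neg_part ul).
Qed.

Lemma measurable_neg_part d (T : measurableType d) (f : T -> R) :
  measurable_fun setT f -> measurable_fun setT (fun x => neg_part (f x)).
Proof. exact: measurable_funrneg. Qed.

End neg_part.

Section weights.
Context {R : realType} {d : measure_display} {T : measurableType d}.
Variable G : set (set T).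

Definition is_weight (a : T -> R) := measurable_wrt G a /\ forall x, 0 < a x <= 1.

Lemma is_weight1 : is_weight (cst 1).
Proof. by split=> [|x]; [exact: measurable_cst|rewrite ltr01 lexx]. Qed.

Lemma weight_gt0 a x : is_weight a -> 0 < a x.
Proof. by case=> _ /(_ x)/andP[]. Qed.

Lemma weight_ge0 a x : is_weight a -> 0 <= a x.
Proof. by move=> wa; exact/ltW/weight_gt0. Qed.

Lemma weight_le1 a x : is_weight a -> a x <= 1.
Proof. by case=> _ /(_ x)/andP[]. Qed.

Lemma is_weightM a b : is_weight a -> is_weight b -> is_weight (fun x => a x * b x).
Proof.
move=> wa wb; split=> [|x]; first by apply: measurable_funM; [exact: wa.1|exact: wb.1].
rewrite mulr_gt0 ?(weight_gt0 x wa) ?(weight_gt0 x wb)//=.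
by rewrite mulr_ile1 ?(weight_ge0 x wa) ?(weight_ge0 x wb)
  ?(weight_le1 x wa) ?(weight_le1 x wb).
Qed.

Variables (J : finType) (a : J -> T -> R).
Hypothesis wa : forall j, is_weight (a j).

Lemma weight_prod_le j x : \prod_i a i x <= a j x.
Proof.
rewrite (bigD1 j)//= ler_piMr ?(weight_ge0 x (wa j))//.
by apply: prodr_ile1 => i _; rewrite (weight_ge0 x (wa i)) (weight_le1 x (wa i)).
Qed.

Lemma is_weight_prod : is_weight (fun x => \prod_j a j x).
Proof.
split=> [|x]; first by apply: measurable_prod => j _; case: (wa j).
rewrite prodr_gt0 ?prodr_ile1// => j _; last exact: weight_gt0 (wa j).
by rewrite (weight_ge0 x (wa j)) (weight_le1 x (wa j)).
Qed.

End weights.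

Section orthant.
Context {R : realType} {dO : measure_display} {Omega : measurableType dO}.
Variable P : probability Omega R.
Variable G : set (set Omega).

Variable J : finType.

Definition orthant (eps : J -> bool) : set (J -> R) :=
  [set v | forall j, 0 <= (-1) ^+ eps j * v j].

Definition simplex (eps : J -> bool) : set (J -> R) :=
  [set v | orthant eps v /\ \sum_j (-1) ^+ eps j * v j = 1].

Hypothesis sG : sub_sigma_algebra G.
Variables (phi : Omega -> (J -> R) -> R) (eps : J -> bool) (j0 : J).
Hypothesis phi_integrand : convex_integrand phi.
Hypothesis phiZ : forall x c v, 0 <= c -> phi x (fun j => c * v j) = c * phi x v.
Hypothesis phi_nondegenerate : forall y : J -> Omega -> R,
  (forall j, measurable_wrt G (y j)) ->
  {ae P, forall x, orthant eps (y^~ x)} -> {ae P, forall x, phi x (y^~ x) = 0} ->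
  {ae P, forall x, forall j, y j x = 0}.

Let phi_ge0 x v : 0 <= phi x v.
Proof. by case: phi_integrand. Qed.

Let measurable_phi (y : J -> Omega -> R) : (forall j, measurable_wrt G (y j)) ->
  measurable_fun setT (fun x => phi x (y^~ x)).
Proof.
case: phi_integrand => + _ _ _ my; apply => j.
exact: (measurable_wrtW sG (my j)).
Qed.

Let phi0 x : phi x (fun=> 0) = 0.
Proof. by apply: homogeneous_fun0 => a v; exact: phiZ. Qed.

Let sg j : R := (-1) ^+ eps j.

Let norm_orthant v j : orthant eps v -> `|v j| = sg j * v j.
Proof. by move=> /(_ j) /ger0_norm <-; rewrite normrMsign. Qed.

Let simplex_le1 v j : simplex eps v -> `|v j| <= 1.
Proof.
move=> [ov sum_v]; rewrite norm_orthant// -sum_v (bigD1 j)//= lerDl.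
by apply: sumr_ge0 => k _; exact: ov.
Qed.

Let vertex j : R := if j == j0 then sg j0 else 0.

Let simplex_vertex : simplex eps vertex.
Proof.
have sg_vertex j : sg j * vertex j = (j == j0)%:R.
  by rewrite /vertex; case: eqP => [->|_]; rewrite ?mulr0// -expr2 sqrr_sign.
split; first by move=> j; rewrite -/(sg j) sg_vertex.
under eq_bigr do rewrite -/(sg _) sg_vertex.
by rewrite (bigD1 j0)//= eqxx big1 ?addr0// => j /negPf ->.
Qed.

Let simplex_argmin : (forall x, phi x vertex <= 1) ->
  exists2 z, selections P G (fun=> simplex eps) z &
    forall y A, selections P G (fun=> simplex eps) y -> G A ->
      (\int[P]_(x in A) (phi x (z^~ x))%:E <= \int[P]_(x in A) (phi x (y^~ x))%:E)%E.
Proof.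
move=> phi_vertex; apply: (selection_argmin sG (c := 1)) => //.
- move=> _ v w [ov sv] [ow sw]; split => [j|].
    by have := ov j; have := ow j; lra.
  by rewrite sum_mulr_mid sv sw; field.
- move=> _ v w sv vw; split => [j|].
    have cvg_j : sg j * v n j @[n --> \oo] --> sg j * w j.
      by apply: cvgM; [exact: cvg_cst|exact: vw].
    by apply: (cvgr_to_ge cvg_j); apply: nearW => n; have [ov _] := sv n; exact: ov.
  have cvg_sum : (\sum_j sg j * v n j) @[n --> \oo] --> \sum_j sg j * w j.
    by apply: cvg_fin_sum => j; apply: cvgM; [exact: cvg_cst|exact: vw].
  rewrite -(cvg_lim _ cvg_sum)//.
  by under eq_fun => n do rewrite (sv n).2; exact: lim_cst.
- by move=> x v sv j; rewrite (le_trans (simplex_le1 j sv))// lerDl.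
- have mvertex j : measurable_wrt G (fun=> vertex j) by exact: measurable_cst.
  exists (fun j => cst (vertex j)); first by split => //; exact: nearW.
  apply: (@le_lt_trans _ _ ('E_P[cst 1])%E); last by rewrite expectation_cst ltry.
  by apply: ge0_expectation_le => //; exact: measurable_phi.
Qed.

(* The conditional expectation of the minimum of phi over the simplex can only
   vanish where a nonzero selection has cost 0. *)
Let simplex_density_gt0 (z : J -> Omega -> R) (xi al : Omega -> R) :
  selections P G (fun=> simplex eps) z ->
  measurable_fun setT xi -> (forall x, 0 <= xi x) ->
  (forall x, xi x = 0 -> phi x (z^~ x) = 0) ->
  is_cond_exp P G xi al -> (forall x, 0 <= al x) ->
  {ae P, forall x, 0 < al x}.
Proof.
move=> [mz sz] mxi xi0 xi_phi [mal alE] al0.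
pose b := [set x | al x <= 0].
have Gb : G b by exact: measurable_wrt_ler.
have mb := (measurable_wrt_set sG b).2 Gb.
have xi_b : {ae P, forall x, b x -> (xi x)%:E = 0%E}.
  have mxib : measurable_fun b (EFin \o xi).
    by apply/measurable_EFinP; exact: measurable_funTS.
  apply/(ae_eq_integral_abs P (sG.2 _ Gb) mxib).
  under eq_integral do rewrite /= ger0_norm//.
  rewrite -alE// (eq_integral (cst 0%E)) ?integral0// => x; rewrite inE => bx.
  by congr (_%:E); apply/eqP; rewrite eq_le bx al0.
pose h j x := if x \in b then z j x else 0.
have mh j : measurable_wrt G (h j) by exact: measurable_ifE.
have h_orthant : {ae P, forall x, orthant eps (h^~ x)}.
  apply: filterS sz => x [oz _] j; rewrite /h.
  by case: ifP => _; [exact: oz|rewrite mulr0].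
have phi_h : {ae P, forall x, phi x (h^~ x) = 0}.
  apply: filterS xi_b => x xi_bx; have [bx|nbx] := pselect (b x).
    rewrite (_ : h^~ x = z^~ x); first by have [/xi_phi] := xi_bx bx.
    by apply/funext => j; rewrite /h mem_set.
  by rewrite (_ : h^~ x = fun=> 0)//; apply/funext => j; rewrite /h memNset.
apply: filterS2 sz (phi_nondegenerate mh h_orthant phi_h) => x [_ sum_z] h_eq0.
rewrite ltNge; apply/negP => bx; move/eqP: sum_z.
rewrite big1 ?(eq_sym 0) ?oner_eq0// => j _.
by have := h_eq0 j; rewrite /h mem_set// => ->; rewrite mulr0.
Qed.

Hypothesis phi_le1 : forall x v, (forall j, `|v j| <= 1) -> phi x v <= 1.

Let simplex_weight : exists2 a, is_weight G a &
  forall y A, selections P G (fun=> simplex eps) y -> G A ->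
    (\int[P]_(x in A) (a x)%:E <= \int[P]_(x in A) (phi x (y^~ x))%:E)%E.
Proof.
have [|z sz z_min] := simplex_argmin.
  by move=> x; apply: phi_le1 => j; exact: simplex_le1 simplex_vertex.
have mz := measurable_phi sz.1.
pose xi x := Num.min (phi x (z^~ x)) 1.
have mxi : measurable_fun setT xi by exact: measurable_minr.
have xi01 x : 0 <= xi x <= 1 by rewrite le_min phi_ge0 ler01/= ge_min lexx orbT.
have [al cal al01] := bounded_cond_exp_exists P sG mxi xi01.
have al_gt0 : {ae P, forall x, 0 < al x}.
  apply: (simplex_density_gt0 sz mxi) => //.
  - by move=> x; case/andP: (xi01 x).
  - by move=> x; rewrite /xi; case: leP => // _ /eqP; rewrite oner_eq0.
  - by move=> x; case/andP: (al01 x).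
pose b := [set x | al x <= 0].
have mb : measurable (b : set (g_sigma_algebraType G)).
  by apply/(measurable_wrt_set sG)/(measurable_wrt_ler sG) => //; exact: cal.1.
pose a x := if x \in b then 1 else al x.
have ma : measurable_wrt G a by apply: measurable_ifE => //; exact: cal.1.
exists a.
  split=> // x; rewrite /a; case: ifPn => [_|]; first by rewrite ltr01 lexx.
  rewrite notin_setE/= => /negP; rewrite -ltNge => ->.
  by case/andP: (al01 x).
move=> y A sy GA; apply: le_trans (z_min _ _ sy GA).
have mA := sG.2 _ GA.
have mfunA (f : Omega -> R) : measurable_fun setT f -> measurable_fun A (EFin \o f).
  by move=> mf; apply/measurable_EFinP; exact: measurable_funTS.
rewrite (ae_eq_integral (EFin \o al))//; last 3 first.
- exact/mfunA/(measurable_wrtW sG).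
- exact/mfunA/(measurable_wrtW sG cal.1).
- apply: filterS al_gt0 => x alx _; rewrite /= /a memNset//=.
  by apply/negP; rewrite -ltNge.
rewrite cal.2//; apply: ge0_le_integral => //.
- by move=> x _; rewrite lee_fin; case/andP: (xi01 x).
- exact: mfunA.
- exact: mfunA.
- by move=> x _; rewrite lee_fin ge_min lexx.
Qed.

Lemma orthant_weight : exists2 a, is_weight G a &
  forall y : J -> Omega -> R, (forall j, measurable_wrt G (y j)) ->
    (forall x, orthant eps (y^~ x)) ->
    ('E_P[fun x => a x * \sum_j `|y j x|] <= 'E_P[fun x => phi x (y^~ x)])%E.
Proof.
have [a wa a_min] := simplex_weight; exists a => // y my oy; have [ma _] := wa.
pose t (x : Omega) : R := \sum_j `|y j x|.
have t_ge0 x : 0 <= t x by exact: sumr_ge0.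
have mt : measurable_wrt G t.
  by apply: measurable_sum => j; exact: measurableT_comp.
pose w j (x : Omega) : R := if 0 < t x then y j x / t x else vertex j.
have mw j : measurable_wrt G (w j).
  apply: measurable_fun_ifT; first exact: measurable_fun_ltr.
    by apply: measurable_funM => //; exact: measurable_funV.
  exact: measurable_cst.
have w_normalised x : 0 < t x -> w^~ x = fun j => y j x / t x.
  by move=> t0; apply/funext => j; rewrite /w t0.
have w_vertex x : t x <= 0 -> w^~ x = vertex.
  by move=> t0; apply/funext => j; rewrite /w ltNge t0.
have sw : selections P G (fun=> simplex eps) w.
  split=> //; apply: nearW => x; have [t0|t0] := ltP 0 (t x); last first.
    by rewrite w_vertex//; exact: simplex_vertex.
  rewrite w_normalised//; split => [j|].
    by rewrite mulrA divr_ge0//; exact: oy.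
  transitivity (\sum_j `|y j x| / t x).
    apply: eq_bigr => j _; rewrite mulrA; congr (_ / _).
    exact/esym/(norm_orthant j (oy x)).
  by rewrite -mulr_suml divff// gt_eqF.
have t_phi x : t x * phi x (w^~ x) = phi x (y^~ x).
  rewrite -phiZ//; congr (phi x _); apply/funext => j.
  have [t0|t_le0] := ltP 0 (t x).
    by rewrite -[w j x]/(w^~ x j) w_normalised// mulrC divfK// gt_eqF.
  have t0 : t x = 0 by apply/eqP; rewrite eq_le t_le0 t_ge0.
  rewrite t0 mul0r; apply/esym/eqP; rewrite -normr_le0 -t0 /t (bigD1 j)//= lerDl.
  exact: sumr_ge0.
rewrite (eq_expectation P (fun x => mulrC (a x) (t x))).
rewrite -(eq_expectation P t_phi).
apply: (le_expectation_weight sG) => //.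
- exact: (measurable_wrtW sG).
- by move=> x; exact: weight_ge0 wa.
- exact: measurable_phi.
- by move=> A GA; exact: a_min.
Qed.

End orthant.

Section sign_regions.
Context {R : realType} {d} {T : measurableType d}.
Variables (I : finType) (y : I -> T -> R).

Definition sign_region (e : {ffun I -> bool}) : set T :=
  [set x | forall i, e i = (y i x < 0)].

Lemma measurable_sign_region e : (forall i, measurable_fun setT (y i)) ->
  measurable (sign_region e).
Proof.
move=> my; rewrite (_ : sign_region e =
    \bigcap_(i in setT) ((fun x => e i == (y i x < 0)) @^-1` [set true])).
  apply: fin_bigcap_measurable => [|i _]; first exact: finite_finset.
  rewrite -[X in measurable X]setTI.
  have mneg : measurable_fun setT (fun x => y i x < 0) by exact: measurable_fun_ltr.
  have : measurable_fun setT (fun x => e i == (y i x < 0)).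
    by case: (e i) => //=; exact: measurable_neg.
  exact.
by apply/seteqP; split => x /= ex i; [move=> _|]; apply/eqP; exact: ex.
Qed.

Lemma sign_regionE e x : sign_region e x <-> e = [ffun i => y i x < 0].
Proof. by split=> [ex|-> i]; [apply/ffunP => i|]; rewrite ffunE. Qed.

Lemma sum_sign_region (J : Type) (F : {ffun I -> bool} -> (J -> R) -> R)
    (v : J -> R) x : (forall e, F e (fun=> 0) = 0) ->
  \sum_e F e (fun j => if x \in sign_region e then v j else 0) =
  F [ffun i => y i x < 0] v.
Proof.
move=> F0; rewrite (bigD1 [ffun i => y i x < 0])//= big1 ?addr0 => [|e ne].
  by rewrite mem_set//; exact/sign_regionE.
by rewrite memNset// => /sign_regionE ee; rewrite ee eqxx in ne.
Qed.

End sign_regions.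

Section one_period.
Context {R : realType} {dO : measure_display} {Omega : measurableType dO}.
Variable P : probability Omega R.
Variable G : set (set Omega).
Variables (I : finType) (X : I -> Omega -> R).

Definition one_period_NA := forall h : I -> Omega -> R,
  (forall i, measurable_wrt G (h i)) ->
  {ae P, forall x, 0 <= \sum_i h i x * X i x} ->
  {ae P, forall x, \sum_i h i x * X i x = 0}.

Hypothesis sG : sub_sigma_algebra G.
Hypothesis mX : forall i, measurable_fun setT (X i).
Variables (p : I -> I -> Omega -> R) (ga : Omega -> R).
Hypothesis p_proj : is_null_projection P G X p.
Hypothesis na : one_period_NA.
Hypothesis mga : measurable_fun setT ga.
Hypothesis ga01 : forall x, 0 < ga x <= 1.

Let J : finType := option I.

(* The coordinate None carries the wealth and Some i the position in asset i. *)
Let payoff x (v : J -> R) := v None + \sum_i v (Some i) * X i x.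
Let null_norm x (v : J -> R) := \sum_k `|\sum_i p k i x * v (Some i)|.
Let scale x := 1 + \sum_i `|X i x| + \sum_k \sum_i `|p k i x|.
Let rho x := ga x / scale x.
Let phi x v := rho x * (neg_part (payoff x v) + null_norm x v).

Let scale_ge1 x : 1 <= scale x.
Proof.
rewrite /scale -addrA lerDl addr_ge0// ?sumr_ge0// => k _.
by rewrite sumr_ge0.
Qed.

Let rho_gt0 x : 0 < rho x.
Proof.
have /andP[g0 _] := ga01 x; apply: divr_gt0 => //.
exact: lt_le_trans ltr01 (scale_ge1 x).
Qed.

Let rho_le x : rho x <= ga x.
Proof.
have /andP[g0 _] := ga01 x.
rewrite ler_pdivrMr ?(lt_le_trans ltr01 (scale_ge1 x))//.
by rewrite ler_peMr ?scale_ge1// ltW.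
Qed.

Let null_norm_ge0 x v : 0 <= null_norm x v.
Proof. exact: sumr_ge0. Qed.

Let phi_le1 x v : (forall j, `|v j| <= 1) -> phi x v <= 1.
Proof.
move=> v1; have /andP[g0 g1] := ga01 x.
have scale_gt0 := lt_le_trans ltr01 (scale_ge1 x).
rewrite /phi /rho mulrAC ler_pdivrMr// mul1r.
apply: (@le_trans _ _ (neg_part (payoff x v) + null_norm x v)).
  by rewrite ler_piMl// addr_ge0// neg_part_ge0.
rewrite /scale lerD//.
  apply: (le_trans (neg_part_le_norm _)); apply: (le_trans (ler_normD _ _)).
  rewrite lerD//; apply: (le_trans (ler_norm_sum _ _ _)); apply: ler_sum => i _.
  by rewrite normrM ler_piMl.
apply: ler_sum => k _; apply: (le_trans (ler_norm_sum _ _ _)).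
by apply: ler_sum => i _; rewrite normrM ler_piMr.
Qed.

Let measurable_phi (y : J -> Omega -> R) : (forall j, measurable_fun setT (y j)) ->
  measurable_fun setT (fun x => phi x (y^~ x)).
Proof.
move=> my; have [mp _ _] := p_proj.
have mpW k i : measurable_fun setT (p k i) by exact: (measurable_wrtW sG).
apply: measurable_funM.
  apply: measurable_funM => //; apply: measurable_funV.
  apply: measurable_funD; first apply: measurable_funD => //.
    by apply: measurable_sum => i; exact: measurableT_comp.
  by do 2!apply: measurable_sum => ?; exact: measurableT_comp.
apply: measurable_funD.
  apply: measurable_neg_part; apply: measurable_funD => //.
  by apply: measurable_sum => i; exact: measurable_funM.
apply: measurable_sum => k; apply: measurableT_comp => //.
by apply: measurable_sum => i; exact: measurable_funM.
Qed.

Let phi_mid x v w : phi x (fun j => (v j + w j) / 2) <= (phi x v + phi x w) / 2.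
Proof.
rewrite /phi -mulrDr -mulrA ler_pM2l//.
have -> : payoff x (fun j => (v j + w j) / 2) = (payoff x v + payoff x w) / 2.
  by rewrite /payoff sum_mull_mid; field.
have := neg_part_mid (payoff x v) (payoff x w).
have : null_norm x (fun j => (v j + w j) / 2) <= (null_norm x v + null_norm x w) / 2.
  rewrite /null_norm -big_split mulr_suml/=; apply: ler_sum => k _.
  rewrite sum_mulr_mid normrM (ger0_norm (_ : 0 <= 2^-1 :> R)) ?invr_ge0//.
  by rewrite ler_pM2r ?invr_gt0//; exact: ler_normD.
lra.
Qed.

Let phi_cvg x (v : nat -> J -> R) w : (forall j, v n j @[n --> \oo] --> w j) ->
  phi x (v n) @[n --> \oo] --> phi x w.
Proof.
move=> vw; apply: cvgM; first exact: cvg_cst.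
apply: cvgD.
  apply: cvg_neg_part; apply: cvgD => //.
  by apply: cvg_fin_sum => i; apply: cvgM => //; exact: cvg_cst.
apply: cvg_fin_sum => k; apply: cvg_norm.
by apply: cvg_fin_sum => i; apply: cvgM => //; exact: cvg_cst.
Qed.

Let phi_integrand : convex_integrand phi.
Proof.
split; [exact: measurable_phi| |exact: phi_mid|exact: phi_cvg].
move=> x v; rewrite mulr_ge0 ?(ltW (rho_gt0 x))//.
by rewrite addr_ge0 ?neg_part_ge0 ?null_norm_ge0.
Qed.

Let phiZ x c v : 0 <= c -> phi x (fun j => c * v j) = c * phi x v.
Proof.
move=> c0; rewrite /phi mulrCA; congr (_ * _).
have -> : payoff x (fun j => c * v j) = c * payoff x v.
  rewrite /payoff mulrDr mulr_sumr; congr (_ + _).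
  by apply: eq_bigr => i _; rewrite mulrA.
rewrite neg_partM// mulrDr; congr (_ + _).
rewrite /null_norm mulr_sumr; apply: eq_bigr => k _.
rewrite -[X in X * _](ger0_norm c0) -normrM mulr_sumr; congr `| _ |.
by apply: eq_bigr => i _; ring.
Qed.

Let phi0 x : phi x (fun=> 0) = 0.
Proof. by apply: homogeneous_fun0 => a v; exact: phiZ. Qed.

Let phi_eq0 x v : phi x v = 0 ->
  0 <= payoff x v /\ forall k, \sum_i p k i x * v (Some i) = 0.
Proof.
move/eqP; rewrite mulf_eq0 (gt_eqF (rho_gt0 x))/=.
rewrite paddr_eq0 ?neg_part_ge0// => /andP[/eqP/neg_part_eq0 payoff_ge0].
rewrite /null_norm psumr_eq0// => /allP null0; split => // k.
by have := null0 k (mem_index_enum k); rewrite normr_eq0 => /eqP.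
Qed.

Let phi_nondegenerate (y : J -> Omega -> R) : (forall j, measurable_wrt G (y j)) ->
  {ae P, forall x, y None x <= 0} -> {ae P, forall x, phi x (y^~ x) = 0} ->
  {ae P, forall x, forall j, y j x = 0}.
Proof.
move=> my yN phi_y0; pose h i := y (Some i).
have h_ge0 : {ae P, forall x, 0 <= \sum_i h i x * X i x}.
  apply: filterS2 yN phi_y0 => x yNx /phi_eq0[+ _].
  by rewrite /payoff -/(h _); lra.
have h_null := na (fun i => my (Some i)) h_ge0.
have [_ _ p_id] := p_proj.
have h_fixed := p_id h (conj (fun i => my (Some i)) h_null).
apply: filterS3 (filterI yN phi_y0) h_null h_fixed => x [yNx /phi_eq0[pay ph0]] hX hp.
have h0 i : y (Some i) x = 0 by rewrite -[LHS]/(h i x) hp; exact: ph0.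
case=> [i|]; first exact: h0.
apply/eqP; rewrite eq_le yNx /=; move: pay; rewrite /payoff big1 ?addr0// => i _.
by rewrite h0 mul0r.
Qed.

Let pattern (e : {ffun I -> bool}) (j : J) : bool := if j is Some i then e i else true.

Let pattern_weight : exists2 a : {ffun I -> bool} -> Omega -> R,
  forall e, is_weight G (a e) & forall e (y : J -> Omega -> R),
    (forall j, measurable_wrt G (y j)) -> (forall x, orthant (pattern e) (y^~ x)) ->
    ('E_P[fun x => a e x * \sum_j `|y j x|] <= 'E_P[fun x => phi x (y^~ x)])%E.
Proof.
have weight e : exists a : Omega -> R, is_weight G a /\
    forall y : J -> Omega -> R, (forall j, measurable_wrt G (y j)) ->
      (forall x, orthant (pattern e) (y^~ x)) ->
      ('E_P[fun x => a x * \sum_j `|y j x|] <= 'E_P[fun x => phi x (y^~ x)])%E.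
  have [|a wa aP] := orthant_weight (P := P) sG (eps := pattern e) None
    phi_integrand phiZ _ phi_le1; last by exists a.
  move=> y my oy; apply: phi_nondegenerate => //; apply: filterS oy => x /(_ None).
  by rewrite /= expr1 mulN1r oppr_ge0.
by have [a aP] := choice weight; exists a => e; have [] := aP e.
Qed.

Let cone_weight : exists2 al, is_weight G al &
  forall y : J -> Omega -> R, (forall j, measurable_wrt G (y j)) ->
    (forall x, y None x <= 0) ->
    ('E_P[fun x => al x * \sum_j `|y j x|] <= 'E_P[fun x => phi x (y^~ x)])%E.
Proof.
have [a wa aP] := pattern_weight.
exists (fun x => \prod_e a e x); first exact: is_weight_prod.
have ma e : measurable_wrt G (a e) by case: (wa e).
have a_gt0 e x : 0 < a e x := weight_gt0 x (wa e).
move=> y my yN; pose A := sign_region (fun i => y (Some i)).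
pose yA e j x := if x \in A e then y j x else 0.
have myA e j : measurable_wrt G (yA e j).
  by apply: measurable_ifE => //; exact: measurable_sign_region.
have oyA e x : orthant (pattern e) ((yA e)^~ x).
  move=> j; rewrite /yA; case: ifPn => [|_]; last by rewrite mulr0.
  rewrite inE => Ax; case: j => [i|] /=; last by rewrite expr1 mulN1r oppr_ge0.
  rewrite (Ax i); case: ltP => [/ltW yi|yi]; last by rewrite expr0 mul1r.
  by rewrite expr1 mulN1r oppr_ge0.
have phi_sum x : phi x (y^~ x) = \sum_e phi x ((yA e)^~ x).
  by rewrite (@sum_sign_region _ _ _ _ (fun i => y (Some i)) _ (fun=> phi x)).
have norm_sum x : a [ffun i => y (Some i) x < 0] x * \sum_j `|y j x| =
    \sum_e a e x * \sum_j `|yA e j x|.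
  rewrite (@sum_sign_region _ _ _ _ (fun i => y (Some i)) _
    (fun e v => a e x * \sum_j `|v j|))// => e.
  by rewrite big1 ?mulr0// => j _; rewrite normr0.
have mphi e : measurable_fun setT (fun x => phi x ((yA e)^~ x)).
  by apply: measurable_phi => j; exact: (measurable_wrtW sG).
have mterm e : measurable_fun setT (fun x => a e x * \sum_j `|yA e j x|).
  apply: (measurable_wrtW sG); apply: measurable_funM => //.
  by apply: measurable_sum => j; exact: measurableT_comp.
have term_ge0 e x : 0 <= a e x * \sum_j `|yA e j x|.
  by rewrite mulr_ge0 ?sumr_ge0// ltW.
have phi_ge0 x v : 0 <= phi x v by case: phi_integrand.
rewrite (eq_expectation P phi_sum) ge0_expectation_sum//.
apply: le_trans (lee_sum _ (fun e _ => aP e (yA e) (myA e) (oyA e))).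
rewrite -ge0_expectation_sum//; apply: ge0_expectation_le.
- apply: (measurable_wrtW sG); apply: measurable_funM.
    exact: (is_weight_prod wa).1.
  by apply: measurable_sum => j; exact: measurableT_comp.
- exact: measurable_sum.
- by move=> x; rewrite mulr_ge0 ?sumr_ge0// ltW// prodr_gt0.
- by move=> x; rewrite -norm_sum ler_wpM2r ?sumr_ge0//; exact: (weight_prod_le wa).
Qed.

Let phi_null_norm0_le x r (v : J -> R) : v None = Num.min r 0 -> null_norm x v = 0 ->
  phi x v <= ga x * neg_part (r + \sum_i v (Some i) * X i x) + Num.max r 0.
Proof.
move=> vN v_null; have /andP[/ltW ga0 ga1] := ga01 x.
have max_ge0 : 0 <= Num.max r 0 by rewrite le_max lexx orbT.
rewrite /phi v_null addr0; set S := \sum_i v (Some i) * X i x.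
have -> : payoff x v = r + S - Num.max r 0.
  by rewrite /payoff vN -/S; have := addr_max_min r 0; lra.
apply: (@le_trans _ _ (ga x * neg_part (r + S - Num.max r 0))).
  by rewrite ler_wpM2r ?neg_part_ge0 ?rho_le.
apply: (@le_trans _ _ (ga x * (neg_part (r + S) + Num.max r 0))).
  by rewrite ler_wpM2l// neg_partB.
by rewrite mulrDr lerD2l ler_piMl.
Qed.

Lemma one_period_bound : exists2 al, is_weight G al &
  forall (w : Omega -> R) (h : I -> Omega -> R),
    measurable_wrt G w -> (forall i, measurable_wrt G (h i)) ->
    {ae P, forall x, forall k, \sum_i p k i x * h i x = 0} ->
    ('E_P[fun x => al x * (neg_part (w x) + \sum_i `|h i x|)] <=
     'E_P[fun x => ga x * neg_part (w x + \sum_i h i x * X i x)] +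
     'E_P[fun x => Num.max (w x) 0])%E.
Proof.
have [al wal alP] := cone_weight; exists al => // w h mw mh ph.
have mwW := measurable_wrtW sG mw.
have ga_ge0 x : 0 <= ga x by case/andP: (ga01 x) => /ltW.
pose y (j : J) x := if j is Some i then h i x else Num.min (w x) 0.
have my j : measurable_wrt G (y j).
  by case: j => [i|]; [exact: mh|exact: measurable_minr].
have yN x : y None x <= 0 by rewrite /y ge_min lexx orbT.
have normE x : al x * \sum_j `|y j x| = al x * (neg_part (w x) + \sum_i `|h i x|).
  congr (_ * _); rewrite (bigD1 None)//=; congr (_ + _).
    rewrite /y; have [w0|w0] := leP (w x) 0.
      by rewrite ler0_norm// neg_part_le0.
    by rewrite normr0 neg_part_id0// ltW.
  rewrite [LHS](reindex_omap Some id)/=; last by case.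
  by apply: eq_big => i; rewrite ?eqxx.
rewrite -(eq_expectation P normE); apply: le_trans (alP y my yN) _.
have mpayoff : measurable_fun setT (fun x => w x + \sum_i h i x * X i x).
  apply: measurable_funD => //; apply: measurable_sum => i.
  by apply: measurable_funM => //; exact: (measurable_wrtW sG).
have mloss : measurable_fun setT
    (fun x => ga x * neg_part (w x + \sum_i h i x * X i x)).
  by apply: measurable_funM => //; exact: measurable_neg_part.
have mmax : measurable_fun setT (fun x => Num.max (w x) 0) by exact: measurable_maxr.
have loss_ge0 x : 0 <= ga x * neg_part (w x + \sum_i h i x * X i x).
  by rewrite mulr_ge0// neg_part_ge0.
have max_ge0 x : 0 <= Num.max (w x) 0 by rewrite le_max lexx orbT.
rewrite -ge0_expectationD//; apply: expectation_le.
- by apply: measurable_phi => j; exact: (measurable_wrtW sG).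
- exact: measurable_funD.
- by move=> x; case: phi_integrand.
- by move=> x; rewrite addr_ge0.
apply: filterS ph => x phx; apply: phi_null_norm0_le => //.
by apply: big1 => k _; rewrite phx normr0.
Qed.

Lemma localized_one_period_bound : exists2 al, is_weight G al &
  forall (w : Omega -> R) (h : I -> Omega -> R) (de : Omega -> R),
    measurable_wrt G w -> (forall i, measurable_wrt G (h i)) ->
    measurable_wrt G de -> (forall x, 0 <= de x) ->
    {ae P, forall x, forall k, \sum_i p k i x * h i x = 0} ->
    ('E_P[fun x => al x * (de x * (neg_part (w x) + \sum_i `|h i x|))] <=
     'E_P[fun x => ga x * (de x * neg_part (w x + \sum_i h i x * X i x))] +
     'E_P[fun x => de x * Num.max (w x) 0])%E.
Proof.
have [al wal alP] := one_period_bound; exists al => // w h de mw mh mde de0 ph.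
have mdw : measurable_wrt G (fun x => de x * w x) by exact: measurable_funM.
have mdh i : measurable_wrt G (fun x => de x * h i x) by exact: measurable_funM.
have pdh : {ae P, forall x, forall k, \sum_i p k i x * (de x * h i x) = 0}.
  apply: filterS ph => x phx k; under eq_bigr do rewrite mulrCA.
  by rewrite -mulr_sumr phx mulr0.
have := alP _ _ mdw mdh pdh.
congr (_ <= _ + _)%E; apply: eq_expectation => x.
- congr (_ * _); rewrite neg_partM// mulrDr mulr_sumr; congr (_ + _).
  by apply: eq_bigr => i _; rewrite normrM ger0_norm.
- congr (_ * _); rewrite -neg_partM// mulrDr mulr_sumr; congr (neg_part (_ + _)).
  by apply: eq_bigr => i _; rewrite mulrA.
- by rewrite maxr_pMr// mulr0.
Qed.

End one_period.

(** * Regular conditional distributions *)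

Section disintegration.
Context {R : realType} {dO : measure_display} {Omega : measurableType dO}.
Variable P : probability Omega R.
Variable G : set (set Omega).
Hypothesis sG : sub_sigma_algebra G.
Context {dV : measure_display} {V : measurableType dV}.
Variable Z : Omega -> V.

Definition disintegrates (mu : Omega -> probability V R) (B : set V) :=
  measurable_wrt G (fun x => mu x B) /\
  forall A, G A -> P (A `&` Z @^-1` B) = (\int[P]_(x in A) mu x B)%E.

Hypothesis mZ : measurable_fun setT Z.
Variable mu : Omega -> probability V R.

Let measurable_preimage B : measurable B -> measurable (Z @^-1` B).
Proof. by move=> mB; rewrite -[X in measurable X]setTI; exact: mZ. Qed.

Let measurable_mu A B : disintegrates mu B -> measurable_fun A (mu^~ B).
Proof. by move=> [mmu _]; apply: measurable_funTS; exact: (measurable_wrtW sG). Qed.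

Lemma disintegratesT : disintegrates mu setT.
Proof.
split; first by under eq_fun do rewrite probability_setT; exact: measurable_cst.
move=> A GA; rewrite preimage_setT setIT.
under eq_integral do rewrite probability_setT.
by rewrite integral_cst ?mul1e//; exact: sG.2.
Qed.

Lemma disintegratesC B : measurable B -> disintegrates mu B -> disintegrates mu (~` B).
Proof.
move=> mB dB; have muC x : mu x (~` B) = (1 - mu x B)%E by exact: probability_setC.
have mmuC : measurable_wrt G (fun x => mu x (~` B)).
  under eq_fun do rewrite muC.
  by apply: emeasurable_funB; [exact: measurable_cst|exact: dB.1].
split=> // A GA; have mA := sG.2 _ GA.
have int_fin : (\int[P]_(x in A) mu x B)%E \is a fin_num.
  by rewrite -dB.2//; apply: fin_num_measure; apply: measurableI => //;
    exact: measurable_preimage.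
have PA : P A = (P (A `&` Z @^-1` (~` B)) + P (A `&` Z @^-1` B))%E.
  rewrite -measureU; first by rewrite -setIUr preimage_setC setUC setUv setIT.
  - by apply: measurableI => //; apply: measurable_preimage; exact: measurableC.
  - by apply: measurableI => //; exact: measurable_preimage.
  - by rewrite setIACA setIid preimage_setC setICl setI0.
have intA : P A = (\int[P]_(x in A) mu x (~` B) + \int[P]_(x in A) mu x B)%E.
  rewrite -ge0_integralD//; last 2 first.
  - by apply: measurable_funTS; exact: (measurable_wrtW sG).
  - exact: measurable_mu.
  rewrite (eq_integral (fun=> 1%E)); first by rewrite integral_cst// mul1e.
  by move=> x _; rewrite muC subeK// fin_num_measure.
rewrite -[LHS](addeK _ int_fin) -[RHS](addeK _ int_fin); congr (_ - _)%E.
by rewrite -intA PA dB.2.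
Qed.

Lemma disintegrates_bigcup (B : nat -> set V) : (forall n, measurable (B n)) ->
  trivIset setT B -> (forall n, disintegrates mu (B n)) ->
  disintegrates mu (\bigcup_n B n).
Proof.
move=> mB tB dB.
have mu_bigcup x : mu x (\bigcup_n B n) = (\sum_(0 <= n <oo) mu x (B n))%E.
  by rewrite measure_bigcup//; apply: eq_eseriesl => n; rewrite in_setT.
split.
  under eq_fun do rewrite mu_bigcup.
  apply: (@ge0_emeasurable_sum _ (g_sigma_algebraType G) _ _
    (fun n (x : Omega) => mu x (B n)) predT) => // n _.
  exact: (dB n).1.
move=> A GA; have mA := sG.2 _ GA; under eq_integral do rewrite mu_bigcup.
rewrite integral_nneseries//; last by move=> n; exact: measurable_mu.
rewrite preimage_bigcup setI_bigcupr measure_bigcup.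
- rewrite (eq_eseriesl (Q := predT)); last by move=> n; rewrite in_setT.
  by apply: eq_eseriesr => n _; exact: (dB n).2.
- by move=> n _; apply: measurableI => //; exact: measurable_preimage.
- apply: trivIset_setIl; apply/trivIsetP => i j _ _ ij; rewrite -preimage_setI.
  by move/trivIsetP : tB => ->//; rewrite preimage_set0.
Qed.

Lemma disintegrates_generated (gen : set (set V)) :
  @measurable _ V = <<s gen >> -> setI_closed gen ->
  (forall B, gen B -> disintegrates mu B) ->
  forall B, measurable B -> disintegrates mu B.
Proof.
move=> mgen genI gen_mu B mB; apply: (dynkin_induction mgen genI) => //.
- exact: disintegratesT.
- exact: disintegratesC.
- exact: disintegrates_bigcup.
- by rewrite -mgen.
Qed.

End disintegration.

Section disintegration_operations.
Context {R : realType} {dO : measure_display} {Omega : measurableType dO}.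
Variable P : probability Omega R.
Variable G : set (set Omega).
Hypothesis sG : sub_sigma_algebra G.
Context {dV : measure_display} {V : measurableType dV}.
Variables (Z : Omega -> V) (mu : Omega -> probability V R).
Hypothesis dmu : forall B, measurable B -> disintegrates P G Z mu B.

Lemma disintegrates_distribution {dW} {W : measurableType dW} (f : {mfun V >-> W})
    B : measurable B ->
  disintegrates P G (f \o Z) (fun x => distribution (mu x) f) B.
Proof.
move=> mB; have mfB : measurable (f @^-1` B) by exact: measurable_funPTI.
exact: dmu mfB.
Qed.

Lemma disintegrates_pair {dW} {W : measurableType dW} (h : Omega -> W) E :
  measurable_fun setT Z -> measurable_wrt G h -> measurable E ->
  measurable_wrt G (fun x => mu x (xsection E (h x))) /\
  P [set x | E (h x, Z x)] = (\int[P]_x mu x (xsection E (h x)))%E.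
Proof.
move=> mZ mh mE; have mhW := measurable_wrtW sG mh.
pose mupair x : probability (W * V)%type R :=
  distribution (mu x) (mfun_Sub (mem_set (pair1_measurable (h x)))).
pose hZ x := (h x, Z x).
have mhZ : measurable_fun setT hZ by exact: measurable_fun_pair.
suff : disintegrates P G hZ mupair E.
  under eq_fun do rewrite xsectionE.
  move=> [mE' /(_ setT)]; rewrite setTI => dE; split; first exact: mE'.
  by apply: dE; apply/(measurable_wrt_set sG); exact: measurableT.
move: E mE; apply: (disintegrates_generated sG mhZ
  (measurable_prod_measurableType _ _)).
  move=> _ _ [A mA [B mB <-]] [A' mA' [B' mB' <-]]; rewrite -setXI.
  exists (A `&` A'); first exact: measurableI.
  by exists (B `&` B') => //; exact: measurableI.
move=> _ [A mA [B mB <-]]; have [mmuB muB] := dmu mB.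
have mupairE x : mupair x (A `*` B) = ((mu^~ B) \_ (h @^-1` A)) x.
  rewrite /mupair/= /distribution /pushforward/= patchE.
  case: ifPn => hA; [congr (mu x _)|rewrite -[RHS](measure0 (mu x)); congr (mu x _)].
    by move: hA; rewrite inE => hA; apply/seteqP; split => [v []|].
  by apply/seteqP; split => // v [/= hxA _]; rewrite notin_setE in hA; exact: hA.
have GhA : G (h @^-1` A).
  by apply/(measurable_wrt_set sG); rewrite -[X in measurable X]setTI; exact: mh.
split.
  under eq_fun do rewrite mupairE.
  apply/(measurable_restrictT _ _).1 => //; first exact/(measurable_wrt_set sG).
  exact: measurable_funTS.
move=> C GC; under eq_integral do rewrite mupairE.
rewrite -integral_mkcondr -muB.
  by rewrite -setIA; congr (P (_ `&` _)); apply/seteqP; split.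
apply/(measurable_wrt_set sG).
by apply: measurableI; exact/(measurable_wrt_set sG).
Qed.

End disintegration_operations.

Section ternary.
Context {R : realType}.
Implicit Types b : nat -> bool.

Definition ternary_sum b n : R := \sum_(0 <= k < n) (b k)%:R * 3^-1 ^+ k.

Let ternary_sumS b n :
  ternary_sum b n.+1 = (b 0%N)%:R + 3^-1 * ternary_sum (fun k => b k.+1) n.
Proof.
rewrite /ternary_sum big_nat_recl//= expr0 mulr1; congr (_ + _).
by rewrite mulr_sumr; apply: eq_bigr => k _; rewrite exprS; ring.
Qed.

Let ternary_sum_bounds b n : 0 <= ternary_sum b n <= 3 / 2.
Proof.
elim: n b => [|n IHn] b; first by rewrite /ternary_sum big_nil; lra.
by rewrite ternary_sumS; have := IHn (fun k => b k.+1); case: (b 0%N) => /=; lra.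
Qed.

Definition ternary b : R := limn (ternary_sum b).

Lemma cvg_ternary_sum b : ternary_sum b n @[n --> \oo] --> ternary b.
Proof.
apply: nondecreasing_is_cvgn.
  apply/nondecreasing_seqP => n; rewrite /ternary_sum big_nat_recr//= lerDl.
  by rewrite mulr_ge0// exprn_ge0// invr_ge0.
by exists (3 / 2) => _ [n _ <-]; case/andP: (ternary_sum_bounds b n).
Qed.

Lemma ternary_bounds b : 0 <= ternary b <= 3 / 2.
Proof.
have sum_bounds n := andP (ternary_sum_bounds b n).
apply/andP; split.
  by apply: limr_ge; [exact: cvg_ternary_sum|apply: nearW => n; case: (sum_bounds n)].
by apply: limr_le; [exact: cvg_ternary_sum|apply: nearW => n; case: (sum_bounds n)].
Qed.

Lemma ternary_recl b : ternary b = (b 0%N)%:R + 3^-1 * ternary (fun k => b k.+1).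
Proof.
have shift_cvg : ternary_sum b n.+1 @[n --> \oo] --> ternary b.
  by rewrite (cvg_shiftS (ternary_sum b)); exact: cvg_ternary_sum.
have head_tail_cvg : ternary_sum b n.+1 @[n --> \oo] -->
    (b 0%N)%:R + 3^-1 * ternary (fun k => b k.+1).
  under eq_fun do rewrite ternary_sumS.
  apply: cvgD; first exact: cvg_cst.
  by apply: cvgM; [exact: cvg_cst|exact: cvg_ternary_sum].
exact: (cvg_unique _ shift_cvg head_tail_cvg).
Qed.

Fixpoint ternary_shift n (y : R) : R :=
  if n is m.+1 then
    let r := ternary_shift m y in 3 * (r - (if 1 <= r then 1 else 0))
  else y.

Definition ternary_digit n y : bool := 1 <= ternary_shift n y.

(* With digits 0 and 1 only, the tail of the expansion is at most 1/2, so that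
   the integer part is the leading digit. *)
Let ternary_ge1 b : (1 <= ternary b) = b 0%N.
Proof.
rewrite ternary_recl; have := ternary_bounds (fun k => b k.+1).
by case: (b 0%N) => /= tail; [apply/idP; lra|apply/negP; lra].
Qed.

Lemma ternary_shiftK b n : ternary_shift n (ternary b) = ternary (fun k => b (n + k)%N).
Proof.
elim: n => //= n ->; rewrite ternary_ge1 addn0 ternary_recl addn0.
rewrite (_ : (fun k => b (n + k.+1)%N) = fun k => b (n.+1 + k)%N); last first.
  by apply/funext => k; rewrite addnS.
by case: (b n) => /=; field.
Qed.

Lemma ternaryK b n : ternary_digit n (ternary b) = b n.
Proof. by rewrite /ternary_digit ternary_shiftK ternary_ge1 addn0. Qed.

Lemma measurable_ternary_digit n : measurable_fun setT (ternary_digit n).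
Proof.
apply: measurable_fun_ler => //; elim: n => [|n IHn] /=; first exact: measurable_id.
apply: measurable_funM => //; apply: measurable_funB => //.
by apply: measurable_fun_ifT => //; exact: measurable_fun_ler.
Qed.

End ternary.

Section coding.
Context {R : realType} (d : nat).
Notation Rd := (d.-tuple R).

(* x is encoded by the bits x_i < q, q rational, read as ternary digits: only a
   measurable left inverse is needed to transport conditional distributions. *)
Definition rational_cut (n : nat) (x : Rd) : bool :=
  if unpickle n is Some (i, q) then tnth x i < ratr q :> R else false.

Definition tuple_code (x : Rd) : R := ternary (rational_cut^~ x).

Let upper_cut (i : 'I_d) (k : nat) (y : R) : \bar R :=
  if unpickle k is Some q then
    if ternary_digit (pickle (i, q)) y then (ratr q)%:E else +oo%E
  else +oo%E.

Definition tuple_decode (y : R) : Rd :=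
  [tuple fine (einfs (fun k => upper_cut i k y) 0) | i < d].

Lemma tuple_codeK : cancel tuple_code tuple_decode.
Proof.
move=> x; apply: eq_from_tnth => i; rewrite tnth_mktuple.
have digitE q : ternary_digit (pickle (i, q)) (tuple_code x) = (tnth x i < ratr q).
  by rewrite /tuple_code ternaryK /rational_cut pickleK.
suff -> : einfs (fun k => upper_cut i k (tuple_code x)) 0 = (tnth x i)%:E by [].
apply/eqP; rewrite eq_le; apply/andP; split.
  apply/lee_addgt0Pr => e e0; have : tnth x i < tnth x i + e by rewrite ltrDl.
  move=> /rat_in_itvoo[q]; rewrite in_itv/= => /andP[xq qxe].
  apply: (@le_trans _ _ (ratr q)%:E); last by rewrite -EFinD lee_fin ltW.
  apply: ereal_inf_lbound; exists (pickle q) => //.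
  by rewrite /upper_cut pickleK digitE xq.
apply: le_ereal_inf_tmp => _ [k _ <-]; rewrite /upper_cut.
case: (unpickle k) => [q|]; last exact: leey.
by rewrite digitE; case: ifPn => [xq|_]; [rewrite lee_fin ltW|exact: leey].
Qed.

Lemma measurable_tuple_code : measurable_fun setT tuple_code.
Proof.
apply: (@measurable_fun_cvg _ _ _ _
  (fun n x => ternary_sum (rational_cut^~ x) n)); last first.
  by move=> x _; exact: cvg_ternary_sum.
move=> n; apply: measurable_sum => k; apply: measurable_funM => //.
rewrite (_ : (fun x => _) = (fun x => if rational_cut k x then 1 else 0)); last first.
  by apply/funext => x; case: (rational_cut k x).
apply: measurable_fun_ifT => //.
rewrite /rational_cut; case: (unpickle k) => [[i q]|] //.
by apply: measurable_fun_ltr => //; exact: measurable_tnth.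
Qed.

Lemma measurable_tuple_decode : measurable_fun setT tuple_decode.
Proof.
apply/measurable_fun_tnthP => i.
rewrite (_ : _ \o _ = fun y => fine (einfs (fun k => upper_cut i k y) 0)); last first.
  by apply/funext => y; rewrite /= tnth_mktuple.
apply: measurableT_comp => //.
apply: (@measurable_fun_einfs _ _ _ _ (upper_cut i)) => k; rewrite /upper_cut.
case: (unpickle k) => [q|] //; apply: measurable_fun_ifT => //.
exact: measurable_ternary_digit.
Qed.

Lemma tuple_code_bounds x : 0 <= tuple_code x < 2.
Proof.
by rewrite /tuple_code; have := ternary_bounds (R := R) (rational_cut^~ x); lra.
Qed.

End coding.

Section quantile.
Context {R : realType}.

Let uniform01 : probability (measurableTypeR R) R := uniform_prob (@ltr01 R).

Lemma uniform_prob_initial_segment (B : set R) s : 0 <= s <= 1 -> measurable B ->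
  (forall u, B u -> u <= s) -> (forall u, 0 <= u < s -> B u) ->
  uniform_prob (@ltr01 R) B = s%:E.
Proof.
move=> /andP[s0 s1] mB B_le s_B; rewrite /uniform_prob integral_uniform_pdf.
rewrite (eq_integral (cst 1%E)); last first.
  move=> u; rewrite inE => -[_]; rewrite /= in_itv/= /uniform_pdf => ->.
  by rewrite subr0 invr1.
have mB01 : measurable (B `&` `[0, 1]) by exact: measurableI.
rewrite integral_cst ?mul1e//; apply/eqP; rewrite eq_le; apply/andP; split.
  apply: (@le_trans _ _ (lebesgue_measure (`[0, s] : set R))).
    apply: le_measure; rewrite ?inE// => u [/B_le us].
    by rewrite /= !in_itv/= => /andP[-> _].
  rewrite lebesgue_measure_itv/= lte_fin; case: ifPn => _; last by rewrite lee_fin.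
  by rewrite oppr0 adde0.
apply: (@le_trans _ _ (lebesgue_measure (`[0, s[ : set R))).
  rewrite lebesgue_measure_itv/= lte_fin; case: ifPn => [_|].
    by rewrite oppr0 adde0.
  by rewrite -leNgt lee_fin.
apply: le_measure; rewrite ?inE// => u; rewrite /= !in_itv/= => /andP[u0 us].
by split; [apply: s_B; rewrite u0|rewrite u0 (le_trans (ltW us))].
Qed.

Variable p : rat -> R.

(* The levels p r = P(Z < r | G) are only almost surely nondecreasing in r; the
   infimum below needs no monotonicity. *)
Let quantile_level (k : nat) (u : R) : \bar R :=
  if (unpickle k : option rat) is Some r then
    if (0 < r) && (u <= p r) then (ratr r)%:E else 2%:E
  else 2%:E.

Definition quantile (u : R) : R := fine (einfs (quantile_level^~ u) 0).

Let quantileE u : (quantile u)%:E = einfs (quantile_level^~ u) 0.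
Proof.
rewrite /quantile fineK// fin_numElt; apply/andP; split.
  apply: (@lt_le_trans _ _ 0%:E); first exact: ltNyr.
  apply: le_ereal_inf_tmp => _ [k _ <-]; rewrite /quantile_level.
  case: (unpickle k) => [r|]; last by rewrite lee_fin.
  by case: ifPn => [/andP[r0 _]|_]; rewrite lee_fin ?ler0q ?(ltW r0).
apply: (@le_lt_trans _ _ 2%:E); last exact: ltry.
apply: ereal_inf_lbound; exists (pickle (-1 : rat)) => //.
by rewrite /quantile_level pickleK.
Qed.

Lemma quantile_lt u x : quantile u < x <->
  2 < x \/ exists r, [/\ 0 < r, ratr r < x & u <= p r].
Proof.
rewrite -lte_fin quantileE; split.
  move/ereal_inf_lt => [_ [k _ <-]]; rewrite /quantile_level.
  case: (unpickle k) => [r|]; last by rewrite lte_fin; left.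
  by case: ifPn => [/andP[r0 ur]|_]; rewrite lte_fin => ?; [right; exists r|left].
have level_lt (r : rat) : (quantile_level (pickle r) u < x%:E)%E ->
    (einfs (quantile_level^~ u) 0%N < x%:E)%E.
  by apply: le_lt_trans; apply: ereal_inf_lbound; exists (pickle r).
move=> [x2|[r [r0 rx ur]]].
  by apply: (level_lt (-1)); rewrite /quantile_level pickleK/= lte_fin.
by apply: (level_lt r); rewrite /quantile_level pickleK r0 ur/= lte_fin.
Qed.

Lemma measurable_quantile : measurable_fun setT quantile.
Proof.
apply: measurableT_comp => //; apply: measurable_fun_einfs => k.
rewrite /quantile_level; case: (unpickle k) => [r|] //; case: (0 < r) => //=.
by apply: measurable_fun_ifT => //; exact: measurable_fun_ler.
Qed.

Definition quantile_law : probability R R := distribution uniform01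
  (@mfun_Sub _ _ (measurableTypeR R) R quantile (mem_set measurable_quantile)).

Definition level_below (x : R) (k : nat) : R :=
  if (unpickle k : option rat) is Some r then
    if (0 < r) && (ratr r < x) then p r else 0
  else 0.

Definition cdf_left (x : R) : \bar R := esups (fun k => (level_below x k)%:E) 0.

Lemma cdf_left_ge x r : 0 < r -> ratr r < x -> ((p r)%:E <= cdf_left x)%E.
Proof.
move=> r0 rx; apply: ereal_sup_ubound; exists (pickle r) => //.
by rewrite /level_below pickleK r0 rx.
Qed.

Hypothesis p01 : forall r, 0 <= p r <= 1.

Lemma level_below_bounds x k : 0 <= level_below x k <= 1.
Proof.
by rewrite /level_below; case: (unpickle k) => [r|]; last lra; case: ifP => // _; lra.
Qed.

Lemma cdf_left_bounds x : (0 <= cdf_left x <= 1)%E.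
Proof.
apply/andP; split.
  apply: (@le_trans _ _ (level_below x 0)%:E).
    by rewrite lee_fin; case/andP: (level_below_bounds x 0).
  by apply: ereal_sup_ubound; exists 0%N.
apply: ge_ereal_sup => _ [k _ <-]; rewrite lee_fin.
by case/andP: (level_below_bounds x k).
Qed.

Lemma quantile_law_lt2 x : 2 < x -> quantile_law `]-oo, x[%classic = 1%E.
Proof.
move=> x2; rewrite /quantile_law/= /distribution /pushforward/=.
rewrite (_ : _ @^-1` _ = setT) ?probability_setT//.
by apply/seteqP; split => // u _ /=; rewrite in_itv/=; apply/quantile_lt; left.
Qed.

Lemma quantile_law_le2 x : x <= 2 -> quantile_law `]-oo, x[%classic = cdf_left x.
Proof.
move=> x2; have /andP[cdf_ge0 cdf_le1] := cdf_left_bounds x.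
have cdf_fin : cdf_left x \is a fin_num.
  by rewrite ge0_fin_numE// (le_lt_trans cdf_le1)// ltry.
rewrite -(fineK cdf_fin).
have preE u : (quantile @^-1` `]-oo, x[) u <->
    exists r, [/\ 0 < r, ratr r < x & u <= p r].
  rewrite /= in_itv/=; split => [/quantile_lt[]//|?]; first by rewrite ltNge x2.
  by apply/quantile_lt; right.
apply: uniform_prob_initial_segment.
- by rewrite -!lee_fin fineK// cdf_ge0.
- by rewrite -[X in measurable X]setTI; exact: measurable_quantile.
- move=> u /preE[r [r0 rx ur]]; rewrite (le_trans ur)// -lee_fin fineK//.
  exact: cdf_left_ge.
- move=> u /andP[u0]; rewrite -lte_fin fineK// => /ereal_sup_gt[_ [k _ <-]].
  rewrite lte_fin /level_below => level_gt; apply/preE; move: level_gt.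
  case: (unpickle k) => [r|]; last by rewrite ltNge u0.
  by case: ifPn => [/andP[r0 rx] /ltW|_]; [exists r|rewrite ltNge u0].
Qed.

End quantile.

Section rcd_exists.
Context {R : realType} {dO : measure_display} {Omega : measurableType dO}.
Variable P : probability Omega R.
Variable G : set (set Omega).
Hypothesis sG : sub_sigma_algebra G.

Section conditional_cdf.
Variables (Z : Omega -> R) (c : R -> Omega -> R).
Hypothesis mZ : measurable_fun setT Z.
Hypothesis Z_bounds : forall x, 0 <= Z x < 2.
Hypothesis c_cond_exp : forall r, is_cond_exp P G (\1_[set x | Z x < r]) (c r).
Hypothesis c01 : forall r x, 0 <= c r x <= 1.

Let p x (r : rat) := c (ratr r) x.

Let below r : set Omega := [set x | Z x < r].

Let p01 x r : 0 <= p x r <= 1.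
Proof. exact: c01. Qed.

Let measurable_below r : measurable (below r).
Proof.
have mlt : measurable_fun setT (fun x => Z x < r) by exact: measurable_fun_ltr.
by rewrite -[below r]setTI; exact: (mlt measurableT [set true]).
Qed.

Let integral_c r A : G A -> (\int[P]_(x in A) (c r x)%:E = P (A `&` below r))%E.
Proof.
move=> GA; have mA := sG.2 _ GA.
by rewrite (c_cond_exp r).2// setIC integral_indic//; exact: measurable_below.
Qed.

Let c_integrable r : P.-integrable setT (EFin \o c r).
Proof.
apply: measurable_bounded_integrable => //.
- by rewrite -ge0_fin_numE// fin_num_measure.
- exact: (measurable_wrtW sG (c_cond_exp r).1).
- exists 1; split=> // M M1 x _ /=; have /andP[c0 c1] := c01 r x.
  by rewrite ger0_norm// (le_trans c1)// ltW.
Qed.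

Let c_mono r s : r <= s -> {ae P, forall x, c r x <= c s x}.
Proof.
move=> rs; apply: (ae_le_of_integral sG).
- exact: (c_cond_exp r).1.
- exact: (c_cond_exp s).1.
- exact: c_integrable.
- exact: c_integrable.
- move=> A GA; rewrite !integral_c//; have mA := sG.2 _ GA.
  apply: le_measure; rewrite ?inE; [exact: measurableI|exact: measurableI|].
  by apply: setIS => x /= /lt_le_trans; apply.
Qed.

Let measurable_cdf_left x : measurable_wrt G (fun o => cdf_left (p o) x).
Proof.
apply: measurable_fun_esups => k; apply/measurable_EFinP; rewrite /level_below.
by case: (unpickle k) => [r|] //; case: (_ && _) => //; exact: (c_cond_exp _).1.
Qed.

Let integral_cdf_left_le x A : G A ->
  (\int[P]_(o in A) cdf_left (p o) x <= P (A `&` below x))%E.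
Proof.
move=> GA; rewrite -integral_c//; apply: ae_ge0_le_integral => //.
- exact: sG.2.
- by move=> o _; case/andP: (cdf_left_bounds (p01 o) x).
- by apply: measurable_funTS; exact: (measurable_wrtW sG).
- by move=> o _; rewrite lee_fin; case/andP: (c01 x o).
- apply/measurable_EFinP/measurable_funTS.
  exact: (measurable_wrtW sG (c_cond_exp x).1).
have : {ae P, forall o, forall k, level_below (p o) x k <= c x o}.
  apply: ae_foralln => k; rewrite /level_below.
  have c_ge0 : {ae P, forall o, 0 <= c x o}.
    by apply: nearW => o; case/andP: (c01 x o).
  case: (unpickle k) => [r|]; last exact: c_ge0.
  by case: (boolP ((0 < r) && (ratr r < x))) => [/andP[_ /ltW rx]|_];
    [exact: c_mono|exact: c_ge0].
apply: filterS => o level_le _; apply: ge_ereal_sup => _ [k _ <-].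
by rewrite lee_fin.
Qed.

Let integral_cdf_left_ge x A : G A ->
  (P (A `&` below x) <= \int[P]_(o in A) cdf_left (p o) x)%E.
Proof.
move=> GA; have mA := sG.2 _ GA; have [x0|x0] := leP x 0.
  rewrite (_ : _ `&` _ = set0) ?measure0; last first.
    apply/seteqP; split => // o [_ /= Zx]; have /andP[Z0 _] := Z_bounds o.
    by move: (lt_le_trans Zx x0); rewrite ltNge Z0.
  by apply: integral_ge0 => o _; case/andP: (cdf_left_bounds (p01 o) x).
pose B n := A `&` below (x - n.+1%:R^-1).
have mB n : measurable (B n) by exact: measurableI.
have -> : A `&` below x = \bigcup_n B n.
  apply/seteqP; split=> [y [Ay Zx]|y [n _ [Ay Zn]]]; last first.
    by split=> //; apply: (lt_le_trans Zn); rewrite gerBl// invr_ge0.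
  have gap : 0 < x - Z y by rewrite subr_gt0.
  have [n _ nP] := near_infty_natSinv_lt (PosNum gap).
  exists n => //; split=> //; rewrite /below/= ltrBrDr -ltrBrDl.
  exact: nP (leqnn n).
have mono_B : {homo B : n m / (n <= m)%N >-> (n <= m)%O}.
  move=> n m nm; apply/subsetPset; apply: setIS => o /= /lt_le_trans; apply.
  by rewrite lerB// lef_pV2 ?posrE ?ltr0n// ler_nat.
have cvg_B := nondecreasing_cvg_mu (mu := P) mB (bigcupT_measurable _ mB) mono_B.
rewrite -(cvg_lim _ cvg_B)//; apply: lime_le; first exact: cvgP cvg_B.
apply: nearW => n /=.
have [r] : exists r : rat, ratr r \in `]Num.max 0 (x - n.+1%:R^-1), x[.
  by apply/rat_in_itvoo; rewrite gt_max x0/= ltrBlDr ltrDl invr_gt0.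
rewrite in_itv/= gt_max => /andP[/andP[r0 nr] rx].
apply: (@le_trans _ _ (\int[P]_(o in A) (c (ratr r) o)%:E)%E).
  rewrite integral_c//; apply: le_measure; rewrite ?inE//; first exact: measurableI.
  by apply: setIS => o /= /lt_trans; apply.
apply: ge0_le_integral => //.
- by move=> o _; rewrite lee_fin; case/andP: (c01 (ratr r) o).
- by apply/measurable_EFinP/measurable_funTS;
    exact: (measurable_wrtW sG (c_cond_exp (ratr r)).1).
- by apply: measurable_funTS; exact: (measurable_wrtW sG).
- by move=> o _; apply: cdf_left_ge; rewrite // -(ltr0q R).
Qed.

Lemma conditional_cdf_disintegrates B : measurable B ->
  disintegrates P G Z (fun o => quantile_law (p o)) B.
Proof.
have gen := @RGenInftyO.measurableE R.
move: B; apply: (disintegrates_generated sG mZ gen).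
  move=> _ _ [x ->] [y ->]; exists (Num.min x y).
  by apply/seteqP; split => z /=; rewrite !in_itv/= lt_min; [case=> -> ->|case/andP].
have rayE x : Z @^-1` `]-oo, x[ = below x.
  by apply/seteqP; split => o /=; rewrite in_itv.
move=> _ [x ->]; rewrite /disintegrates rayE; have [x2|x2] := leP x 2.
  under eq_fun do rewrite quantile_law_le2//.
  split=> [|A GA]; first exact: measurable_cdf_left.
  apply/eqP; rewrite eq_le; apply/andP; split.
    exact: integral_cdf_left_ge.
  exact: integral_cdf_left_le.
under eq_fun do rewrite quantile_law_lt2//.
split=> // A GA; rewrite integral_cst ?mul1e; last exact: sG.2.
congr (P _); apply/seteqP; split=> [y []//|y Ay]; split=> //.
by rewrite /below/=; case/andP: (Z_bounds y) => _ /lt_trans; apply.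
Qed.

End conditional_cdf.

Lemma real_disintegration_exists (Z : Omega -> R) : measurable_fun setT Z ->
  (forall x, 0 <= Z x < 2) -> exists mu : Omega -> probability R R,
  forall B, measurable B -> disintegrates P G Z mu B.
Proof.
move=> mZ Z_bounds.
have cond_exp r : exists e : Omega -> R,
    is_cond_exp P G (\1_[set x | Z x < r]) e /\ forall x, 0 <= e x <= 1.
  have mbelow : measurable [set x | Z x < r].
    have mlt : measurable_fun setT (fun x => Z x < r) by exact: measurable_fun_ltr.
    by rewrite -[[set _ | _]]setTI; exact: (mlt measurableT [set true]).
  have [|e ee e01] := bounded_cond_exp_exists P sG (measurable_indic mbelow)
    (a := 0) (b := 1); last by exists e.
  by move=> x; rewrite indicE ler0n lern1 leq_b1.
have [c cP] := choice cond_exp.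
exists (fun x => quantile_law (fun r => c (ratr r) x)).
by apply: conditional_cdf_disintegrates => // r; have [] := cP r.
Qed.

Lemma rcd_exists (d : nat) (Y : Omega -> d.-tuple R) : measurable_fun setT Y ->
  exists kappa, rcd P G Y kappa.
Proof.
move=> mY; pose Z x := tuple_code (Y x).
have mZ : measurable_fun setT Z.
  by apply: measurableT_comp => //; exact: measurable_tuple_code.
have [mu dmu] := real_disintegration_exists mZ (fun x => tuple_code_bounds (Y x)).
pose decode : {mfun R >-> d.-tuple R} :=
  mfun_Sub (mem_set (@measurable_tuple_decode R d)).
exists (fun x => distribution (mu x) decode).
have YE : Y = decode \o Z by apply/funext => x; rewrite /= tuple_codeK.
split=> B mB; have [mmuB muB] := disintegrates_distribution dmu decode mB.
  exact/(sub_measurableP sG).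
by move=> A GA; rewrite YE; exact: muB.
Qed.

End rcd_exists.

(** * Conditional supports *)

Section boxes.
Context {R : realType} (d : nat).
Notation Rd := (d.-tuple R).
Implicit Types (v w x : Rd) (e : R).

Lemma measurable_boxball x e : measurable (boxball x e).
Proof.
rewrite (_ : boxball x e =
    \bigcap_(i in [set: 'I_d]) [set y : Rd | `|tnth y i - tnth x i| < e]).
  apply: fin_bigcap_measurable => // i _.
  have mlt : measurable_fun setT (fun y : Rd => `|tnth y i - tnth x i| < e).
    apply: measurable_fun_ltr => //; apply: measurableT_comp => //.
    by apply: measurable_funB => //; exact: measurable_tnth.
  by rewrite -[X in measurable X]setTI; exact: (mlt measurableT [set true]).
by apply/seteqP; split => y /= xy i; [move=> _|]; exact: xy.
Qed.

Definition rational_box (q : d.-tuple rat * rat) : set Rd :=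
  boxball [tuple ratr (tnth q.1 i) | i < d] (ratr q.2).

Lemma rational_box_sub_boxball x e : 0 < e ->
  exists2 q, rational_box q x & rational_box q `<=` boxball x e.
Proof.
move=> e0.
have /choice[a aP] (i : 'I_d) : exists q : rat, `|ratr q - tnth x i| < e / 4.
  have : tnth x i < tnth x i + e / 4 by rewrite ltrDl; lra.
  move=> /rat_in_itvoo[q]; rewrite in_itv/= => /andP[xq qx]; exists q.
  by rewrite ger0_norm; lra.
have : e / 4 < e / 2 by lra.
move=> /rat_in_itvoo[r]; rewrite in_itv/= => /andP[er re].
exists ([tuple a i | i < d], r) => [i|y xy i].
  by rewrite !tnth_mktuple distrC (lt_trans (aP i)).
have := xy i; rewrite !tnth_mktuple => ya.
have := ler_distD (ratr (a i)) (tnth y i) (tnth x i).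
by have := aP i; move: ya; rewrite /=; lra.
Qed.

Lemma support_setC_negligible (mu : probability Rd R) :
  mu.-negligible (~` Defs.support mu).
Proof.
pose N k : set Rd := if (unpickle k : option (d.-tuple rat * rat)) is Some q then
  (if mu (rational_box q) == 0%E then rational_box q else set0) else set0.
have null_N k : mu.-negligible (N k).
  rewrite /N; case: (unpickle k) => [q|]; last exact: negligible_set0.
  case: ifPn => [/eqP box0|_]; last exact: negligible_set0.
  by apply/negligibleP => //; exact: measurable_boxball.
apply: negligibleS (negligible_bigcup null_N) => w.
move=> /existsNP[e /not_implyP[e0 /negP ball0]].
have [q qw qe] := rational_box_sub_boxball w e0; exists (pickle q) => //.
rewrite /N pickleK; case: eqP => // -[]; apply/eqP; rewrite -measure_le0.
apply: le_trans (le_measure mu _ _ qe) _; rewrite ?inE; try exact: measurable_boxball.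
by rewrite leNgt.
Qed.

Lemma dotp_neq0_boxball v w : dotp v w != 0 ->
  exists2 e, 0 < e & boxball w e `<=` [set y | dotp v y != 0].
Proof.
move=> vw; have vw_gt0 : 0 < `|dotp v w| by rewrite normr_gt0.
pose c := 1 + \sum_i `|tnth v i|; have c_gt0 : 0 < c by rewrite ltr_pwDl// sumr_ge0.
exists (`|dotp v w| / c); first exact: divr_gt0.
move=> y wy /=; apply: contraTneq vw_gt0 => vy0; rewrite -leNgt.
have : `|dotp v w| <= `|dotp v w| / c * \sum_i `|tnth v i|.
  rewrite -[X in X <= _]normrN -[- _]add0r -[X in `|X - _|]vy0 /dotp -sumrB mulr_sumr.
  apply: (le_trans (ler_norm_sum _ _ _)); apply: ler_sum => i _.
  by rewrite -mulrBr normrM mulrC ler_wpM2r// ltW.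
rewrite mulrAC ler_pdivlMr// -subr_ge0 -mulrBr /c opprD addrCA subrr addr0 mulrN1.
by rewrite oppr_ge0.
Qed.

Lemma measurable_dotp : measurable_fun setT (fun z : Rd * Rd => dotp z.1 z.2).
Proof.
apply: measurable_sum => i.
by apply: measurable_funM; apply: (measurableT_comp (measurable_tnth i)).
Qed.

Lemma measurable_dotp_neq0 : measurable [set z : Rd * Rd | dotp z.1 z.2 != 0].
Proof.
rewrite (_ : [set _ | _] = (fun z : Rd * Rd => dotp z.1 z.2) @^-1` (~` [set 0])).
  rewrite -[X in measurable X]setTI; apply: measurable_dotp => //.
  exact: measurableC.
by apply/seteqP; split => z /= /eqP.
Qed.

Lemma support_orthogonalP (mu : probability Rd R) v :
  mu [set w | dotp v w != 0] = 0%E <-> Defs.support mu `<=` [set w | dotp v w = 0].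
Proof.
have mneq0 : measurable [set w | dotp v w != 0].
  by have := measurable_xsection v measurable_dotp_neq0; rewrite xsectionE.
split=> [null w supp_w /=|supp_v].
  apply: contrapT => /eqP/dotp_neq0_boxball[e e0 wv].
  have := supp_w e e0; rewrite ltNge => /negP; apply; rewrite -null.
  by apply: le_measure; rewrite ?inE//; exact: measurable_boxball.
apply/(negligibleP mu mneq0); apply: negligibleS (support_setC_negligible mu).
by move=> w /= /eqP vw /supp_v.
Qed.

Lemma affine_set_orthogonal v : affine_set [set w | dotp v w = 0].
Proof.
move=> x y /= vx vy l.
transitivity (l * dotp v x + (1 - l) * dotp v y); last by rewrite vx vy !mulr0 addr0.
rewrite /dotp !mulr_sumr -big_split/=; apply: eq_bigr => i _.
by rewrite tnth_mktuple; ring.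
Qed.

End boxes.

Section orthogonal_transfer.
Context {R : realType} {dO : measure_display} {Omega : measurableType dO}.
Variable P : probability Omega R.
Variable G : set (set Omega).
Hypothesis sG : sub_sigma_algebra G.
Variable d : nat.
Notation Rd := (d.-tuple R).
Variable h : Omega -> Rd.
Hypothesis mh : measurable_wrt G h.

Lemma ae_orthogonal_supportP (X : Omega -> Rd) kappa : measurable_fun setT X ->
  rcd P G X kappa ->
  {ae P, forall x, dotp (h x) (X x) = 0} <->
  {ae P, forall x, Defs.support (kappa x) `<=` [set v | dotp (h x) v = 0]}.
Proof.
move=> mX [mkappa kappaE].
have dkappa B : measurable B -> disintegrates P G X kappa B.
  by move=> mB; split; [apply/(sub_measurableP sG)/mkappa|exact: kappaE].
pose neq0 : set (Rd * Rd) := [set z | dotp z.1 z.2 != 0].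
have mneq0 : measurable neq0 by exact: measurable_dotp_neq0.
have [m_neq0 hX_neq0] := disintegrates_pair sG dkappa mX mh mneq0.
have hX_null : {ae P, forall x, dotp (h x) (X x) = 0} <->
    P [set x | dotp (h x) (X x) != 0] = 0%E.
  rewrite -(negligibleP P); last first.
    have mhX : measurable_fun setT (fun x => (h x, X x)).
      by apply: measurable_fun_pair => //; exact: (measurable_wrtW sG).
    by rewrite -[X in measurable X]setTI; exact: (mhX measurableT neq0 mneq0).
  by split; apply: negligibleS => x /=; [move=> /eqP|move=> hX; apply/eqP].
rewrite hX_null hX_neq0.
rewrite (eq_integral (fun x => `|kappa x (xsection neq0 (h x))|)%E); last first.
  by move=> x _; rewrite gee0_abs.
apply: (iff_trans (ae_eq_integral_abs P measurableT (measurable_wrtW sG m_neq0))).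
by split; apply: filterS => x; rewrite xsectionE => hx;
  [apply/support_orthogonalP/hx|move=> _; apply/support_orthogonalP].
Qed.

Lemma orthogonal_transfer (X Y : Omega -> Rd) :
  measurable_fun setT X -> measurable_fun setT Y ->
  (forall kX kY, rcd P G Y kY -> rcd P G X kX ->
    {ae P, forall x, affine_hull (Defs.support (kY x)) `<=`
                     affine_hull (Defs.support (kX x))}) ->
  {ae P, forall x, dotp (h x) (X x) = 0} -> {ae P, forall x, dotp (h x) (Y x) = 0}.
Proof.
move=> mX mY hull_incl.
have [kX rX] := rcd_exists P sG mX; have [kY rY] := rcd_exists P sG mY.
move=> /(ae_orthogonal_supportP mX rX) supp_X.
apply/(ae_orthogonal_supportP mY rY).
apply: filterS2 (hull_incl _ _ rY rX) supp_X => x hull supp v supp_v.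
have hull_v : affine_hull (Defs.support (kY x)) v by move=> B _; exact.
by apply: (hull v hull_v) => //; exact: affine_set_orthogonal.
Qed.

End orthogonal_transfer.

(** * Multi-period estimates *)

Section weight_bounded.
Context {R : realType} {dO : measure_display} {Omega : measurableType dO}.
Variable P : probability Omega R.
Context {K : Type}.
Variable A : set K.
Implicit Types (G : set (set Omega)) (f g : K -> Omega -> R).

Definition weight_bounded G f := (forall k, A k -> measurable_wrt G (f k)) /\
  exists a C, is_weight G a /\
    forall k, A k -> ('E_P[fun x => a x * `|f k x|] <= C%:E)%E.

Lemma weight_bounded_common (J : finType) G (f : J -> K -> Omega -> R) :
  sub_sigma_algebra G -> (forall j, weight_bounded G (f j)) ->
  exists a C, is_weight G a /\
    forall j k, A k -> ('E_P[fun x => a x * `|f j k x|] <= C%:E)%E.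
Proof.
move=> sG bf; have /choice[a /choice[C aC]] j := (bf j).2.
have wa j : is_weight G (a j) by case: (aC j).
exists (fun x => \prod_j a j x), (\sum_j `|C j|).
split=> [|j k Ak]; first exact: is_weight_prod.
apply: (@le_trans _ _ (C j)%:E); last first.
  by rewrite lee_fin (bigD1 j)//= (le_trans (ler_norm _))// lerDl sumr_ge0.
have maf w : is_weight G w -> measurable_fun setT (fun x => w x * `|f j k x|).
  move=> [mw _]; apply: (measurable_wrtW sG); apply: measurable_funM => //.
  by apply: measurableT_comp => //; exact: (bf j).1.
apply: le_trans ((aC j).2 k Ak); apply: ge0_expectation_le.
- exact/maf/is_weight_prod.
- exact: maf.
- by move=> x; rewrite mulr_ge0//; exact: weight_ge0 (is_weight_prod wa).
- by move=> x; rewrite ler_wpM2r//; exact: (weight_prod_le wa).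
Qed.

Lemma weight_bounded_sum (J : finType) G (f : J -> K -> Omega -> R) :
  sub_sigma_algebra G -> (forall j, weight_bounded G (f j)) ->
  weight_bounded G (fun k x => \sum_j f j k x).
Proof.
move=> sG bf; have [a [C [wa aC]]] := weight_bounded_common sG bf.
split=> [k Ak|]; first by apply: measurable_sum => j; exact: (bf j).1.
exists a, (\sum_(j : J) C); split=> // k Ak; have [ma _] := wa.
have a_ge0 x : 0 <= a x := weight_ge0 x wa.
have maf j : measurable_fun setT (fun x => a x * `|f j k x|).
  apply: (measurable_wrtW sG); apply: measurable_funM => //.
  by apply: measurableT_comp => //; exact: (bf j).1.
rewrite -sumEFin; apply: le_trans (lee_sum _ (fun j _ => aC j k Ak)).
rewrite -ge0_expectation_sum//; last by move=> j x; rewrite mulr_ge0.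
apply: ge0_expectation_le.
- apply: (measurable_wrtW sG); apply: measurable_funM => //.
  by apply: measurableT_comp => //; apply: measurable_sum => j; exact: (bf j).1.
- exact: measurable_sum.
- by move=> x; rewrite mulr_ge0.
- by move=> x; rewrite -mulr_sumr ler_wpM2l// ler_norm_sum.
Qed.

Lemma weight_boundedD G f g : sub_sigma_algebra G ->
  weight_bounded G f -> weight_bounded G g ->
  weight_bounded G (fun k x => f k x + g k x).
Proof.
move=> sG bf bg.
have := @weight_bounded_sum bool G (fun b => if b then f else g) sG.
under eq_fun => k do under eq_fun do rewrite big_bool.
by apply; case.
Qed.

Lemma weight_boundedM G f (m : Omega -> R) : sub_sigma_algebra G ->
  weight_bounded G f -> measurable_wrt G m ->
  weight_bounded G (fun k x => f k x * m x).
Proof.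
move=> sG [mf [a [C [wa aC]]]] mm; have [ma _] := wa.
split=> [k Ak|]; first by apply: measurable_funM => //; exact: mf.
have scale_ge1 x : 1 <= 1 + `|m x| by rewrite lerDl.
have mscale : measurable_wrt G (fun x => (1 + `|m x|)^-1).
  by apply: measurable_funV; apply: measurable_funD => //; exact: measurableT_comp.
have a_gt0 x : 0 < a x := weight_gt0 x wa.
exists (fun x => a x / (1 + `|m x|)), C; split.
  split=> [|x]; first exact: measurable_funM.
  rewrite divr_gt0//= ler_pdivrMr// mul1r (le_trans _ (scale_ge1 x))//.
  exact: weight_le1 wa.
move=> k Ak; apply: le_trans (aC k Ak); have mfk := mf k Ak.
apply: ge0_expectation_le.
- apply: (measurable_wrtW sG); apply: measurable_funM; first exact: measurable_funM.
  by apply: measurableT_comp => //; exact: measurable_funM.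
- apply: (measurable_wrtW sG); apply: measurable_funM => //.
  exact: measurableT_comp.
- by move=> x; rewrite mulr_ge0// ltW// divr_gt0.
- move=> x; rewrite -mulrA ler_wpM2l ?(ltW (a_gt0 x))// normrM mulrCA ler_piMr//.
  by rewrite mulrC ler_pdivrMr// mul1r lerDr.
Qed.

Lemma weight_bounded_mono G H f : sub_sigma_algebra G -> sub_sigma_algebra H ->
  G `<=` H -> weight_bounded G f -> weight_bounded H f.
Proof.
move=> sG sH GH [mf [a [C [[ma a01] aC]]]]; split=> [k Ak|].
  by apply: (measurable_wrt_mono sG sH GH); exact: mf.
by exists a, C; split=> //; split=> //; exact: (measurable_wrt_mono sG sH GH).
Qed.

End weight_bounded.

Section coordinates.
Context {R : realType} {dO : measure_display} {Omega : measurableType dO}.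
Variables (d : nat).
Notation proc := (@process R _ Omega d).
Implicit Types (S phi : proc).

Definition coord S t i x := tnth (S t x) i.

Lemma sub_measurable_coordP G (f : Omega -> d.-tuple R) : sub_sigma_algebra G ->
  sub_measurable G f <-> forall i, measurable_wrt G (fun x => tnth (f x) i).
Proof. by move=> sG; rewrite (sub_measurableP sG); exact: measurable_fun_tnthP. Qed.

Lemma wealth0 S w phi x : wealth S w phi 0 x = w.
Proof. by rewrite /wealth big_geq// addr0. Qed.

Lemma wealthS S w phi t x : wealth S w phi t.+1 x =
  wealth S w phi t x + \sum_i coord phi t.+1 i x * coord (DeltaS S) t.+1 i x.
Proof. by rewrite /wealth big_nat_recr//= addrA. Qed.

End coordinates.

Section market.
Context {R : realType} {dO : measure_display} {Omega : measurableType dO}.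
Variable P : probability Omega R.
Variables (d T : nat) (F : nat -> set (set Omega)).
Hypothesis filtF : filtration P F T.
Notation proc := (@process R _ Omega d).
Implicit Types (S phi psi : proc).

Lemma filtration_sub_sigma_algebra t : (t <= T)%N -> sub_sigma_algebra (F t).
Proof. by case: filtF => sF FM _ _ tT; split; [exact: sF|exact: FM]. Qed.

Let sF := filtration_sub_sigma_algebra.

Let measurable_next t dV (V : measurableType dV) (f : Omega -> V) : (t < T)%N ->
  measurable_wrt (F t) f -> measurable_wrt (F t.+1) f.
Proof.
move=> tT; apply: (measurable_wrt_mono (sF (ltnW tT)) (sF tT)).
by case: filtF => _ _ + _; exact.
Qed.

Lemma strategiesP phi : strategies F T phi <->
  forall t i, (t < T)%N -> measurable_wrt (F t) (coord phi t.+1 i).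
Proof.
split=> [sphi t i tT|mphi [//|t] /= tT].
  exact: ((sub_measurable_coordP _ (sF (ltnW tT))).1 (sphi t.+1 tT)).
by apply/(sub_measurable_coordP _ (sF (ltnW tT))) => i; exact: mphi.
Qed.

Lemma adapted_DeltaS S t i : adapted F T S -> (t < T)%N ->
  measurable_wrt (F t.+1) (coord (DeltaS S) t.+1 i).
Proof.
move=> aS tT; have mS s : (s <= T)%N -> measurable_wrt (F s) (coord S s i).
  by move=> sT; exact: ((sub_measurable_coordP _ (sF sT)).1 (aS s sT)).
rewrite (_ : coord _ _ _ = fun x => coord S t.+1 i x - coord S t i x); last first.
  by apply/funext => x; rewrite /coord tnth_mktuple.
apply: measurable_funB; first exact: mS.
by apply: measurable_next => //; apply: mS; exact: ltnW.
Qed.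

Lemma measurable_DeltaS S t : adapted F T S -> (t < T)%N ->
  measurable_fun setT (DeltaS S t.+1).
Proof.
move=> aS tT; apply/measurable_fun_tnthP => i.
by apply: (measurable_wrtW (sF tT)); exact: adapted_DeltaS.
Qed.

Lemma adapted_wealth S w phi t : adapted F T S -> strategies F T phi ->
  (t <= T)%N -> measurable_wrt (F t) (wealth S w phi t).
Proof.
move=> aS /strategiesP sphi; elim: t => [|t IHt] tT.
  by rewrite (_ : wealth _ _ _ _ = cst w)//; apply/funext => x; exact: wealth0.
rewrite (_ : wealth _ _ _ _ = fun x => wealth S w phi t x +
    \sum_i coord phi t.+1 i x * coord (DeltaS S) t.+1 i x); last first.
  by apply/funext => x; exact: wealthS.
apply: measurable_funD; first by apply: measurable_next => //; exact: IHt (ltnW tT).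
apply: measurable_sum => i; apply: measurable_funM; last exact: adapted_DeltaS.
by apply: measurable_next => //; exact: sphi.
Qed.

(* A one-period arbitrage in period t + 1 extends by zero positions. *)
Lemma NA_one_period S t : NA P F T S -> (t < T)%N ->
  one_period_NA P (F t) (coord (DeltaS S) t.+1).
Proof.
move=> na tT h mh h_ge0.
pose phi : proc := fun s x => [tuple if s == t.+1 then h i x else 0 | i < d].
have phiE s i : coord phi s.+1 i = fun x => if s == t then h i x else 0.
  by apply/funext => x; rewrite /coord tnth_mktuple.
have sphi : strategies F T phi.
  apply/strategiesP => s i sT; rewrite phiE.
  by case: eqP => [->|_]; [exact: mh|exact: measurable_cst].
have gain_phi s x : dotp (phi s x) (DeltaS S s x) =
    if s == t.+1 then \sum_i h i x * coord (DeltaS S) t.+1 i x else 0.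
  rewrite /dotp; case: (s =P t.+1) => [->|/eqP/negPf st].
    by apply: eq_bigr => i _; rewrite tnth_mktuple eqxx.
  by apply: big1 => i _; rewrite tnth_mktuple st mul0r.
have wealth_phi x :
    wealth S 0 phi T x = \sum_i h i x * coord (DeltaS S) t.+1 i x.
  rewrite /wealth add0r; under eq_bigr do rewrite gain_phi.
  by rewrite -big_mkcond/= big_nat1_eq/= ltnS tT.
have : {ae P, forall x, 0 <= wealth S 0 phi T x}.
  by apply: filterS h_ge0 => x; rewrite wealth_phi.
by move/(na _ sphi); apply: filterS => x; rewrite wealth_phi.
Qed.

Lemma ae_eq_wealth S w phi psi :
  (forall t, (t < T)%N -> {ae P, forall x,
    dotp (phi t.+1 x) (DeltaS S t.+1 x) = dotp (psi t.+1 x) (DeltaS S t.+1 x)}) ->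
  {ae P, forall x, wealth S w phi T x = wealth S w psi T x}.
Proof.
move=> eq_gain.
have : {ae P, forall x, forall t : 'I_T, dotp (phi t.+1 x) (DeltaS S t.+1 x) =
    dotp (psi t.+1 x) (DeltaS S t.+1 x)}.
  by apply: filter_forall => t; exact: eq_gain.
apply: filterS => x eq_x; congr (w + _).
by rewrite !big_add1/= !big_mkord; apply: eq_bigr => t _.
Qed.

End market.

Section reduced_strategies.
Context {R : realType} {dO : measure_display} {Omega : measurableType dO}.
Variable P : probability Omega R.
Variables (d T : nat) (F : nat -> set (set Omega)).
Hypothesis filtF : filtration P F T.
Notation proc := (@process R _ Omega d).
Variable S0 : proc.
Hypothesis aS0 : adapted F T S0.

Let X t : 'I_d -> Omega -> R := coord (DeltaS S0) t.+1.
Let sF := filtration_sub_sigma_algebra filtF.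

Lemma null_projections_exist : exists p : nat -> 'I_d -> 'I_d -> Omega -> R,
  forall t, (t < T)%N -> is_null_projection P (F t) (X t) (p t).
Proof.
have /choice[p pP] t : exists p : 'I_d -> 'I_d -> Omega -> R,
    (t < T)%N -> is_null_projection P (F t) (X t) p.
  have [tT|tT] := ltnP t T; last by exists (fun _ _ _ => 0).
  by have [p pP] := null_projection_exists P (X t) (sF (ltnW tT)); exists p.
by exists p.
Qed.

Variable p : nat -> 'I_d -> 'I_d -> Omega -> R.
Hypothesis pP : forall t, (t < T)%N -> is_null_projection P (F t) (X t) (p t).

Definition reduced (phi : proc) := strategies F T phi /\
  forall t, (t < T)%N ->
    {ae P, forall x, forall k, \sum_i p t k i x * coord phi t.+1 i x = 0}.

Lemma reduced_exists (phi : proc) : strategies F T phi ->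
  exists2 psi, reduced psi & forall S w, adapted F T S -> D_incl P F T S S0 ->
    {ae P, forall x, wealth S w psi T x = wealth S w phi T x}.
Proof.
move=> /(strategiesP filtF) sphi.
pose q t k x := \sum_i p t.-1 k i x * coord phi t i x.
have nq t : (t < T)%N -> null_strategy P (F t) (X t) (q t.+1).
  by move=> tT; have [_ + _] := pP tT; apply => i; exact: sphi.
pose psi : proc := fun t x => [tuple coord phi t k x - q t k x | k < d].
have psiE t k : coord psi t k = fun x => coord phi t k x - q t k x.
  by apply/funext => x; rewrite /coord tnth_mktuple.
exists psi.
  split=> [|t tT].
    apply/(strategiesP filtF) => t k tT; rewrite psiE.
    by apply: measurable_funB; [exact: sphi|case: (nq t tT) => + _; exact].
  have [_ _ /(_ _ (nq t tT)) q_fixed] := pP tT.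
  apply: filterS q_fixed => x qx k.
  under eq_bigr do rewrite psiE mulrBr.
  by rewrite sumrB -qx subrr.
move=> S w aS inclS; apply: ae_eq_wealth => t tT; have [mq q_null] := nq t tT.
pose qt x : d.-tuple R := [tuple q t.+1 k x | k < d].
have mqt : measurable_wrt (F t) qt.
  apply/(sub_measurableP (sF (ltnW tT)))/(sub_measurable_coordP _ (sF (ltnW tT))) => k.
  by rewrite (_ : (fun x => _) = q t.+1 k)//; apply/funext => x; rewrite tnth_mktuple.
have qt_null : {ae P, forall x, dotp (qt x) (DeltaS S0 t.+1 x) = 0}.
  apply: filterS q_null => x q0; rewrite -[RHS]q0; apply: eq_bigr => i _.
  by rewrite tnth_mktuple.
have qt_nullS : {ae P, forall x, dotp (qt x) (DeltaS S t.+1 x) = 0}.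
  apply: (orthogonal_transfer (sF (ltnW tT)) mqt (measurable_DeltaS filtF aS0 tT)
    (measurable_DeltaS filtF aS tT) _ qt_null) => kX kY rY rX.
  exact: (inclS t.+1 tT).
apply: filterS qt_nullS => x qS; rewrite -[RHS]subr0 -[X in _ - X]qS /dotp -sumrB.
by apply: eq_bigr => i _; rewrite !tnth_mktuple mulrBl.
Qed.

Hypothesis naS0 : NA P F T S0.
Variable w0 : R.
Let W phi t := wealth S0 w0 phi t.

Let adapted_W phi t : reduced phi -> (t <= T)%N -> measurable_wrt (F t) (W phi t).
Proof. by move=> [sphi _] tT; exact: (adapted_wealth filtF). Qed.

Let measurable_W phi t : reduced phi -> (t <= T)%N -> measurable_fun setT (W phi t).
Proof. by move=> rphi tT; apply: (measurable_wrtW (sF tT)); exact: adapted_W. Qed.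

Let reduced_coord phi t i : reduced phi -> (t < T)%N ->
  measurable_wrt (F t) (coord phi t.+1 i).
Proof. by move=> [/(strategiesP filtF) + _]; exact. Qed.

Lemma reduced_one_period_bound t (ga : Omega -> R) s : (t < T)%N ->
  (s <= T)%N -> is_weight (F s) ga ->
  exists2 al, is_weight (F t) al & forall phi (de : Omega -> R), reduced phi ->
    measurable_wrt (F t) de -> (forall x, 0 <= de x) ->
    ('E_P[fun x => al x *
       (de x * (neg_part (W phi t x) + \sum_i `|coord phi t.+1 i x|))] <=
     'E_P[fun x => ga x * (de x * neg_part (W phi t.+1 x))] +
     'E_P[fun x => de x * Num.max (W phi t x) 0])%E.
Proof.
move=> tT sT [mga ga01]; have mgaW := measurable_wrtW (sF sT) mga.
have mX i : measurable_fun setT (X t i).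
  by apply: (measurable_wrtW (sF tT)); exact: (adapted_DeltaS filtF).
have [al wal alP] := localized_one_period_bound (sF (ltnW tT)) mX (pP tT)
  (NA_one_period filtF naS0 tT) mgaW ga01.
exists al => // phi de rphi mde de0; have [_ phi_red] := rphi.
rewrite (_ : (fun x => ga x * _) = fun x => ga x * (de x * neg_part (W phi t x +
    \sum_i coord phi t.+1 i x * X t i x))); last first.
  by apply/funext => x; rewrite -wealthS.
apply: alP => //; [exact: adapted_W (ltnW tT)| |exact: phi_red].
by move=> i; exact: reduced_coord.
Qed.

(* The bound is localised on the event of negative wealth, where the term in
   the positive part vanishes. *)
Let neg_part_wealth_step t (ga : Omega -> R) : (t < T)%N -> is_weight (F t.+1) ga ->
  exists2 al, is_weight (F t) al & forall phi, reduced phi ->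
    ('E_P[fun x => al x * neg_part (W phi t x)] <=
     'E_P[fun x => ga x * neg_part (W phi t.+1 x)])%E.
Proof.
move=> tT wga; have [al wal alP] := reduced_one_period_bound tT tT wga.
exists al => // phi rphi; have tT' := ltnW tT.
have al0 x := weight_ge0 x wal; have ga0 x := weight_ge0 x wga.
pose de x : R := if W phi t x < 0 then 1 else 0.
have de0 x : 0 <= de x by rewrite /de; case: ifP.
have de_neg x : de x * neg_part (W phi t x) = neg_part (W phi t x).
  by rewrite /de; case: ltP => [_|W0]; rewrite ?mul1r// neg_part_id0// mulr0.
have de_max x : de x * Num.max (W phi t x) 0 = 0.
  by rewrite /de; case: ltP => _; rewrite ?mulr0// mul0r.
have mde : measurable_wrt (F t) de.
  apply: measurable_fun_ifT => //; apply: measurable_fun_ltr => //.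
  exact: adapted_W.
have mcoord i : measurable_fun setT (coord phi t.+1 i).
  by apply: (measurable_wrtW (sF tT')); exact: reduced_coord.
have mneg s : (s <= T)%N -> measurable_fun setT (fun x => neg_part (W phi s x)).
  by move=> sT; apply: measurable_neg_part; exact: measurable_W.
have mgaW := measurable_wrtW (sF tT) wga.1.
have malW := measurable_wrtW (sF tT') wal.1; have mdeW := measurable_wrtW (sF tT') mde.
apply: (@le_trans _ _ ('E_P[fun x => al x *
    (de x * (neg_part (W phi t x) + \sum_i `|coord phi t.+1 i x|))])%E).
  apply: ge0_expectation_le.
  - by apply: measurable_funM => //; exact: mneg.
  - do 2!apply: measurable_funM => //; apply: measurable_funD; first exact: mneg.
    by apply: measurable_sum => i; exact: measurableT_comp.
  - by move=> x; rewrite mulr_ge0 ?neg_part_ge0.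
  - by move=> x; rewrite ler_wpM2l// mulrDr de_neg lerDl mulr_ge0// sumr_ge0.
apply: le_trans (alP phi de rphi mde de0) _.
rewrite (eq_expectation P de_max) expectation_cst adde0; apply: ge0_expectation_le.
- by do 2!apply: measurable_funM => //; exact: mneg.
- by apply: measurable_funM => //; exact: mneg.
- by move=> x; rewrite !mulr_ge0 ?neg_part_ge0.
- move=> x; rewrite ler_wpM2l// /de; case: ifP => _; rewrite ?mul1r// mul0r.
  exact: neg_part_ge0.
Qed.

Lemma neg_part_wealth_weight t : (t <= T)%N -> exists2 ga, is_weight (F t) ga &
  forall phi, reduced phi ->
    ('E_P[fun x => ga x * neg_part (W phi t x)] <=
     'E_P[fun x => neg_part (W phi T x)])%E.
Proof.
move=> tT; rewrite -(subKn tT); move: (T - t)%N (leq_subr t T) => k {t tT}.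
elim: k => [|k IHk] kT.
  rewrite subn0; exists (cst 1) => [|phi _]; first exact: is_weight1.
  by under eq_expectation do rewrite mul1r.
have tS : (T - k)%N = (T - k.+1).+1 by rewrite subnSK.
have [ga wga gaP] := IHk (ltnW kT); rewrite tS in wga gaP.
have tT : (T - k.+1 < T)%N by rewrite -tS leq_subr.
have [al wal alP] := neg_part_wealth_step tT wga.
by exists al => // phi rphi; apply: le_trans (alP phi rphi) (gaP phi rphi).
Qed.

Variable K : R.

Let bounded_shortfall : set proc := [set phi | reduced phi /\
  ('E_P[fun x => neg_part (W phi T x)] <= K%:E)%E].

Let coord_weight_bounded t i : (t < T)%N ->
  weight_bounded P bounded_shortfall (F t) (fun phi => W phi t) ->
  weight_bounded P bounded_shortfall (F t) (fun phi => coord phi t.+1 i).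
Proof.
move=> tT [_ [de [C [wde deC]]]].
have [ga wga gaP] := neg_part_wealth_weight tT.
have [al wal alP] := reduced_one_period_bound tT tT wga.
have mgaW := measurable_wrtW (sF tT) wga.1.
have mdeW := measurable_wrtW (sF (ltnW tT)) wde.1.
have malW := measurable_wrtW (sF (ltnW tT)) wal.1.
have de0 x := weight_ge0 x wde; have ga0 x := weight_ge0 x wga.
have al0 x := weight_ge0 x wal.
split=> [phi [rphi _]|]; first exact: reduced_coord.
exists (fun x => al x * de x), (K + C); split; first exact: is_weightM.
move=> phi Aphi; have [rphi phiK] := Aphi.
have mcoord j : measurable_fun setT (coord phi t.+1 j).
  by apply: (measurable_wrtW (sF (ltnW tT))); exact: reduced_coord.
have mWt : measurable_fun setT (W phi t) by apply: measurable_W => //; exact: ltnW.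
have mneg : measurable_fun setT (fun x => neg_part (W phi t.+1 x)).
  by apply: measurable_neg_part; exact: measurable_W.
apply: (@le_trans _ _ ('E_P[fun x => al x *
    (de x * (neg_part (W phi t x) + \sum_j `|coord phi t.+1 j x|))])%E).
  apply: ge0_expectation_le.
  - by apply: measurable_funM; [exact: measurable_funM|exact: measurableT_comp].
  - do 2!apply: measurable_funM => //; apply: measurable_funD.
      exact: measurable_neg_part.
    by apply: measurable_sum => j; exact: measurableT_comp.
  - by move=> x; rewrite !mulr_ge0.
  - move=> x; rewrite -mulrA !ler_wpM2l// (bigD1 i)//= addrCA lerDl addr_ge0//.
      exact: neg_part_ge0.
    exact: sumr_ge0.
apply: le_trans (alP phi de rphi wde.1 de0) _; rewrite EFinD leeD//.
  apply: le_trans phiK; apply: le_trans (gaP phi rphi); apply: ge0_expectation_le.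
  - by do 2!apply: measurable_funM => //.
  - exact: measurable_funM.
  - by move=> x; rewrite !mulr_ge0// neg_part_ge0.
  - move=> x; rewrite ler_wpM2l// ler_piMl ?neg_part_ge0//.
    exact: weight_le1 wde.
apply: le_trans (deC phi Aphi); apply: ge0_expectation_le.
- by apply: measurable_funM => //; exact: measurable_maxr.
- by apply: measurable_funM => //; exact: measurableT_comp.
- by move=> x; rewrite mulr_ge0// le_max lexx orbT.
- by move=> x; rewrite ler_wpM2l// ge_max ler_norm normr_ge0.
Qed.

Let wealth_weight_bounded t : (t <= T)%N ->
  weight_bounded P bounded_shortfall (F t) (fun phi => W phi t).
Proof.
elim: t => [|t IHt] tT.
  split=> [phi [rphi _]|]; first exact: adapted_W.
  exists (cst 1), `|w0|; split=> [|phi _]; first exact: is_weight1.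
  rewrite (@eq_expectation _ _ _ _ _ (cst `|w0|)) ?expectation_cst// => x.
  by rewrite mul1r /W wealth0.
have next f : weight_bounded P bounded_shortfall (F t) f ->
    weight_bounded P bounded_shortfall (F t.+1) f.
  apply: (weight_bounded_mono (sF (ltnW tT)) (sF tT)).
  by case: filtF => _ _ + _; exact.
rewrite (_ : (fun phi => _) = fun phi x => W phi t x +
    \sum_i coord phi t.+1 i x * X t i x); last first.
  by apply/funext => phi; apply/funext => x; exact: wealthS.
apply: (weight_boundedD (sF tT)); first exact: next (IHt (ltnW tT)).
apply: (weight_bounded_sum (sF tT)) => i; apply: (weight_boundedM (sF tT)).
  by apply: next; apply: coord_weight_bounded => //; exact: IHt (ltnW tT).
exact: (adapted_DeltaS filtF).
Qed.

Theorem reduced_strategies_weight_bounded : exists a C, is_weight (F T) a /\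
  forall phi, reduced phi -> ('E_P[fun x => neg_part (W phi T x)] <= K%:E)%E ->
  forall (t : 'I_T) i, ('E_P[fun x => a x * `|coord phi t.+1 i x|] <= C%:E)%E.
Proof.
have [|a [C [wa aC]]] := @weight_bounded_common _ _ _ P _ bounded_shortfall
    ('I_T * 'I_d)%type (F T) (fun k phi => coord phi k.1.+1 k.2) (sF (leqnn T)).
  move=> [t i]; have tT := ltn_ord t.
  apply: (weight_bounded_mono (sF (ltnW tT)) (sF _)) => //.
    by case: filtF => _ _ + _; apply => //; exact: ltnW.
  by apply: coord_weight_bounded => //; apply: wealth_weight_bounded; exact: ltnW.
by exists a, C; split=> // phi rphi phiK t i; exact: (aC (t, i) phi (conj rphi phiK)).
Qed.

End reduced_strategies.

(** * The loss function and the optimal strategy *)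

Section loss.
Context {R : realType}.
Implicit Types V : R -> R.

Definition is_loss V := [/\ forall x, 0 <= V x, {homo V : x y /~ x <= y},
  forall x y l, 0 <= l <= 1 -> V (l * x + (1 - l) * y) <= l * V x + (1 - l) * V y &
  forall x c, c < V x -> \forall y \near x, c <= V y].

Lemma loss_mid V x y : is_loss V -> V ((x + y) / 2) <= (V x + V y) / 2.
Proof.
move=> [_ _ /(_ x y 2^-1) convV _].
have -> : (x + y) / 2 = 2^-1 * x + (1 - 2^-1) * y by field.
by apply: (le_trans (convV _)); lra.
Qed.

Lemma measurable_loss V : is_loss V -> measurable_fun setT V.
Proof.
move=> [_ antiV _ _]; apply: nonincreasing_measurable => // x y.
exact: antiV.
Qed.

Lemma utility_loss (U : R -> \bar R) : utility U -> (forall x, U x != -oo%E) ->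
  (lim (U x @[x --> +oo%R]) < +oo)%E ->
  exists B V, is_loss V /\ forall x, U x = (B - V x)%:E.
Proof.
move=> [U_neqy U_mono U_concave U_usc] U_neqNy limU.
have U_fin x : U x \is a fin_num by rewrite fin_numE U_neqy U_neqNy.
have UE x : U x = (fine (U x))%:E by rewrite fineK.
pose B := ereal_sup (range U).
have U_le x : (U x <= B)%E by apply: ereal_sup_ubound; exists x.
have B_fin : B \is a fin_num.
  rewrite fin_numElt (lt_le_trans _ (U_le 0)) ?ltNye ?U_neqNy//=.
  by rewrite (le_lt_trans _ limU)// (cvg_lim _ (nondecreasing_cvge U_mono)).
exists (fine B), (fun x => fine B - fine (U x)); split; last first.
  by move=> x; rewrite subKr -UE.
split=> [x|x y xy|x y l l01|x c c_lt].
- by rewrite subr_ge0 -lee_fin !fineK.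
- by rewrite lerD2l lerN2 -lee_fin -!UE; exact: U_mono.
- have := U_concave x y l l01; rewrite (UE x) (UE y) (UE (_ + _)).
  by rewrite -!EFinM -EFinD lee_fin; lra.
- have /U_usc : (U x < (fine B - c)%:E)%E by rewrite (UE x) lte_fin; lra.
  by apply: filterS => y; rewrite (UE y) lte_fin; lra.
Qed.

Lemma loss_chord_bound V a b x : is_loss V -> a < b -> V b < V a -> x < a ->
  a - x <= (b - a) / (V a - V b) * V x.
Proof.
move=> [V_ge0 _ convV _] ab Vab xa; have bx : 0 < b - x by lra.
have dV : 0 < V a - V b by rewrite subr_gt0.
pose l := (b - a) / (b - x).
have l01 : 0 <= l <= 1.
  apply/andP; split; first by apply: divr_ge0; lra.
  by rewrite ler_pdivrMr// mul1r; lra.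
have := convV x b l l01.
have -> : l * x + (1 - l) * b = a by rewrite /l; field; rewrite gt_eqF.
rewrite -(ler_pM2l bx) => chord.
have chordE : (b - x) * (l * V x + (1 - l) * V b) = (b - a) * V x + (a - x) * V b.
  by rewrite /l; field; rewrite gt_eqF.
rewrite mulrAC ler_pdivlMr//; move: chord; rewrite chordE.
by have := V_ge0 b; nra.
Qed.

Lemma loss_coercive V : is_loss V -> (forall x y, V x = V y) \/
  exists a b, [/\ 0 <= a, 0 <= b & forall x, neg_part x <= a + b * V x].
Proof.
move=> lossV; have [V_ge0 antiV _ _] := lossV.
have [cstV|ncstV] := pselect (forall x y, V x = V y); [by left|right].
have [a [b [ab Vab]]] : exists a b, a < b /\ V b < V a.
  apply: contrapT => no_drop; apply: ncstV => x y.
  wlog xy : x y / x <= y.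
    by move=> IH; have [xy|yx] := leP x y; [|symmetry]; apply: IH => //; exact: ltW.
  apply/eqP; rewrite eq_le (antiV _ _ xy) andbT leNgt; apply/negP => Vyx.
  apply: no_drop; exists x, y; split=> //; rewrite lt_neqAle xy andbT.
  by apply: contraTneq Vyx => ->; rewrite ltxx.
exists `|a|, ((b - a) / (V a - V b)).
have slope_ge0 : 0 <= (b - a) / (V a - V b) by rewrite divr_ge0// subr_ge0 ltW.
split=> // x; apply: (@le_trans _ _ (`|a| + neg_part (x - a))).
  have : x - a - `|a| <= x by have := lerNnormlW (lexx `|a|); lra.
  by move=> /le_neg_part; have := neg_partB (x - a) (normr_ge0 a); lra.
rewrite lerD2l; have [ax|xa] := leP a x.
  by rewrite neg_part_id0 ?subr_ge0// mulr_ge0.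
rewrite neg_part_le0 ?subr_le0 ?(ltW xa)// opprB.
exact: loss_chord_bound.
Qed.

End loss.

Section expected_utility.
Context {R : realType} {dO : measure_display} {Omega : measurableType dO}.
Variable P : probability Omega R.

Lemma Econv_cstB (B : R) (f : Omega -> R) : measurable_fun setT f ->
  (forall x, 0 <= f x) -> Econv P (fun x => (B - f x)%:E) = (B%:E - 'E_P[f])%E.
Proof.
move=> mf f0; rewrite /Econv; set h := fun x => (B - f x)%:E.
pose pos_part (r : R) := Num.max r 0.
have pos_ge0 r : 0 <= pos_part r by rewrite le_max lexx orbT.
have posE : (\int[P]_x h^\+ x)%E = 'E_P[fun x => pos_part (B - f x)]%E.
  by rewrite expectation.unlock; apply: eq_integral => x _; rewrite funeposE EFin_max.
have negE : (\int[P]_x h^\- x)%E = 'E_P[fun x => neg_part (B - f x)]%E.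
  by rewrite expectation.unlock; apply: eq_integral => x _; rewrite funenegE EFin_max.
have mBf : measurable_fun setT (fun x => B - f x) by exact: measurable_funB.
have mpos : measurable_fun setT (fun x => pos_part (B - f x)) by exact: measurable_maxr.
have mneg := measurable_neg_part mBf.
have neg_ge0 x : 0 <= neg_part (B - f x) := neg_part_ge0 (B - f x).
have negB_ge0 (x : Omega) : 0 <= cst (neg_part B) x := neg_part_ge0 B.
have pos_fin : ('E_P[fun x => pos_part (B - f x)])%E \is a fin_num.
  apply: (@expectation_bounded_fin_num _ _ _ _ _ (pos_part B)) => // x.
  by rewrite pos_ge0/= ge_max pos_ge0 andbT le_max gerBl f0.
have balance : ('E_P[f] + ('E_P[fun x => pos_part (B - f x)] + (neg_part B)%:E) =
    'E_P[fun x => neg_part (B - f x)] + (pos_part B)%:E)%E.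
  rewrite -(expectation_cst P (neg_part B)) -(expectation_cst P (pos_part B)).
  rewrite -!ge0_expectationD//.
  - apply: eq_expectation => x; have := pos_partB_neg_part B.
    by have := pos_partB_neg_part (B - f x); rewrite /pos_part /cst/=; lra.
  - by move=> x; exact: pos_ge0.
  - exact: measurable_funD.
  - by move=> x; rewrite addr_ge0.
rewrite posE negE; have := pos_partB_neg_part B; rewrite -/(pos_part B).
move: balance; rewrite -(fineK pos_fin) -EFinD /=.
have : (0 <= 'E_P[f])%E by exact: expectation_ge0.
have : (0 <= 'E_P[fun x => neg_part (B - f x)])%E.
  exact: expectation_ge0.
case: ('E_P[fun x => neg_part (B - f x)])%E => [b|//|//];
  case: ('E_P[f])%E => [e|//|//] //=.
by move=> _ _; rewrite -!EFinD => -[] balance B_parts; congr (_%:E); lra.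
Qed.

End expected_utility.

Section terminal_wealth.
Context {R : realType} {dO : measure_display} {Omega : measurableType dO}.
Variables (d T : nat).
Notation proc := (@process R _ Omega d).
Notation J := ('I_T * 'I_d)%type.
Implicit Types (S phi : proc) (y z : J -> Omega -> R).

Definition coords phi : J -> Omega -> R := fun k => coord phi k.1.+1 k.2.

Definition strategy_of y : proc := fun t x =>
  [tuple (if insub t.-1 is Some s then y (s, i) x else 0) | i < d].

Lemma strategy_ofK y : coords (strategy_of y) = y.
Proof.
apply/funext => -[t i]; apply/funext => x.
by rewrite /coords /coord tnth_mktuple/= valK.
Qed.

Definition terminal_wealth S w y x := w + \sum_k y k x * coords (DeltaS S) k x.

Lemma wealth_coords S w phi x : wealth S w phi T x = terminal_wealth S w (coords phi) x.
Proof.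
rewrite /wealth /terminal_wealth big_add1/= big_mkord; congr (_ + _).
by rewrite -(pair_bigA _ (fun (t : 'I_T) i => coord phi t.+1 i x *
  coord (DeltaS S) t.+1 i x)).
Qed.

Lemma terminal_wealth_midpoint S w y z x : terminal_wealth S w (midpoint y z) x =
  (terminal_wealth S w y x + terminal_wealth S w z x) / 2.
Proof. by rewrite /terminal_wealth /midpoint sum_mull_mid; field. Qed.

Lemma cvg_terminal_wealth S w (y : nat -> J -> Omega -> R) z x :
  (forall k, y n k x @[n --> \oo] --> z k x) ->
  terminal_wealth S w (y n) x @[n --> \oo] --> terminal_wealth S w z x.
Proof.
move=> yz; apply: cvgD; first exact: cvg_cst.
apply: cvg_fin_sum => k.
by apply: cvgM => //; exact: cvg_cst.
Qed.

End terminal_wealth.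

Arguments coords {R dO Omega d} T phi.

Section optimal_strategy.
Context {R : realType} {dO : measure_display} {Omega : measurableType dO}.
Variable P : probability Omega R.
Variables (d T : nat) (F : nat -> set (set Omega)).
Hypothesis filtF : filtration P F T.
Notation proc := (@process R _ Omega d).
Notation J := ('I_T * 'I_d)%type.
Variable Sfam : set proc.
Hypothesis aS : forall S, Sfam S -> adapted F T S.
Variables (V : R -> R) (w0 : R).
Hypothesis lossV : is_loss V.

Let sF := filtration_sub_sigma_algebra filtF.

Let V_ge0 x : 0 <= V x.
Proof. by case: lossV. Qed.

Definition expected_loss (S phi : proc) := ('E_P[fun x => V (wealth S w0 phi T x)])%E.

Lemma measurable_loss_wealth S phi : Sfam S -> strategies F T phi ->
  measurable_fun setT (fun x => V (wealth S w0 phi T x)).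
Proof.
move=> SS sphi; apply: (measurableT_comp (measurable_loss lossV)).
apply: (measurable_wrtW (sF (leqnn T))); apply: (adapted_wealth filtF) => //.
exact: aS.
Qed.

Lemma robust_valueP (U : R -> \bar R) B phi c : (forall x, U x = (B - V x)%:E) ->
  strategies F T phi ->
  (c%:E <= robust_value P F T Sfam U phi w0)%E <->
  forall S, Sfam S -> (expected_loss S phi <= (B - c)%:E)%E.
Proof.
move=> UE sphi.
have lossE S : Sfam S -> (c%:E <= Econv P (fun x => U (wealth S w0 phi T x)))%E =
    (expected_loss S phi <= (B - c)%:E)%E.
  move=> SS; under eq_fun do rewrite UE.
  rewrite Econv_cstB//; last exact: measurable_loss_wealth.
  rewrite -/(expected_loss S phi).
  have : (0 <= expected_loss S phi)%E by exact: expectation_ge0.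
  case: (expected_loss S phi) => [r _|_|//] //=.
  by rewrite -EFinB !lee_fin lerBrDl lerBrDr addrC.
split=> [c_le S SS|loss_le].
  rewrite -lossE//; apply: le_trans c_le _.
  by apply: ereal_inf_lbound; exists S.
by apply: le_ereal_inf_tmp => _ [S SS <-]; rewrite lossE//; exact: loss_le.
Qed.

Lemma value_fin_num (U : R -> \bar R) B : Sfam !=set0 ->
  (forall x, U x = (B - V x)%:E) ->
  value P F T Sfam U w0 \is a fin_num /\ (value P F T Sfam U w0 <= B%:E)%E.
Proof.
move=> [S SS] UE; set v := value P F T Sfam U w0.
have v_le : (v <= B%:E)%E.
  apply: ge_ereal_sup => _ [phi sphi <-]; apply: (@le_trans _ _ (Econv P
    (fun x => U (wealth S w0 phi T x)))).
    by apply: ereal_inf_lbound; exists S.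
  under eq_fun do rewrite UE.
  rewrite Econv_cstB//; last exact: measurable_loss_wealth.
  by rewrite -[leRHS]adde0 leeD2l// oppe_le0; exact: expectation_ge0.
pose phi0 : proc := fun _ _ => [tuple 0 | i < d].
have sphi0 : strategies F T phi0.
  apply/(strategiesP filtF) => t i tT; rewrite (_ : coord _ _ _ = cst 0)//.
  by apply/funext => x; rewrite /coord tnth_mktuple.
have wealth_phi0 S' x : wealth S' w0 phi0 T x = w0.
  rewrite /wealth big1 ?addr0// => s _; apply: big1 => i _.
  by rewrite tnth_mktuple mul0r.
have v_ge : ((B - V w0)%:E <= v)%E.
  apply: (@le_trans _ _ (robust_value P F T Sfam U phi0 w0)); last first.
    by apply: ereal_sup_ubound; exists phi0.
  apply/robust_valueP => // S' _; rewrite subKr -(expectation_cst P (V w0)).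
  rewrite le_eqVlt; apply/orP; left; apply/eqP.
  by apply: eq_expectation => x; rewrite wealth_phi0.
split=> //; rewrite fin_numElt (lt_le_trans _ v_ge) ?ltNyr//.
by rewrite (le_lt_trans v_le) ?ltry.
Qed.

Lemma expected_loss_midpoint S (y z : J -> Omega -> R) (e : \bar R) : Sfam S ->
  strategies F T (strategy_of y) -> strategies F T (strategy_of z) ->
  strategies F T (strategy_of (midpoint y z)) ->
  (expected_loss S (strategy_of y) <= e)%E ->
  (expected_loss S (strategy_of z) <= e)%E ->
  (expected_loss S (strategy_of (midpoint y z)) <= e)%E.
Proof.
move=> SS sy sz smid ye ze.
have my := measurable_loss_wealth SS sy; have mz := measurable_loss_wealth SS sz.
apply: (@le_trans _ _ ('E_P[fun x => 2^-1 * (V (wealth S w0 (strategy_of y) T x) +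
    V (wealth S w0 (strategy_of z) T x))])%E).
  apply: ge0_expectation_le => //.
  - exact: measurable_loss_wealth.
  - by apply: measurable_funM => //; exact: measurable_funD.
  - move=> x; rewrite !wealth_coords !strategy_ofK terminal_wealth_midpoint.
    by rewrite [leRHS]mulrC; exact: loss_mid.
rewrite ge0_expectationZl//; last 2 first.
- exact: measurable_funD.
- by move=> x; rewrite addr_ge0.
rewrite ge0_expectationD// lee_pdivrMl// mule_natl mule2n.
exact: leeD.
Qed.

Variable S0 : proc.
Hypothesis SS0 : Sfam S0.
Hypothesis naS0 : NA P F T S0.
Hypothesis inclS : forall S, Sfam S -> D_incl P F T S S0.
Variable p : nat -> 'I_d -> 'I_d -> Omega -> R.
Hypothesis pP : forall t, (t < T)%N ->
  is_null_projection P (F t) (coord (DeltaS S0) t.+1) (p t).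

Let reduced_strategy_ofP y : reduced P T F p (strategy_of y) <->
  (forall k : J, measurable_wrt (F k.1) (y k)) /\
  forall t : 'I_T, {ae P, forall x, forall k, \sum_i p t k i x * y (t, i) x = 0}.
Proof.
have yE (t : 'I_T) i : coord (strategy_of y) t.+1 i = y (t, i).
  by rewrite -[LHS]/(coords T (strategy_of y) (t, i)) strategy_ofK.
split=> [[/(strategiesP filtF) sy ry]|[sy ry]]; split.
- by move=> [t i]; rewrite -yE; exact: sy.
- move=> t; apply: filterS (ry t (ltn_ord t)) => x ryx k.
  by rewrite -[RHS](ryx k); apply: eq_bigr => i _; rewrite yE.
- apply/(strategiesP filtF) => t i tT; rewrite -[t]/(nat_of_ord (Ordinal tT)) yE.
  exact: (sy (Ordinal tT, i)).
- move=> t tT; apply: filterS (ry (Ordinal tT)) => x ryx k.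
  by rewrite -[RHS](ryx k); apply: eq_bigr => i _; rewrite -yE.
Qed.

Let near_optimal l (n : nat) : set (J -> Omega -> R) :=
  [set y | reduced P T F p (strategy_of y) /\
    forall S, Sfam S -> (expected_loss S (strategy_of y) <= (l + n.+1%:R^-1)%:E)%E].

Let near_optimal_midpoint l n y z : near_optimal l n y -> near_optimal l n z ->
  near_optimal l n (midpoint y z).
Proof.
move=> [ry ly] [rz lz].
have /reduced_strategy_ofP[my py] := ry; have /reduced_strategy_ofP[mz pz] := rz.
have rmid : reduced P T F p (strategy_of (midpoint y z)).
  apply/reduced_strategy_ofP; split=> [k|t].
    by apply: measurable_funM => //; exact: measurable_funD.
  apply: filterS2 (py t) (pz t) => x pyx pzx k.
  by rewrite sum_mulr_mid pyx pzx addr0 mul0r.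
split=> // S SS; apply: expected_loss_midpoint => //; [exact: ry.1|exact: rz.1|..].
- exact: rmid.1.
- exact: ly.
- exact: lz.
Qed.

Let near_optimal_exists l n : (exists2 phi, strategies F T phi &
    forall S, Sfam S -> (expected_loss S phi <= (l + n.+1%:R^-1)%:E)%E) ->
  near_optimal l n !=set0.
Proof.
move=> [phi sphi phil].
have [psi rpsi psiE] := reduced_exists filtF (aS SS0) pP sphi.
have rcoords : reduced P T F p (strategy_of (coords T psi)).
  apply/reduced_strategy_ofP; have [/(strategiesP filtF) spsi ppsi] := rpsi.
  by split=> [k|t]; [exact: spsi|exact: ppsi].
exists (coords T psi); split=> // S SS; apply: le_trans (phil S SS).
rewrite le_eqVlt; apply/orP; left; apply/eqP.
apply: ge0_ae_eq_expectation => //; [exact: measurable_loss_wealth rcoords.1|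
  exact: measurable_loss_wealth|].
apply: filterS (psiE S w0 (aS SS) (inclS SS)) => x <-.
by rewrite !wealth_coords strategy_ofK.
Qed.

Let expected_shortfall_bound a b (e : R) phi : 0 <= a -> 0 <= b ->
  (forall x, neg_part x <= a + b * V x) -> strategies F T phi ->
  (expected_loss S0 phi <= e%:E)%E ->
  ('E_P[fun x => neg_part (wealth S0 w0 phi T x)] <= (a + b * e)%:E)%E.
Proof.
move=> a0 b0 V_ge sphi loss_le; have mV := measurable_loss_wealth SS0 sphi.
apply: (@le_trans _ _ ('E_P[fun x => a + b * V (wealth S0 w0 phi T x)])%E).
  apply: ge0_expectation_le => //.
  - apply: measurable_neg_part; apply: (measurable_wrtW (sF (leqnn T))).
    by apply: (adapted_wealth filtF) => //; exact: aS.
  - by apply: measurable_funD => //; exact: measurable_funM.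
  - by move=> x; exact: neg_part_ge0.
rewrite ge0_expectationD//; last 2 first.
- exact: measurable_funM.
- by move=> x; rewrite mulr_ge0.
rewrite expectation_cst ge0_expectationZl// EFinD leeD2l// EFinM.
by rewrite lee_wpmul2l.
Qed.

Let near_optimal_cvg l a b : 0 <= a -> 0 <= b -> 0 <= l ->
  (forall x, neg_part x <= a + b * V x) -> (forall n, near_optimal l n !=set0) ->
  exists2 y, forall n, near_optimal l n (y n) &
    {ae P, forall x, forall k, cvgn (fun n => y n k x)}.
Proof.
move=> a0 b0 l0 V_ge near_optimal_neq0.
have [g [C [wg gC]]] := reduced_strategies_weight_bounded filtF (aS SS0) pP naS0 w0
  (a + b * (l + 1)).
have [|||||||y [Dy cvg_y]] := @midpoint_convex_ae_cvg _ _ _ P J (near_optimal l) g C;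
  last by exists y.
- move=> n y [ry ly]; split=> // S SS; apply: le_trans (ly S SS) _.
  by rewrite lee_fin lerD2l lef_pV2 ?posrE// ler_nat.
- exact: near_optimal_neq0.
- by move=> n y z; exact: near_optimal_midpoint.
- move=> n y [/reduced_strategy_ofP[my _] _] k.
  exact: (measurable_wrtW (sF (ltnW (ltn_ord k.1)))).
- exact: (measurable_wrtW (sF (leqnn T)) wg.1).
- by move=> x; exact: weight_gt0 wg.
- move=> n y [ry ly] [t i].
  have := gC _ ry _ t i; rewrite -[coord _ _ _]/(coords T (strategy_of y) (t, i)).
  rewrite strategy_ofK; apply; apply: expected_shortfall_bound => //; first exact: ry.1.
  apply: le_trans (ly S0 SS0) _.
  by rewrite lee_fin lerD2l invf_le1// ler1n.
Qed.

Let near_optimal_limit l (y : nat -> J -> Omega -> R) :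
  (forall n, near_optimal l n (y n)) ->
  {ae P, forall x, forall k, cvgn (fun n => y n k x)} ->
  exists2 phi, strategies F T phi &
    forall S, Sfam S -> (expected_loss S phi <= l%:E)%E.
Proof.
move=> Dy cvg_y.
have my n (k : J) : measurable_wrt (F k.1) (y n k).
  by have [/reduced_strategy_ofP[]] := Dy n.
have /choice[z zP] (k : J) : exists z : Omega -> R, measurable_wrt (F k.1) z /\
    forall x, cvgn (fun n => y n k x) -> y n k x @[n --> \oo] --> z x.
  exact: (measurable_fun_lim (fun n => my n k)).
have mz (k : J) : measurable_wrt (F k.1) (z k) by case: (zP k).
have sz : strategies F T (strategy_of z).
  apply/(strategiesP filtF) => t i tT; rewrite -[t]/(nat_of_ord (Ordinal tT)).
  rewrite -[coord _ _ _]/(coords T (strategy_of z) (Ordinal tT, i)) strategy_ofK.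
  exact: (mz (Ordinal tT, i)).
exists (strategy_of z) => // S SS.
apply: (expectation_fatou
  (f := fun n x => V (wealth S w0 (strategy_of (y n)) T x))) => //.
- by move=> n; apply: measurable_loss_wealth => //; case: (Dy n) => -[].
- exact: measurable_loss_wealth.
- apply: filterS cvg_y => x cvg_yx c; rewrite wealth_coords strategy_ofK => c_lt.
  have cvg_w : terminal_wealth S w0 (y n) x @[n --> \oo] --> terminal_wealth S w0 z x.
    by apply: cvg_terminal_wealth => k; case: (zP k) => _; exact.
  have [_ _ _ lscV] := lossV.
  have near_c : \forall n \near \oo, c <= V (terminal_wealth S w0 (y n) x).
    exact: cvg_w _ (lscV _ _ c_lt).
  apply: filterS near_c => n.
  by rewrite wealth_coords strategy_ofK.
- by move=> n; case: (Dy n) => _; exact.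
Qed.

Theorem expected_loss_level_attained l : 0 <= l ->
  (forall n, exists2 phi, strategies F T phi &
    forall S, Sfam S -> (expected_loss S phi <= (l + n.+1%:R^-1)%:E)%E) ->
  exists2 phi, strategies F T phi &
    forall S, Sfam S -> (expected_loss S phi <= l%:E)%E.
Proof.
move=> l0 near_l; have [cstV|[a [b [a0 b0 V_ge]]]] := loss_coercive lossV.
  have loss_cst S phi : expected_loss S phi = (V 0)%:E.
    by rewrite -(expectation_cst P (V 0)); apply: eq_expectation => x; exact: cstV.
  have [phi sphi _] := near_l 0%N; exists phi => // S SS; rewrite loss_cst.
  apply/lee_addgt0Pr => e e0; have [n _ nP] := near_infty_natSinv_lt (PosNum e0).
  have [psi _ /(_ S SS)] := near_l n; rewrite loss_cst => /le_trans; apply.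
  by rewrite -EFinD lee_fin lerD2l ltW//; exact: nP (leqnn n).
have [y Dy cvg_y] := near_optimal_cvg a0 b0 l0 V_ge
  (fun n => near_optimal_exists (near_l n)).
exact: near_optimal_limit Dy cvg_y.
Qed.

End optimal_strategy.

Theorem theorem3p4 (R : realType) (dO : measure_display)
  (Omega : measurableType dO) (P : probability Omega R) (d T : nat)
  (F : nat -> set (set Omega)) (Sfam : set (@process R _ Omega d))
  (U : R -> \bar R) (w0 : R) :
  filtration P F T ->
  Sfam !=set0 ->
  (forall S, Sfam S -> adapted F T S) ->
  Sstar P F T Sfam !=set0 ->
  utility U ->
  (forall x, U x != -oo%E) ->
  (lim (U x @[x --> +oo%R]) < +oo)%E ->
  exists phi_hat, strategies F T phi_hat /\
    value P F T Sfam U w0 = robust_value P F T Sfam U phi_hat w0 /\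
    (robust_value P F T Sfam U phi_hat w0 < +oo)%E.
Proof.
move=> filtF Sfam0 aS [S0 [SS0 naS0 inclS]] utilU U_neqNy limU.
have [B [V [lossV UE]]] := utility_loss utilU U_neqNy limU.
have [p pP] := null_projections_exist filtF S0.
have robustP c phi := @robust_valueP _ _ _ P _ _ _ filtF _ aS _ w0 lossV _ _ phi c UE.
have [v_fin v_le] := value_fin_num filtF aS w0 lossV Sfam0 UE.
set v := value P F T Sfam U w0 in v_fin v_le *.
have [||phi sphi phi_le] :=
  expected_loss_level_attained filtF aS lossV SS0 naS0 inclS pP
    (w0 := w0) (l := B - fine v).
- by rewrite subr_ge0 -lee_fin fineK.
- move=> n; have e0 : 0 < n.+1%:R^-1 :> R by rewrite invr_gt0.
  have [_ [phi sphi <-] v_lt] := ub_ereal_sup_adherent e0 v_fin.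
  exists phi => //; rewrite -addrA [- _ + _]addrC -opprB; apply/robustP => //.
  by rewrite EFinB fineK// ltW.
have v_eq : v = robust_value P F T Sfam U phi w0.
  apply/eqP; rewrite eq_le -{1}(fineK v_fin) (robustP _ _ sphi).2//=.
  by apply: ereal_sup_ubound; exists phi.
by exists phi; split=> //; split=> //; rewrite -v_eq -(fineK v_fin) ltry.
Qed.
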